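(* Let $B$ be the Borromean rings in $S^3$, and put \[\Omega_0=\left\{(\alpha_1,\alpha_2,\alpha_3)\in[0,\pi)^3\,\middle|\,2\,\mathrm{Im}\left(\Phi_B\left(\alpha_1,\alpha_2,\alpha_3;\frac{\min\{\alpha_1,\alpha_2,\alpha_3\}}{2}\right)\right)<\mathrm{Vol}(M_{\alpha_1,\alpha_2,\alpha_3}(B))\right\}.\] Let $(\alpha_1,\alpha_2,\alpha_3)\in\Omega_0$. For each integer $n\geq1$ and each $i=1,2,3$ let $j_i=j_i^{(n)}$ be a weight in $\{a/2\mid a\in\mathbb{Z},\ 0\leq a\leq (2n+1)-2\}$ such that the limit $\lim_{n\to\infty}\frac{j_i^{(n)}}{2n+1}$ exists and \[\left|8\pi\lim_{n\to\infty}\frac{j_i^{(n)}}{2n+1}-2\pi\right|=\alpha_i\qquad(i=1,2,3).\] Then \[\lim_{n\to\infty}\frac{4\pi}{2n+1}\log\left|V_{j_1^{(n)},j_2^{(n)},j_3^{(n)}}^{(2n+1)}(B)\right|=\mathrm{Vol}(M_{\alpha_1,\alpha_2,\alpha_3}(B)).\]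
   Context: Let $r=2n+1\geq 3$ be odd and $s=\exp(2\pi\sqrt{-1}/r)$. Put $\{m\}=s^m-s^{-m}$, $\{m;k\}=\prod_{i=0}^{k-1}\{m-i\}$ and $\{m\}!=\{m;m\}$ (so $\{0\}!=1$). For weights $j_1,j_2,j_3\in\{a/2\mid a\in\mathbb{Z},0\leq a\leq r-2\}$, the colored Jones invariant of the Borromean rings $B$ whose components are colored by $j_1,j_2,j_3$, at parameter $q=s^2=\exp(4\pi\sqrt{-1}/r)$, is given by \[V_{j_1,j_2,j_3}^{(r)}(B)=\sum_{k=0}^{k_{\max}}(-1)^k\frac{\{2j_1+1+k\}!\{2j_2+1+k\}!\{2j_3+1+k\}!}{\{1\}\{2j_1-k\}!\{2j_2-k\}!\{2j_3-k\}!}\left(\frac{\{k\}!}{\{2k+1\}!}\right)^2,\] where $k_{\max}=\min_{i=1,2,3}\{2j_i,\,r-(2j_i+1)-1\}$. The potential function is \[\Phi_B(\alpha_1,\alpha_2,\alpha_3;z)=\sum_{i=1}^3\left\{-\tfrac12\mathrm{Li}_2(e^{2\sqrt{-1}(\alpha_i/2+z)})+\tfrac12\mathrm{Li}_2(e^{2\sqrt{-1}(\alpha_i/2-z)})\right\}-\mathrm{Li}_2(e^{2\sqrt{-1}z})+\mathrm{Li}_2(e^{4\sqrt{-1}z})+(\alpha_1+\alpha_2+\alpha_3+5\pi)z-3z^2,\] where $\mathrm{Li}_2(w)=-\int_0^w\frac{\log(1-u)}{u}du$ is the dilogarithm, analytically continued to the complex plane cut along $[1,\infty)$ (and extended continuously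 to $w=1$). For real $x$, \[\mathrm{Im}\,\Phi_B(x)=-\sum_{i=1}^3\Delta\left(\tfrac{\alpha_i}{2},x\right)+2\Delta\left(\tfrac{\pi}{2},x\right)+\Delta(0,x),\] where $\Delta(a,b)=\Lambda(a+b)-\Lambda(a-b)$ and $\Lambda(t)=-\int_0^t\log|2\sin u|\,du$ is the Lobachevsky function. $M_{\alpha_1,\alpha_2,\alpha_3}(B)$ denotes the hyperbolic cone manifold with underlying space $S^3$ and singular set $B$ whose cone angle around the $i$-th component is $\alpha_i$ (cone angle $0$ means a complete cusp); it is hyperbolic for $0\leq\alpha_1,\alpha_2,\alpha_3<\pi$. $\mathrm{Vol}$ denotes hyperbolic volume. It is known (Mednykh) that \[\mathrm{Vol}(M_{\alpha_1,\alpha_2,\alpha_3}(B))=2\left\{\sum_{i=1}^3\Delta\left(\tfrac{\alpha_i}{2},\theta_B\right)-2\Delta\left(\tfrac{\pi}{2},\theta_B\right)-\Delta(0,\theta_B)\right\},\] where $\theta_B\in(0,\frac{\pi}{2})$ is determined by $T=\tan\theta_B>0$, $T^4-(N_1^2+N_2^2+N_3^2+1)T^2-N_1^2N_2^2N_3^2=0$, $N_i=\tan\frac{\alpha_i}{2}$. *)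

(* Defs.v *)
From mathcomp Require Import all_boot all_order all_algebra.
From mathcomp Require Import all_classical all_reals all_analysis.
From mathcomp Require Import complex.

Set Implicit Arguments.
Unset Strict Implicit.
Unset Printing Implicit Defensive.

Import Order.TTheory GRing.Theory Num.Theory.
Import numFieldNormedType.Exports.

Local Open Scope classical_set_scope.
Local Open Scope ring_scope.
Local Open Scope complex_scope.

Definition cexp (R : realType) (z : R[i]) : R[i] :=
  (expR (complex.Re z))%:C
    * (cos (complex.Im z) +i* sin (complex.Im z)).

(* principal argument, in ]-pi, pi]; irrelevant at 0 *)
Definition carg (R : realType) (z : R[i]) : R :=
  if 0 <= complex.Im z then acos (complex.Re z / Normc.normc z)
  else - acos (complex.Re z / Normc.normc z).

Definition clog (R : realType) (z : R[i]) : R[i] := ln (Normc.normc z) +i* carg z.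

(* -log(1 - u)/u integrated along the straight segment u = t w, 0 <= t <= 1.
   The segment avoids the cut [1, +oo[ when w does; at w = 1 the integrand has
   an integrable singularity and the Lebesgue integral is the continuous
   extension. *)
Definition Li2 (R : realType) (w : R[i]) : R[i] :=
  let f (t : R) := clog (1 - t%:C * w) / t%:C in
  - ((\int[@lebesgue_measure R]_(t in `[0, 1]) complex.Re (f t))
     +i* (\int[@lebesgue_measure R]_(t in `[0, 1]) complex.Im (f t))).

Definition qroot (R : realType) (r : nat) : R[i] :=
  cexp ((2 * pi / r%:R)%:C * 'i).

(* {m} *)
Definition qint (R : realType) (r : nat) (m : int) : R[i] :=
  qroot R r ^ m - qroot R r ^ (- m).

(* {m; k} *)
Definition qfalling (R : realType) (r : nat) (m : int) (k : nat) : R[i] :=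
  \prod_(i < k) qint R r (m - i%:Z).

(* {m}! *)
Definition qfact (R : realType) (r m : nat) : R[i] := qfalling R r m%:Z m.

(* A weight j, a half-integer with 0 <= j <= (r - 2) / 2, is encoded by the
   natural number a = 2 j. *)
Definition is_weight (r a : nat) : bool := (a <= r - 2)%N.

Definition weight_val (R : realType) (a : nat) : R := a%:R / 2.

Definition borromean_kmax (r : nat) (a : 'I_3 -> nat) : nat :=
  let m i := minn (a i) (r - (a i + 1) - 1)%N in
  minn (m 0) (minn (m 1) (m 2%:R)).

Definition borromean_jones (R : realType) (r : nat) (a : 'I_3 -> nat) : R[i] :=
  \sum_(0 <= k < (borromean_kmax r a).+1)
    (-1) ^+ k
    * ((\prod_(i < 3) qfact R r (a i + 1 + k)%N)
       / (qint R r 1 * \prod_(i < 3) qfact R r (a i - k)%N))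
    * (qfact R r k / qfact R r (2 * k + 1)%N) ^+ 2.

Definition Phi_B (R : realType) (al : 'I_3 -> R) (z : R[i]) : R[i] :=
  (\sum_(i < 3)
     (- (2^-1 * Li2 (cexp (2 * 'i * ((al i / 2)%:C + z))))
      + 2^-1 * Li2 (cexp (2 * 'i * ((al i / 2)%:C - z)))))
  - Li2 (cexp (2 * 'i * z)) + Li2 (cexp (4 * 'i * z))
  + (\sum_(i < 3) al i + 5 * pi)%:C * z - 3 * z ^+ 2.

Definition lobachevsky (R : realType) (t : R) : R :=
  if 0 <= t
  then - \int[@lebesgue_measure R]_(u in `[0, t]) ln `|2 * sin u|
  else \int[@lebesgue_measure R]_(u in `[t, 0]) ln `|2 * sin u|.

Definition Delta (R : realType) (a b : R) : R :=
  lobachevsky (a + b) - lobachevsky (a - b).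

Definition is_theta_B (R : realType) (al : 'I_3 -> R) (th : R) : Prop :=
  let N i := tan (al i / 2) in
  let T := tan th in
  0 < th < pi / 2 /\
  T ^+ 4 - (\sum_(i < 3) N i ^+ 2 + 1) * T ^+ 2 - \prod_(i < 3) N i ^+ 2 = 0.

Definition mednykh_value (R : realType) (al : 'I_3 -> R) (th : R) : R :=
  2 * (\sum_(i < 3) Delta (al i / 2) th - 2 * Delta (pi / 2) th - Delta 0 th).

Definition cone_angles (R : realType) : set ('I_3 -> R) :=
  [set al | forall i, 0 <= al i < pi].

Definition sphere3 (R : realType) : set 'rV[R]_4 :=
  [set x | \sum_(i < 4) x 0 i ^+ 2 = 1].

(* inverse stereographic projection R^3 -> S^3; the pole is (0, 0, 0, 1) *)
Definition inv_stereo (R : realType) (y : 'rV[R]_3) : 'rV[R]_4 :=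
  let n2 := \sum_(i < 3) y 0 i ^+ 2 in
  \row_(i < 4) ((if insub (val i) is Some j then 2 * y 0 (j : 'I_3)
                 else n2 - 1) / (n2 + 1)).

(* Three mutually perpendicular ellipses, in the coordinate planes y_i = 0; the
   index arithmetic in 'I_3 is modulo 3. *)
Definition borromean_ellipse (R : realType) (i : 'I_3) : set 'rV[R]_3 :=
  [set y | y 0 i = 0 /\ y 0 (i + 1) ^+ 2 + (y 0 (i + 2%:R) / 2) ^+ 2 = 1].

Definition borromean (R : realType) (i : 'I_3) : set 'rV[R]_4 :=
  @inv_stereo R @` @borromean_ellipse R i.

Definition cosh (R : realType) (x : R) : R := (expR x + expR (- x)) / 2.
Definition sinh (R : realType) (x : R) : R := (expR x - expR (- x)) / 2.
Definition acosh (R : realType) (x : R) : R := ln (x + Num.sqrt (x ^+ 2 - 1)).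

(* Model space H^3(b), 0 < b <= 2 pi: cylindrical coordinates (rho, phi, h)
   about a geodesic of cone angle b, i.e. the metric
   d rho^2 + sinh^2 rho d phi^2 + cosh^2 rho d h^2 with phi taken modulo b.
   H^3(2 pi) is hyperbolic space. *)
Definition cone_point (R : realType) (b : R) : set (R * R * R) :=
  [set p | 0 <= p.1.1 /\ 0 <= p.1.2 < b].

(* hyperbolic law of cosines; the angular gap is at most b / 2 <= pi.  This is
   a pseudo-distance: phi is immaterial where rho = 0. *)
Definition cone_dist (R : realType) (b : R) (p q : R * R * R) : R :=
  let gap := Num.min `|p.1.2 - q.1.2| (b - `|p.1.2 - q.1.2|) in
  acosh (cosh p.1.1 * cosh q.1.1 * cosh (p.2 - q.2)
         - sinh p.1.1 * sinh q.1.1 * cos gap).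

Definition cone_origin (R : realType) : R * R * R := (0, 0, 0).

(* (X, d) has around x an open ball isometric to a ball of H^3(b) centred on
   the axis *)
Definition locally_cone (R : realType) (T : Type) (X : set T) (d : T -> T -> R)
    (b : R) (x : T) : Prop :=
  exists2 e : R, 0 < e &
  let ball_x := [set y | X y /\ d x y < e] in
  exists f : T -> R * R * R,
    [/\ forall y, ball_x y ->
          cone_point b (f y) /\ cone_dist b (@cone_origin R) (f y) = d x y,
        forall y z, ball_x y -> ball_x z -> cone_dist b (f y) (f z) = d y z
      & forall p, cone_point b p -> cone_dist b (@cone_origin R) p < e ->
          exists2 y, ball_x y & cone_dist b (f y) p = 0].

(* 3-dimensional Hausdorff measure, normalized by the volume pi/6 of a Euclidean
   ball of diameter 1: on a hyperbolic cone manifold it is the hyperbolic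
   volume. *)
Definition hausdorff3_pre (R : realType) (T : Type) (X : set T)
    (d : T -> T -> R) (delta : R) : \bar R :=
  ereal_inf [set s | exists (U : nat -> set T) (D : nat -> R),
    [/\ X `<=` \bigcup_n U n,
        forall n, 0 <= D n <= delta,
        forall n y z, X y -> X z -> U n y -> U n z -> d y z <= D n
      & s = (\sum_(0 <= n <oo) ((D n) ^+ 3)%:E)%E]].

Definition volume3 (R : realType) (T : Type) (X : set T) (d : T -> T -> R)
    : \bar R :=
  ((pi / 6)%:E * ereal_sup [set hausdorff3_pre X d delta
                             | delta in [set delta : R | (0 < delta)%R]])%E.

(* components with cone angle 0 are cusps, hence removed *)
Definition cone_carrier (R : realType) (al : 'I_3 -> R) : set 'rV[R]_4 :=
  @sphere3 R `\` \bigcup_(i in [set i | al i = 0]) @borromean R i.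

(* d is the distance of a hyperbolic cone metric on S^3 with singular set the
   Borromean rings and cone angles al: a complete length metric (complete and
   with midpoints) of finite volume inducing the topology of S^3, locally
   isometric to H^3(al i) at the points of the i-th component and to H^3 off
   the rings. *)
Record hyp_cone_metric (R : realType) (al : 'I_3 -> R)
    (d : 'rV[R]_4 -> 'rV[R]_4 -> R) : Prop := HypConeMetric {
  hcm_ge0 : forall x y, cone_carrier al x -> cone_carrier al y -> 0 <= d x y ;
  hcm_eq0 : forall x y, cone_carrier al x -> cone_carrier al y ->
    d x y = 0 <-> x = y ;
  hcm_sym : forall x y, cone_carrier al x -> cone_carrier al y ->
    d x y = d y x ;
  hcm_triangle : forall x y z, cone_carrier al x -> cone_carrier al y ->
    cone_carrier al z -> d x z <= d x y + d y z ;
  hcm_topology : forall x, cone_carrier al x -> forall U : set 'rV[R]_4,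
    within (cone_carrier al) (nbhs x) U <->
    exists2 e : R, 0 < e & forall y, cone_carrier al y -> d x y < e -> U y ;
  hcm_midpoint : forall x y, cone_carrier al x -> cone_carrier al y ->
    exists m, [/\ cone_carrier al m, d x m = d x y / 2 & d m y = d x y / 2] ;
  hcm_complete : forall u : nat -> 'rV[R]_4,
    (forall n, cone_carrier al (u n)) ->
    (forall e : R, 0 < e -> exists N : nat, forall m n : nat,
       (N <= m)%N -> (N <= n)%N -> d (u m) (u n) < e) ->
    exists2 x, cone_carrier al x & (fun n => d (u n) x) @ \oo --> (0 : R) ;
  hcm_regular : forall x, cone_carrier al x ->
    (forall i, ~ borromean i x) ->
    locally_cone (cone_carrier al) d (2 * pi) x ;
  hcm_singular : forall x i, cone_carrier al x -> borromean i x ->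
    locally_cone (cone_carrier al) d (al i) x ;
  hcm_volume : volume3 (cone_carrier al) d \is a fin_num
}.

(* Vol(M_al(B)); 0 if there is no such metric *)
Definition borromean_volume (R : realType) (al : 'I_3 -> R) : R :=
  xget 0 [set fine (volume3 (cone_carrier al) d)
         | d in [set d | hyp_cone_metric al d]].

(* Mednykh's theorem, a known result of hyperbolic geometry: the geometric volume
   equals the Lobachevsky-function expression at theta_B. *)
Definition mednykh_formula (R : realType) : Prop :=
  forall (al : 'I_3 -> R) (th : R),
    cone_angles al -> is_theta_B al th ->
    borromean_volume al = mednykh_value al th.

Definition Omega0 (R : realType) : set ('I_3 -> R) :=
  [set al | cone_angles al /\
    2 * complex.Im
          (Phi_B al (Num.min (al 0) (Num.min (al 1) (al 2%:R)) / 2)%:C)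
    < borromean_volume al].

(* Main.v *)
(* Up to powers of the imaginary unit, which cancel, {m} is 2 sin (h m) with
   h = 2 pi / r, so the Jones invariant is a sum of real terms t_k; split it at
   K = floor (r / 4).

   For k >= K the terms have the same sign, since each {N_i + k} / sqrt (-1) with
   N_i = 2 j_i + 1 is then negative and each {N_i - k} / sqrt (-1) positive; and
   h ln |t_k| is uniformly close to P (h k), where P = Im Phi_B.  As P is odd
   about pi / 2 and its derivative changes sign once, at theta_B, the maximum of
   P over the range of h k is - P (theta_B) = Vol / 2 > 0.

   The terms with k < K can be much larger than their sum, which is e^{o(r)}.
   Indeed, when the third colour N_3 is replaced with an integer M <= K, the sum is a
   quantum 6j-symbol in disguise: expanding in N_1 and N_2 by the q-binomial
   theorem gives a symmetric kernel E_cd whose columns are orthogonal for positive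
   weights W_c, with W_d sum_c (W_c E_cd^2) independent of d; this bounds E_cd
   by a power of r over a power of min |{j}|.  The actual colour is reached by
   Lagrange interpolation in cos (2 h N_3) at the nodes M = 1, .., K, and since h K tends
   to pi / 2 the exponential growth rates in each interpolation coefficient
   cancel. *)

Require Import Defs.
From mathcomp Require Import all_boot all_order all_algebra.
From mathcomp Require Import all_classical all_reals all_analysis.
From mathcomp Require Import complex.
From mathcomp Require Import measurable_realfun.
From mathcomp Require Import ring lra zify.
Import Order.TTheory GRing.Theory Num.Theory.
Import numFieldNormedType.Exports.
Local Open Scope classical_set_scope.
Local Open Scope ring_scope.
Set Implicit Arguments.
Unset Strict Implicit.
Unset Printing Implicit Defensive.

(** * Sums truncated by an integral colour *)

(** The cut at K serves several purposes. For M <= K all {j} with 0 < j <= 2 M, up to powers of the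
    imaginary unit, and all cos (h c) with c <= M are positive, which the orthogonality argument
    needs. For k < K the quotient {N_3 + k; 2 k + 1} / {N_3} is a polynomial of degree below K in
    cos (2 h N_3), so K nodes determine it. At a node M the sum stops at k = M - 1 by itself,
    because {M - M} = 0.

    The logarithm of {j} is unbounded near the zeros of the sine, so factorials are compared with
    the Lobachevsky function in one direction only, by concavity; the exact value of the full
    product up to r - 1 supplies the other direction.

    Errors are tracked at a fixed level n rather than through limits: given eps, each factor
    e^{o(r)} is bounded by a power of E = exp (eps / h), and each h ln by a multiple of eps. The
    integers 3, 7, 13, 17, 23, 33, 34 in the bounds are tallies of such errors, and 57 is the margin
    by which the largest term has to exceed 1 for the tail to dominate the head. *)

Section TrigProducts.
Context {R : realType}.
Variable h : R.

(* [sg m], [sf m] are {m}, {m}! up to a power of the imaginary unit, and [sF k N] is {N + k; 2 k + 1}. *)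
Definition sg (x : R) : R := 2 * sin (h * x).
Definition sf (m : nat) : R := \prod_(1 <= j < m.+1) sg j%:R.
Definition sF (k : nat) (x : R) : R :=
  sg x * \prod_(1 <= j < k.+1) (sg (x + j%:R) * sg (x - j%:R)).

Lemma sf0 : sf 0 = 1. Proof. by rewrite /sf big_geq. Qed.
Lemma sfS m : sf m.+1 = sf m * sg m.+1%:R.
Proof. by rewrite /sf big_nat_recr. Qed.
Lemma sF0 x : sF 0 x = sg x. Proof. by rewrite /sF big_geq// mulr1. Qed.
Lemma sFS k x : sF k.+1 x = sF k x * (sg (x + k.+1%:R) * sg (x - k.+1%:R)).
Proof. by rewrite /sF big_nat_recr//= mulrA. Qed.
Lemma sg0 : sg 0 = 0. Proof. by rewrite /sg mulr0 sin0 mulr0. Qed.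
Lemma sF_nat k N : (k < N)%N -> sF k N%:R * sf (N - k.+1) = sf (N + k).
Proof.
elim: k => [|k IH] kN.
  by rewrite sF0 addn0; case: N kN => // N _; rewrite sfS subSS subn0 mulrC.
rewrite sFS addnS sfS -IH; last lia.
rewrite (_ : N - k.+1 = (N - k.+2).+1)%N; last lia.
rewrite sfS -natrB; last lia.
rewrite -natrD addnS (_ : N - k.+1 = (N - k.+2).+1)%N; last lia.
ring.
Qed.
Lemma sgN x : sg (- x) = - sg x.
Proof. by rewrite /sg mulrN sinN mulrN. Qed.

Lemma sgM x y : sg x * sg y = 2 * cos (h * (x - y)) - 2 * cos (h * (x + y)).
Proof. by rewrite /sg mulrBr mulrDr cosB cosD; ring. Qed.

Lemma cos2D_sin2 (x : R) : cos x ^+ 2 + sin x ^+ 2 - 1 = 0.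
Proof. by rewrite cos2Dsin2 subrr. Qed.

(** The trigonometric content of [qbinom_recurrence], left after division by a common q-binomial.
    The coefficients [a] and [g] are such that the right-hand side no longer depends on [c]. *)
Lemma step_identity (M c k : R) : cos (h * c) != 0 -> cos (h * (c + 1)) != 0 ->
  sin (h * (2 * c + 1)) != 0 ->
  let a := - (tan (h * (c + 1))) * (sg (M - c - 1) * sg (M + c + 1)) / sg (2 * c + 1) in
  let g := - (tan (h * c)) * (sg (M + c) * sg (M - c)) / sg (2 * c + 1) in
  let b := 2 * cos h + a + g in
  a * (sg (k - c) * sg (k - 1 - c)) + (b - 2 * cos (h * (2 * k - 1))) * (sg (k - c) * sg (k + c + 1))
   + g * (sg (k + c + 1) * sg (k + c)) = - (sg k * sg k * (sg (M + k) * sg (M - k))).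
Proof.
move=> cy0 cx0 s0 a g b.
set x := h * (c + 1) in cx0 *; set y := h * c in cy0 *.
have Ex : x = h * (c + 1) by [].
have Ey : y = h * c by [].
have sA : sin (h * (2 * c + 1)) = sin x * cos y + cos x * sin y.
  by rewrite -sinD; congr sin; rewrite Ex Ey; ring.
pose m := 2 * cos (h * (2 * M)).
have Ea : a = - (sin x / cos x) * (2 * (cos x ^+ 2 - sin x ^+ 2) - m) / (2 * (sin x * cos y + cos x * sin y)).
  rewrite /a /tan -/x sgM [sg (2 * c + 1)]/sg sA; congr (_ * (_ - _) / _).
    by rewrite !expr2 -cosD -cosN; congr (_ * cos _); rewrite Ex; ring.
  by rewrite /m; congr (_ * cos _); ring.
have Eg : g = - (sin y / cos y) * (2 * (cos y ^+ 2 - sin y ^+ 2) - m) / (2 * (sin x * cos y + cos x * sin y)).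
  rewrite /g /tan -/y sgM [sg (2 * c + 1)]/sg sA; congr (_ * (_ - _) / _).
    by rewrite !expr2 -cosD; congr (_ * cos _); rewrite Ey; ring.
  by rewrite /m; congr (_ * cos _); ring.
rewrite sA in s0.
have Hx := cos2D_sin2 x; have Hy := cos2D_sin2 y.
pose ch := cos x * cos y + sin x * sin y.
pose sh := sin x * cos y - cos x * sin y.
pose cA := cos x * cos y - sin x * sin y.
pose sn := sin x * cos y + cos x * sin y.
have Ech : cos h = ch by rewrite /ch -cosB; congr cos; rewrite Ex Ey; ring.
have Esh : sin h = sh by rewrite /sh -sinB; congr sin; rewrite Ex Ey; ring.
have EcA : cos (h * (2 * c + 1)) = cA by rewrite /cA -cosD; congr cos; rewrite Ex Ey; ring.
(* All that is used of [a] and [g] are two linear equations for [a + g] and [a - g]. The identity is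
   their combination with coefficients in [e] and [s], modulo the Pythagorean relations [Hh] and
   [Hes]. *)
have H1 : (a + g) * (ch + cA) - (m + 2 * sh ^+ 2 - 2 * (ch * cA)) = 0.

  rewrite Ea Eg /ch /cA /sh.
  by field: (sin2cos2 x) (sin2cos2 y); rewrite s0 cx0 cy0.
have H3 : sn * (a - g) - (sh * (a + g) + 2 * sh * (ch - cA)) = 0.
  rewrite Ea Eg /ch /cA /sh /sn.
  by field: (sin2cos2 x) (sin2cos2 y); rewrite s0 cx0 cy0.
pose e := cos (h * (2 * k)); pose s := sin (h * (2 * k)).
have Hes : e ^+ 2 + s ^+ 2 - 1 = 0 by exact: cos2D_sin2.
have Hh : ch ^+ 2 + sh ^+ 2 - 1 = 0 by rewrite -Ech -Esh; exact: cos2D_sin2.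
have P1 : sg (k - c) * sg (k - 1 - c) = 2 * ch - 2 * (e * cA + s * sn).
  rewrite sgM -Ech -EcA /sn -sA -cosB.
  by congr (_ * cos _ - _ * cos _); ring.
have P2 : sg (k - c) * sg (k + c + 1) = 2 * cA - 2 * (e * ch - s * sh).
  rewrite sgM -Ech -Esh -EcA -cosD -cosN.
  by congr (_ * cos _ - _ * cos _); ring.
have P3 : sg (k + c + 1) * sg (k + c) = 2 * ch - 2 * (e * cA - s * sn).
  rewrite sgM -Ech -EcA /sn -sA -cosD.
  by congr (_ * cos _ - _ * cos _); ring.
have P4 : cos (h * (2 * k - 1)) = e * ch + s * sh.
  by rewrite -Ech -Esh -cosB; congr cos; ring.
have P5 : sg k * sg k = 2 - 2 * e.
  rewrite sgM subrr mulr0 cos0 mulr1.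
  by congr (_ - _ * cos _); ring.
have P6 : sg (M + k) * sg (M - k) = 2 * e - m.
  by rewrite sgM; congr (_ * cos _ - _ * cos _); ring.
rewrite P1 P2 P3 P4 P5 P6 /b Ech; apply/eqP; rewrite -subr_eq0; apply/eqP.
clearbody a g; clear Ea Eg.
transitivity (2 * ((a + g) * (ch + cA) - (m + 2 * sh ^+ 2 - 2 * (ch * cA))) * (1 - e)
  - 2 * s * (sn * (a - g) - (sh * (a + g) + 2 * sh * (ch - cA)))
  + 4 * e * (e - 1) * (ch ^+ 2 + sh ^+ 2 - 1) - 4 * sh ^+ 2 * (e ^+ 2 + s ^+ 2 - 1)).
  ring.
by rewrite H1 H3 Hh Hes; ring.
Qed.

(** Pascal's rule for the coefficients [sf (2 * k).+1 * qbinom k c], divided by [qbinom k c]: going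
    up one level takes 2 cos (2 h k) times an entry plus its two neighbours in [c]. *)
Lemma binomial_identity (c k : R) :
  sg (2 * k) * sg (2 * k + 1) =
  2 * cos (h * (2 * k)) * (sg (k - c) * sg (k + c + 1))
  + sg (k + c + 1) * sg (k + c) + sg (k - c) * sg (k - 1 - c).
Proof.
rewrite !sgM.
pose A := h * (2 * c + 1); pose e := h * (2 * k).
have -> : h * (2 * k - (2 * k + 1)) = - h by ring.
have -> : h * (2 * k + (2 * k + 1)) = e + (e + h) by rewrite /e; ring.
have -> : h * (k - c - (k + c + 1)) = - A by rewrite /A; ring.
have -> : h * (k - c + (k + c + 1)) = e + h by rewrite /e; ring.
have -> : h * (k + c + 1 - (k + c)) = h by ring.
have -> : h * (k + c + 1 + (k + c)) = e + A by rewrite /e /A; ring.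
have -> : h * (k - c - (k - 1 - c)) = h by ring.
have -> : h * (k - c + (k - 1 - c)) = e - A by rewrite /e /A; ring.
rewrite -/e !cosN; clearbody A e; rewrite cosB !cosD !sinD; ring: (sin2cos2 e).
Qed.

(** Times [sf (2 * k).+1], this is the quantum binomial coefficient of 2 k + 1 over k - c. That
    factor is left out because it cancels a denominator of [jones_term]. *)
Definition qbinom (k c : nat) : R :=
  if (c <= k)%N then (sf (k - c) * sf (k + c).+1)^-1 else 0.

Variable M : nat.
Hypothesis M_gt0 : (0 < M)%N.
Hypothesis sg_gt0 : forall j : nat, (0 < j <= 2 * M)%N -> 0 < sg j%:R.

Let sg_neq0 (j : nat) : (0 < j <= 2 * M)%N -> sg j%:R != 0.
Proof. by move=> /sg_gt0 /lt0r_neq0. Qed.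

Lemma sf_gt0 m : (m <= 2 * M)%N -> 0 < sf m.
Proof.
elim: m => [|m IH] mM; first by rewrite sf0.
by rewrite sfS mulr_gt0 ?IH ?sg_gt0//; lia.
Qed.

Let sf_neq0 m : (m <= 2 * M)%N -> sf m != 0.
Proof. by move=> /sf_gt0 /lt0r_neq0. Qed.

(** Ratios of neighbouring entries are written through level [k.+1], hence without division. They
    survive at the edge c = k + 1, where [sg 0] accounts for the default value 0. *)
Lemma qbinom_stepE k c : (k < M)%N -> (c <= k.+1)%N ->
  qbinom k c = sg (k.+1%:R - c%:R) * sg (k.+1%:R + c%:R + 1) * qbinom k.+1 c.
Proof.
move=> kM ck; rewrite /qbinom ck; case: leqP => ck'; last first.
  by rewrite (_ : c = k.+1) ?subrr ?sg0 ?mul0r//; lia.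
rewrite -natrB// -natrD natr1 subSn// !addSn.
rewrite [sf (k - c).+1]sfS [sf (k + c).+2]sfS.
have ? : sg (k - c).+1%:R != 0 by apply: sg_neq0; lia.
have ? : sg (k + c).+2%:R != 0 by apply: sg_neq0; lia.
have ? : sf (k - c) != 0 by apply: sf_neq0; lia.
have ? : sf (k + c).+1 != 0 by apply: sf_neq0; lia.
by field; repeat (apply/andP; split => //).
Qed.

Lemma qbinom_stepSE k c : (k < M)%N -> (c <= k.+1)%N ->
  qbinom k c.+1 = sg (k.+1%:R - c%:R) * sg (k.+1%:R - 1 - c%:R) * qbinom k.+1 c.
Proof.
move=> kM ck; rewrite /qbinom ck; case: ltnP => ck'; last first.
  have [->|->] : c = k \/ c = k.+1 by lia.
    by rewrite -natr1 addrK subrr sg0 mulr0 mul0r.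
  by rewrite subrr sg0 !mul0r.
have -> : k.+1%:R - 1 - c%:R = (k - c)%:R :> R by rewrite -natr1 addrK natrB//; lia.
rewrite -natrB//.
rewrite (_ : k.+1 - c = (k - c.+1).+2)%N; last lia.
rewrite (_ : k - c = (k - c.+1).+1)%N; last lia.
rewrite addnS addSn [sf (k - c.+1).+2]sfS [sf (k - c.+1).+1]sfS [sf (k + c).+2]sfS.
have ? : sg (k - c.+1).+1%:R != 0 by apply: sg_neq0; lia.
have ? : sg (k - c.+1).+2%:R != 0 by apply: sg_neq0; lia.
have ? : sf (k - c.+1) != 0 by apply: sf_neq0; lia.
have ? : sf (k + c).+1 != 0 by apply: sf_neq0; lia.
have ? : sg (k + c).+2%:R != 0 by apply: sg_neq0; lia.
by field; repeat (apply/andP; split => //).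
Qed.

Lemma qbinom_stepPE k c : (k + c < (2 * M).-2)%N -> (c < k.+1)%N ->
  qbinom k c = sg (k.+1%:R + c.+1%:R + 1) * sg (k.+1%:R + c.+1%:R) * qbinom k.+1 c.+1.
Proof.
move=> kM; rewrite ltnS => ck; rewrite /qbinom ck ltnS ck subSS.
rewrite -natrD natr1 !addSn !addnS [sf (k + c).+3]sfS [sf (k + c).+2]sfS [sf (k + c).+1]sfS.
have ? : sf (k - c) != 0 by apply: sf_neq0; lia.
have ? : sf (k + c) != 0 by apply: sf_neq0; lia.
have ? : sg (k + c).+1%:R != 0 by apply: sg_neq0; lia.
have ? : sg (k + c).+2%:R != 0 by apply: sg_neq0; lia.
have ? : sg (k + c).+3%:R != 0 by apply: sg_neq0; lia.
by field; repeat (apply/andP; split => //).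
Qed.

Lemma qbinom_gt k c : (k < c)%N -> qbinom k c = 0.
Proof. by rewrite /qbinom ltnNge => /negbTE ->. Qed.

(** Moves the two shifts from [b] to [v]. At c = 0 the predecessor is 0: this is the reflection
    b(-1) = b(0) obeyed by the binomial coefficients, and the hypothesis on [v 0] is its counterpart
    v(-1) = v(0). *)
Lemma sum_by_parts (t : R) (b v : nat -> R) m :
  (forall c, t * v c.+1 = - (v c + v c.+2)) -> t * v 0%N = - (v 0%N + v 1%N) ->
  \sum_(c < m.+1) b c.-1 * v c + \sum_(c < m.+1) b c.+1 * v c
    + t * \sum_(c < m.+1) b c * v c = b m.+1 * v m - b m * v m.+1.
Proof.
move=> vS v0; elim: m => [|m IHm].
  transitivity (b 0%N * v 0%N + b 1%N * v 0%N + b 0%N * (t * v 0%N)).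
    by rewrite !big_ord1 /=; ring.
  by rewrite v0; ring.
rewrite !(big_ord_recr m.+1) /=.
transitivity (b m.+1 * v m - b m * v m.+1 + (b m * v m.+1 + b m.+2 * v m.+1
   + b m.+1 * (t * v m.+1))); first by rewrite -IHm; ring.
by rewrite vS; ring.
Qed.

(* the q-binomial theorem *)
Lemma sF_expansion k x n : (k < M)%N -> (k < n)%N ->
  sF k x = \sum_(c < n) (-1) ^+ c * (sf (2 * k).+1 * qbinom k c) * sg ((2 * c%:R + 1) * x).
Proof.
elim: k n => [|k IH] n kM kn.
  case: n kn => // n _; rewrite big_ord_recl big1 ?addr0 => [|i _]; last first.
    by rewrite qbinom_gt// mulr0 mulr0 mul0r.
  rewrite sF0 /qbinom /= expr0 sf0 mul1r mulr0 add0r !mul1r mulfV ?mul1r//.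
  by apply: sf_neq0; lia.
have kn' : (k < n)%N by lia.
rewrite sFS (IH n)//; last lia.
pose b c := sf (2 * k).+1 * qbinom k c.
pose v (c : nat) : R := (-1) ^+ c * sg ((2 * c%:R + 1) * x).
pose bp c := b c.-1.
pose q : R := 2 * cos (h * (2 * k.+1%:R)).
have Eq : sg (x + k.+1%:R) * sg (x - k.+1%:R) = q - 2 * cos (h * (2 * x)).
  by rewrite sgM; congr (_ * cos _ - _ * cos _); ring.
(* [v] samples a sine at equally spaced angles, so multiplication by 2 cos (2 h x) gives the sum of
   the two neighbours, negated because of the alternating sign. *)
have vS c : 2 * cos (h * (2 * x)) * v c.+1 = - (v c + v c.+2).
  rewrite /v !exprS /sg.
  have -> : h * ((2 * c.+1%:R + 1) * x) = h * (2 * x) + h * ((2 * c%:R + 1) * x).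
    by rewrite -natr1; ring.
  have -> : h * ((2 * c.+2%:R + 1) * x) = h * (2 * x) + (h * (2 * x) + h * ((2 * c%:R + 1) * x)).
    by rewrite -!natr1; ring.
  rewrite !sinD !cosD; ring: (sin2cos2 (h * (2 * x))).
have v0 : 2 * cos (h * (2 * x)) * v 0%N = - (v 0%N + v 1%N).
  rewrite /v expr0 expr1 /sg mulr0 add0r mul1r mul1r.
  have -> : h * ((2 * 1%:R + 1) * x) = h * (2 * x) + h * x by ring.
  have -> : h * (2 * x) = h * x + h * x by ring.
  rewrite !sinD !cosD; ring: (sin2cos2 (h * x)).

have bE c : (c < n)%N -> sf (2 * k.+1).+1 * qbinom k.+1 c = q * b c + bp c + b c.+1.
  move=> cn; have [ck|ck] := leqP c k.+1; last first.
    rewrite /bp /b; case: c cn ck => // c _ ck /=.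
    by rewrite !qbinom_gt ?mulr0 ?addr0//; lia.
  have Esf : sf (2 * k.+1).+1 = sf (2 * k).+1 * (sg (2 * k.+1%:R) * sg (2 * k.+1%:R + 1)).
    rewrite (_ : (2 * k.+1).+1 = (2 * k).+3)%N; last lia.
    rewrite 2!sfS -mulrA -!natrM natr1; congr (_ * (sg _%:R * sg _%:R)); lia.
  have Ebp : bp c = sf (2 * k).+1 * (sg (k.+1%:R + c%:R + 1) * sg (k.+1%:R + c%:R) * qbinom k.+1 c).
    rewrite /bp /=; case: c cn ck => [|c] cn ck.
      by rewrite /b qbinom_stepE//; [congr (_ * (_ * _)); rewrite subr0 addr0 mulrC|lia].
    by rewrite /b qbinom_stepPE//; lia.
  rewrite Ebp /b (@qbinom_stepE k)//; last lia.
  rewrite (@qbinom_stepSE k)//; last lia.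
  rewrite Esf (binomial_identity c%:R) /q; ring.
have bn : b n.-1 = 0 by rewrite /b qbinom_gt ?mulr0//; lia.
have -> : \sum_(c < n) (-1) ^+ c * (sf (2 * k.+1).+1 * qbinom k.+1 c) * sg ((2 * c%:R + 1) * x)
   = q * \sum_(c < n) b c * v c + (\sum_(c < n) bp c * v c + \sum_(c < n) b c.+1 * v c).
  rewrite mulr_sumr -!big_split /=; apply: eq_bigr => c _.
  by rewrite bE// /v; ring.
have -> : \sum_(c < n) bp c * v c + \sum_(c < n) b c.+1 * v c
   = - (2 * cos (h * (2 * x))) * \sum_(c < n) b c * v c.
  have nE : n = n.-1.+1 by lia.
  apply/eqP; rewrite mulNr -addr_eq0 nE (sum_by_parts b _ vS v0) -nE bn.
  by rewrite {1}/b qbinom_gt ?mulr0 ?mul0r ?subr0//; lia.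
rewrite mulNr -mulrBl mulr_sumr mulr_suml; apply: eq_bigr => c _.
by rewrite Eq /b /v; ring.
Qed.

(** * A tridiagonal operator and the orthogonality of the kernel *)

Definition racah_eigenvalue (c : nat) : R := 2 * cos (h * (2 * c%:R + 1)).

(** Thus, relative to level M - 1, [qbinom k d] is a Newton product of differences of eigenvalues.
    At d = k + 1 both sides vanish. *)
Lemma qbinom_eigen k d : (k < M)%N -> qbinom k d = (racah_eigenvalue d - racah_eigenvalue k.+1) * qbinom k.+1 d.
Proof.
move=> kM; have [dk|dk] := leqP d k.+1; last first.
  by rewrite !qbinom_gt ?mulr0//; lia.
rewrite qbinom_stepE// sgM /racah_eigenvalue -cosN.
by congr ((_ * cos _ - _ * cos _) * _); rewrite -?natr1; ring.
Qed.

(** With [gcoef] and [bcoef], the entries of a tridiagonal operator in [c], chosen to make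
    [qbinom_recurrence] hold. [acoef] vanishes at M - 1 and [gcoef] at 0, so the operator acts on
    the M points 0, .., M - 1. *)
Definition acoef (c : R) : R :=
  - tan (h * (c + 1)) * (sg (M%:R - c - 1) * sg (M%:R + c + 1)) / sg (2 * c + 1).
Definition gcoef (c : R) : R :=
  - tan (h * c) * (sg (M%:R + c) * sg (M%:R - c)) / sg (2 * c + 1).
Definition bcoef (c : R) : R := 2 * cos h + acoef c + gcoef c.

Lemma gcoef0 : gcoef 0 = 0.
Proof. by rewrite /gcoef mulr0 tan0 oppr0 !mul0r. Qed.

Definition phik (k : R) : R := - (sg k * sg k * (sg (M%:R + k) * sg (M%:R - k))).

(** The part of a summand with third colour M that remains after expanding in the first two colours,
    up to [sg 1]: the two factors [sf (2 * k).+1] of the expansions cancel the denominator. *)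
Definition Phik (k : nat) : R := (-1) ^+ k * sf k ^+ 2 * sF k M%:R.

Lemma PhikS k : Phik k.+1 = phik k.+1%:R * Phik k.
Proof. by rewrite /Phik /phik sFS sfS exprS; ring. Qed.

Lemma Phik_M : Phik M = 0.
Proof.
by rewrite -(prednK M_gt0) PhikS /phik prednK// subrr sg0; ring.
Qed.

Hypothesis cos_gt0 : forall c : nat, (c <= M)%N -> 0 < cos (h * c%:R).

Let cos_neq0 c : (c <= M)%N -> cos (h * c%:R) != 0.
Proof. by move=> /cos_gt0 /lt0r_neq0. Qed.

(** The operator is bidiagonal on the vectors [qbinom k]: an eigenvalue on level [k] plus a multiple
    of level [k.+1]. All entries on the left are multiples of [qbinom k.+1 c], which reduces the
    claim to [step_identity]. *)
Lemma qbinom_recurrence k c : (k < M)%N -> (c < M)%N ->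
  acoef c%:R * qbinom k c.+1 + bcoef c%:R * qbinom k c + gcoef c%:R * qbinom k c.-1
  = racah_eigenvalue k * qbinom k c + phik k.+1%:R * qbinom k.+1 c.
Proof.
move=> kM cM; have [ck|ck] := leqP c k.+1; last first.
  by case: c cM ck => // c cM ck /=; rewrite !qbinom_gt//; [ring|lia..].
have EY : racah_eigenvalue k = 2 * cos (h * (2 * k.+1%:R - 1)).
  by rewrite /racah_eigenvalue -natr1; congr (_ * cos (_ * _)); ring.
have Eg : gcoef c%:R * qbinom k c.-1
    = gcoef c%:R * (sg (k.+1%:R + c%:R + 1) * sg (k.+1%:R + c%:R)) * qbinom k.+1 c.
  case: c cM ck => [|c] cM ck; first by rewrite gcoef0 !mul0r.
  by rewrite qbinom_stepPE ?mulrA//=; lia.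
have c1 : cos (h * c%:R) != 0 by apply: cos_neq0; lia.
have c2 : cos (h * (c%:R + 1)) != 0 by rewrite natr1; apply: cos_neq0.
have s1 : sin (h * (2 * c%:R + 1)) != 0.
  have : sg (2 * c%:R + 1) != 0 by rewrite -natrM natr1; apply: sg_neq0; lia.
  by rewrite /sg mulf_eq0 negb_or => /andP[].
have := step_identity M%:R k.+1%:R c1 c2 s1.
rewrite -/(acoef c%:R) -/(gcoef c%:R) -/(bcoef c%:R) => H.
rewrite Eg EY (@qbinom_stepE k c)// (@qbinom_stepSE k c)//.
transitivity (qbinom k.+1 c * (- (sg k.+1%:R * sg k.+1%:R * (sg (M%:R + k.+1%:R) * sg (M%:R - k.+1%:R)))) + 2 * cos (h * (2 * k.+1%:R - 1)) * (sg (k.+1%:R - c%:R) * sg (k.+1%:R + c%:R + 1) * qbinom k.+1 c)); last by rewrite /phik; ring.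
by rewrite -H /bcoef; ring.
Qed.

(** The kernel E_cd of the overview. *)
Definition racah_sum (c d : nat) : R := \sum_(k < M) qbinom k c * Phik k * qbinom k d.

Lemma racah_sumC c d : racah_sum c d = racah_sum d c.
Proof. by apply: eq_bigr => k _; ring. Qed.

(** The operator in [c] yields a diagonal term and one raised to level k + 1; [qbinom_eigen] in [d]
    turns the latter into a difference of eigenvalues, and a shift of [k] leaves the eigenvalue of
    [d]. The boundary terms vanish: [Phik M] is 0, and at level 0 either d > 0 and [qbinom 0 d] is
    0, or d = 0 and the eigenvalues agree. *)
Lemma racah_sum_recurrence c d : (c < M)%N -> (d < M)%N ->
  acoef c%:R * racah_sum c.+1 d + bcoef c%:R * racah_sum c d + gcoef c%:R * racah_sum c.-1 d
  = racah_eigenvalue d * racah_sum c d.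
Proof.
move=> cM dM.
transitivity (\sum_(k < M) (racah_eigenvalue k * (qbinom k c * Phik k * qbinom k d)
    + (racah_eigenvalue d - racah_eigenvalue k.+1) * (qbinom k.+1 c * Phik k.+1 * qbinom k.+1 d))).
  rewrite /racah_sum !mulr_sumr -!big_split /=; apply: eq_bigr => k _.
  transitivity ((acoef c%:R * qbinom k c.+1 + bcoef c%:R * qbinom k c + gcoef c%:R * qbinom k c.-1)
    * (Phik k * qbinom k d)); first by ring.
  rewrite qbinom_recurrence// PhikS mulrDl; congr (_ + _); first by ring.
  by rewrite (@qbinom_eigen k d)//; ring.
pose t k := (racah_eigenvalue d - racah_eigenvalue k) * (qbinom k c * Phik k * qbinom k d).
rewrite big_split /= -[X in _ + X](_ : \sum_(k < M) t k.+1 = _)//.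
have t0 : t 0%N = 0.
  rewrite /t; case: d {cM dM t} => [|d]; first by rewrite subrr mul0r.
  by rewrite (@qbinom_gt 0 d.+1)// !mulr0.
have tM : t M = 0 by rewrite /t Phik_M; ring.
have -> : \sum_(k < M) t k.+1 = \sum_(k < M) t k.
  by rewrite -[LHS]add0r -{1}t0 -(big_ord_recl _ (fun k => t k)) big_ord_recr /= tM addr0.
by rewrite -big_split /= /racah_sum mulr_sumr; apply: eq_bigr => k _; rewrite /t; ring.
Qed.

Definition racah_weight (c : nat) : R := sg (2 * c%:R + 1).

Lemma racah_weight_gt0 c : (c < M)%N -> 0 < racah_weight c.
Proof. by move=> cM; rewrite /racah_weight -natrM natr1; apply: sg_gt0; lia. Qed.

(** Detailed balance between the two off-diagonals. *)
Lemma racah_weight_symmetry c : (c.+1 < M)%N -> racah_weight c * acoef c%:R = racah_weight c.+1 * gcoef c.+1%:R.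
Proof.
move=> cM; have /lt0r_neq0 W1 := @racah_weight_gt0 c ltac:(lia).
have /lt0r_neq0 W2 := @racah_weight_gt0 c.+1 ltac:(lia).
have WE (x y : R) : y != 0 -> y * (x / y) = x by move=> y0; rewrite mulrC divfK.
rewrite /acoef /gcoef -/(racah_weight c) -/(racah_weight c.+1) !WE//.
by rewrite natr1; congr (_ * _); rewrite mulrC -natr1; congr (sg _ * sg _); ring.
Qed.

Lemma acoef_last : acoef M.-1%:R = 0.
Proof.
by rewrite /acoef -addrA -opprD natr1 prednK// subrr sg0; ring.
Qed.

Lemma cos_decr (c d : nat) : (c < d)%N -> (d < M)%N -> racah_eigenvalue c != racah_eigenvalue d.
Proof.
move=> cd dM; rewrite -subr_eq0 /racah_eigenvalue.
have -> : 2 * cos (h * (2 * c%:R + 1)) - 2 * cos (h * (2 * d%:R + 1))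
   = sg (d%:R - c%:R) * sg (d%:R + c%:R + 1).
  by rewrite sgM -[in RHS]cosN; congr (_ * cos _ - _ * cos _); ring.
by rewrite mulf_neq0// -?natrB ?(ltnW cd)// -?natrD ?natr1; apply: sg_neq0; lia.
Qed.

Lemma racah_eigenvalue_inj (c d : nat) : (c < M)%N -> (d < M)%N -> racah_eigenvalue c = racah_eigenvalue d -> c = d.
Proof.
move=> cM dM /eqP E; apply/eqP; case: ltngtP E => // cd.
  by rewrite (negbTE (cos_decr cd dM)).
by rewrite eq_sym (negbTE (cos_decr cd cM)).
Qed.

(* the columns of [racah_sum] are eigenvectors, for distinct eigenvalues, of a
   tridiagonal operator that is self-adjoint for the weights [racah_weight] *)
Lemma racah_sum_orthogonal d e : (d < M)%N -> (e < M)%N -> d != e ->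
  \sum_(c < M) racah_weight c * racah_sum c d * racah_sum c e = 0.
Proof.
move=> dM eM de.
have Yde : racah_eigenvalue d - racah_eigenvalue e != 0.
  by rewrite subr_eq0; apply: contra_neq de => /racah_eigenvalue_inj ->.
apply: (mulfI Yde); rewrite mulr0 mulr_sumr.
(* The discrete Wronskian of the columns [d] and [e]. It vanishes at both ends, at 0 by definition
   and at M because [acoef] is 0 at M - 1. *)
pose U c := if c is c'.+1 then racah_weight c' * acoef c'%:R * (racah_sum c d * racah_sum c' e - racah_sum c' d * racah_sum c e) else 0.
have UE c : (c < M)%N -> (racah_eigenvalue d - racah_eigenvalue e) * (racah_weight c * racah_sum c d * racah_sum c e) = U c.+1 - U c.
  move=> cM; transitivity (racah_weight c * ((racah_eigenvalue d * racah_sum c d) * racah_sum c e - racah_sum c d * (racah_eigenvalue e * racah_sum c e))).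
    by ring.
  rewrite -!racah_sum_recurrence//.
  transitivity (U c.+1 + racah_weight c * gcoef c%:R * (racah_sum c.-1 d * racah_sum c e - racah_sum c d * racah_sum c.-1 e)).
    by rewrite /U; ring.
  congr (_ + _); case: c cM => [|c] cM /=; first by rewrite gcoef0 mulr0 mul0r oppr0.
  by rewrite -racah_weight_symmetry//; ring.
under eq_bigr => c _ do rewrite UE//.
rewrite -(big_mkord xpredT (fun c => U c.+1 - U c)) telescope_sumr// /U.
by rewrite subr0 -(prednK M_gt0) acoef_last; ring.
Qed.

Definition racah_norm (d : nat) : R := \sum_(c < M) racah_weight c * racah_sum c d * racah_sum c d.

(** Only k = M - 1 contributes, so this column has a closed form. It calibrates the norms of all the
    others. *)
Lemma racah_sum_last c : (c < M)%N -> racah_sum c M.-1 = (-1) ^+ M.-1 * sf M.-1 ^+ 2 / (sf (M.-1 - c) * sf (M.-1 + c).+1).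
Proof.
move=> cM; have ME := prednK M_gt0.
have last_lt : (M.-1 < M)%N by lia.
rewrite /racah_sum (bigD1 (Ordinal last_lt))//= big1 ?addr0 => [|k]; last first.
  rewrite -val_eqE /= => kM; have ? := ltn_ord k.
  by rewrite (@qbinom_gt k M.-1) ?mulr0//; lia.
rewrite /qbinom leqnn (_ : (c <= M.-1)%N); last lia.
rewrite subnn sf0 mul1r.
have := @sF_nat M.-1 M ltac:(lia); rewrite ME subnn sf0 mulr1 /Phik => ->.
rewrite (_ : M + M.-1 = (M.-1 + M.-1).+1)%N; last lia.
have ? : sf (M.-1 - c) != 0 by apply: sf_neq0; lia.
have ? : sf (M.-1 + c).+1 != 0 by apply: sf_neq0; lia.
have ? : sf (M.-1 + M.-1).+1 != 0 by apply: sf_neq0; lia.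
by field; repeat (apply/andP; split => //).
Qed.

(** The matrix A of the kernel is symmetric, so orthogonality reads A W A = D with D diagonal.
    Evaluating A W A W A in two ways gives D W A = A W D, and the entry at (M - 1, d), where A is
    nonzero, is the claim. *)
Lemma racah_norm_const d : (d < M)%N -> racah_norm d * racah_weight d = racah_norm M.-1 * racah_weight M.-1.
Proof.
move=> dM; pose A := \matrix_(i < M, j < M) racah_sum i j.
pose W := diag_mx (\row_(i < M) racah_weight i); pose D := diag_mx (\row_(i < M) racah_norm i).
have AWA : A *m W *m A = D.
  apply/matrixP => i j; rewrite !mxE.
  under eq_bigr => c _ do rewrite mul_mx_diag !mxE.
  have [->|ij] := eqVneq i j.
    by rewrite mulr1n; apply: eq_bigr => c _; rewrite (racah_sumC _ j); ring.
  rewrite mulr0n -[RHS](@racah_sum_orthogonal i j)//.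
  by apply: eq_bigr => c _; rewrite (racah_sumC i c); ring.
have DWA : D *m W *m A = A *m W *m D by rewrite -AWA !mulmxA.
have last_lt : (M.-1 < M)%N by lia.
have := congr1 (fun B : 'M[R]_M => B (Ordinal last_lt) (Ordinal dM)) DWA.
rewrite -mulmxA !mul_diag_mx !mul_mx_diag !mxE /= => E.
have E0 : racah_sum M.-1 d != 0.
  rewrite racah_sumC racah_sum_last// mulf_neq0//.
    rewrite mulf_neq0 ?signr_eq0// expf_neq0//; apply: sf_neq0; lia.
  by rewrite invr_eq0 mulf_neq0//; apply: sf_neq0; lia.
by apply: (mulfI E0); transitivity (racah_sum M.-1 d * racah_weight d * racah_norm d); [|rewrite -E]; ring.
Qed.

Lemma racah_sum_weighted_bound c d : (c < M)%N -> (d < M)%N ->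
  racah_weight c * racah_weight d * racah_sum c d ^+ 2 <= racah_norm M.-1 * racah_weight M.-1.
Proof.
move=> cM dM; rewrite -(racah_norm_const dM) mulrAC; apply: ler_wpM2r.
  by apply/ltW/racah_weight_gt0.
rewrite /racah_norm (bigD1 (Ordinal cM))//= expr2 mulrA lerDl sumr_ge0// => i _.
by rewrite -mulrA mulr_ge0 ?sqr_ge0 ?ltW ?racah_weight_gt0// -expr2 sqr_ge0.
Qed.

(** The right-hand side increases with [c]: its successive ratios are sg (M + c + 1) / sg (M - c -
    1), and the difference of numerator and denominator is 2 cos (h M) sg (c + 1) >= 0. This bounds
    the last column of the kernel by 1 / sg M. *)
Lemma sf_central_bound c : (c < M)%N ->
  sf M.-1 ^+ 2 * sg M%:R <= sf (M.-1 - c) * sf (M.-1 + c).+1.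
Proof.
elim: c => [|c IH] cM.
  by rewrite subn0 addn0 -[X in sg X%:R](prednK M_gt0) sfS le_eqVlt; apply/orP; left; apply/eqP; ring.
apply: le_trans (IH _) _; first lia.
rewrite (_ : M.-1 - c = (M.-1 - c.+1).+1)%N; last lia.
rewrite addnS [sf (M.-1 - c.+1).+1]sfS [sf (M.-1 + c).+2]sfS -mulrA.
apply: ler_wpM2l; first by apply/ltW/sf_gt0; lia.
rewrite mulrC; apply: ler_wpM2l; first by apply/ltW/sf_gt0; lia.
rewrite (_ : (M.-1 - c.+1).+1 = M - c.+1)%N; last lia.
rewrite (_ : (M.-1 + c).+2 = M + c.+1)%N; last lia.
rewrite natrB 1?natrD; last lia.
rewrite -subr_ge0 (_ : _ - _ = 2 * cos (h * M%:R) * sg c.+1%:R).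
  apply: mulr_ge0; last by apply/ltW/sg_gt0; lia.
  by apply: mulr_ge0 => //; apply/ltW/cos_gt0.
by rewrite /sg mulrDr mulrBr sinD sinB; ring.
Qed.

(** The term t_k of the overview. The colours N_i are real arguments here, since the bounds at an
    integral third colour hold for all real values of the other two. *)
Definition jones_term (k : nat) (x y z : R) : R :=
  (-1) ^+ k * sF k x * sF k y * sF k z * (sf k / sf (2 * k).+1) ^+ 2 / sg 1.

(** The q-binomial theorem in [x] and in [y], followed by an exchange of sums, separates the two
    colours from [k]. *)
Lemma sum_jones_term_racah_sum x y : \sum_(k < M) jones_term k x y M%:R =
  \sum_(c < M) \sum_(d < M) (-1) ^+ c * (-1) ^+ d
     * (sg ((2 * c%:R + 1) * x) * sg ((2 * d%:R + 1) * y)) * racah_sum c d / sg 1.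
Proof.
transitivity (\sum_(k < M) \sum_(c < M) \sum_(d < M) (-1) ^+ c * (-1) ^+ d
     * (sg ((2 * c%:R + 1) * x) * sg ((2 * d%:R + 1) * y)) * (qbinom k c * Phik k * qbinom k d) / sg 1).
  apply: eq_bigr => k _.
  have k0 : sf (2 * k).+1 != 0 by apply: sf_neq0; have := ltn_ord k; lia.
  pose S t := \sum_(c < M) (-1) ^+ c * qbinom k c * sg ((2 * c%:R + 1) * t).
  have SE t : sF k t = sf (2 * k).+1 * S t.
    rewrite (@sF_expansion k t M)// /S mulr_sumr.
    by apply: eq_bigr => c _; ring.
  transitivity (Phik k / sg 1 * (S x * S y)).
    have ? : sg 1 != 0 by apply: (@sg_neq0 1%N); lia.
    by rewrite /jones_term (SE x) (SE y) /Phik; field; rewrite k0 andbT.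
  rewrite /S big_distrlr /= mulr_sumr; apply: eq_bigr => c _.
  by rewrite mulr_sumr; apply: eq_bigr => d _; ring.
rewrite exchange_big /=; apply: eq_bigr => c _.
rewrite exchange_big /=; apply: eq_bigr => d _.
by rewrite /racah_sum mulr_sumr mulr_suml; apply: eq_bigr => k _; ring.
Qed.

Lemma sg_max x : `|sg x| <= 2.
Proof. by rewrite /sg normrM ger0_norm// ler_piMr// sin_max. Qed.

(** The last column is at most 1 / w and the weights are at most 2, so the constant norm times
    weight is at most 4 M / w^2. Each entry squared, times two weights of size at least w, is below
    this constant. *)
Lemma racah_sum_bound (w : R) c d : 0 < w -> (forall j : nat, (0 < j < 2 * M)%N -> w <= sg j%:R) ->
  (c < M)%N -> (d < M)%N -> `|racah_sum c d| <= 2 * M%:R / w ^+ 2.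
Proof.
move=> w0 wsg cM dM.
have WcE e : (e < M)%N -> w <= racah_weight e.
  by move=> eM; rewrite /racah_weight -natrM natr1; apply: wsg; lia.
have Ew e : (e < M)%N -> racah_sum e M.-1 ^+ 2 <= w ^- 2.
  move=> eM; have s0 : 0 < sg M%:R by apply: sg_gt0; lia.
  have d0 : 0 < sf (M.-1 - e) * sf (M.-1 + e).+1.
    by rewrite mulr_gt0// sf_gt0//; lia.
  rewrite -real_normK ?num_real// -exprVn lerXn2r ?nnegrE ?invr_ge0 ?(ltW w0)//.
  rewrite racah_sum_last// -mulrA normrM normrX normrN1 expr1n mul1r.
  rewrite ger0_norm ?divr_ge0 ?sqr_ge0 ?(ltW d0)// ler_pdivrMr//.
  have := sf_central_bound eM; rewrite -ler_pdivlMr// => /le_trans; apply.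
  by rewrite mulrC ler_pM2r// lef_pV2 ?posrE//; apply: wsg; lia.
have m1 : racah_norm M.-1 * racah_weight M.-1 <= 4 * M%:R / w ^+ 2.
  have -> : 4 * M%:R / w ^+ 2 = (\sum_(c < M) 2 / w ^+ 2) * 2.
    by rewrite sumr_const card_ord -mulr_natr; ring.
  have Wle e : racah_weight e <= 2 by apply: le_trans (ler_norm _) (sg_max _).
  have Wge e : (e < M)%N -> 0 <= racah_weight e by move=> /racah_weight_gt0/ltW.
  apply: ler_pM => //; [| apply: Wge; lia |].
    apply: sumr_ge0 => e _; rewrite -mulrA mulr_ge0 ?Wge//.
    by rewrite -expr2 sqr_ge0.
  apply: ler_sum => e _; rewrite -mulrA -expr2.
  by apply: ler_pM; rewrite ?Wge ?sqr_ge0 ?Ew.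
have M1 : 1 <= M%:R :> R by rewrite ler1n.
rewrite -ler_sqr ?nnegrE ?divr_ge0 ?mulr_ge0 ?(ltW w0)//.
rewrite real_normK ?num_real//.
have W0 : 0 < w ^+ 2 by rewrite exprn_gt0.
have : w ^+ 2 * racah_sum c d ^+ 2 <= 4 * M%:R / w ^+ 2.
  apply: le_trans m1; apply: le_trans (racah_sum_weighted_bound cM dM).
  by rewrite ler_wpM2r ?sqr_ge0// expr2 ler_pM ?WcE ?(ltW w0).
rewrite mulrC -ler_pdivlMr// => /le_trans; apply.
have -> : (2 * M%:R / w ^+ 2) ^+ 2 = 4 * (M%:R * M%:R) / w ^+ 2 / w ^+ 2 :> R.
  by field; exact: lt0r_neq0.
apply: ler_wpM2r; first by rewrite invr_ge0 ltW.
apply: ler_wpM2r; first by rewrite invr_ge0 ltW.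
by rewrite ler_pM2l// ler_peMr// (le_trans ler01).
Qed.

Lemma sum_jones_term_bound (w x y : R) : 0 < w -> (forall j : nat, (0 < j < 2 * M)%N -> w <= sg j%:R) ->
  `|\sum_(k < M) jones_term k x y M%:R| <= 8 * M%:R ^+ 3 / w ^+ 3.
Proof.
move=> w0 wsg; rewrite sum_jones_term_racah_sum.
have -> : 8 * M%:R ^+ 3 / w ^+ 3 = \sum_(c < M) \sum_(d < M) 8 * M%:R / w ^+ 3.
  rewrite sumr_const card_ord -[RHS]mulr_natr sumr_const card_ord -[X in _ = X * _]mulr_natr.
  by field; exact: lt0r_neq0.
apply: le_trans (ler_norm_sum _ _ _) _; apply: ler_sum => c _.
apply: le_trans (ler_norm_sum _ _ _) _; apply: ler_sum => d _.
have s1 : w <= sg 1 by apply: (wsg 1%N); lia.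
have := sg_max ((2 * d%:R + 1) * y); have := sg_max ((2 * c%:R + 1) * x).
move: (sg 1) s1 => S s1.
move: (sg ((2 * c%:R + 1) * x)) (sg ((2 * d%:R + 1) * y)) => X Y HX HY.
rewrite !normrM !normrX !normrN1 !expr1n !mul1r normfV.
have -> : 8 * M%:R / w ^+ 3 = 2 * 2 * (2 * M%:R / w ^+ 2) * w^-1.
  by field; exact: lt0r_neq0.
apply: ler_pM; rewrite ?invr_ge0 ?mulr_ge0//.
  apply: ler_pM; rewrite ?mulr_ge0//; last exact: racah_sum_bound.
  by apply: ler_pM => //; exact: normr_ge0.
have s10 := lt_le_trans w0 s1.
by rewrite gtr0_norm// lef_pV2 ?posrE.
Qed.
End TrigProducts.

(** * Real form of the Jones invariant *)

Section Jones.
Context {R : realType}.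
Local Open Scope complex_scope.

Definition cis (x : R) : R[i] := cos x +i* sin x.

Lemma cisD x y : cis (x + y) = cis x * cis y.
Proof. by rewrite /cis cosD sinD; simpc; congr (_ +i* _); ring. Qed.

Lemma cis0 : cis 0 = 1. Proof. by rewrite /cis cos0 sin0. Qed.

Lemma cisN x : cis (- x) = (cis x)^-1.
Proof.
have xu : cis x \is a GRing.unit.
  by apply/unitrPr; exists (cis (- x)); rewrite -cisD subrr cis0.
by apply: (mulrI xu); rewrite -cisD subrr cis0 mulrV.
Qed.

Lemma cisX x (n : nat) : cis x ^+ n = cis (x * n%:R).
Proof.
elim: n => [|n IH]; first by rewrite mulr0 cis0.
by rewrite exprS IH -cisD -natr1; congr cis; ring.
Qed.

Lemma cis_exprz x (m : int) : cis x ^ m = cis (x * m%:~R).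
Proof.
case: m => n; first by rewrite -[LHS]/(cis x ^+ n) cisX.
by rewrite -[LHS]/((cis x ^+ n.+1)^-1) cisX -cisN NegzE mulrNz mulrN.
Qed.

Variable n : nat.
Hypothesis n_gt0 : (0 < n)%N.
Let r := (2 * n + 1)%N.
Definition qangle (m : nat) : R := 2 * pi / m%:R.
Let h := qangle r.

Lemma qrootE : qroot R r = cis h.
Proof.
rewrite /qroot /cexp.
have -> : (2 * pi / r%:R)%:C * 'i = 0 +i* h :> R[i] by simpc.
by rewrite /= expR0 mul1r.
Qed.

Lemma qintE (m : int) : qint R r m = 'i * (sg h m%:~R)%:C.
Proof.
rewrite /qint qrootE !cis_exprz mulrNz mulrN /cis cosN sinN /sg; simpc.
by congr (_ +i* _); ring.
Qed.

Lemma qfactE (m : nat) : qfact R r m = 'i ^+ m * (sf h m)%:C.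
Proof.
rewrite /qfact /qfalling.
have -> : \prod_(i < m) qint R r (m%:Z - i%:Z) = \prod_(i < m) ('i * (sg h i.+1%:R)%:C).
  rewrite (reindex_inj rev_ord_inj); apply: eq_bigr => i _ /=.
  rewrite qintE; congr (_ * (sg h _)%:C).
  rewrite (_ : (m%:Z - _)%R = i.+1%:Z)//; have := ltn_ord i; lia.
rewrite big_split /= prodr_const card_ord -rmorph_prod /=.
by rewrite /sf big_add1 /= big_mkord.
Qed.

Lemma qangle_gt0 : 0 < h.
Proof. by rewrite divr_gt0 ?mulr_gt0 ?pi_gt0// ltr0n /r addn1. Qed.

Lemma qangle_r : h * r%:R = 2 * pi.
Proof. by rewrite divfK// pnatr_eq0 /r addn1. Qed.

Lemma sg_qangle_gt0 (j : nat) : (0 < j)%N -> (2 * j < r)%N -> 0 < sg h j%:R.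
Proof.
move=> j0 jr; rewrite mulr_gt0// sin_gt0_pi// mulr_gt0 ?qangle_gt0 ?ltr0n//=.
have -> : pi = h * (r%:R / 2) by rewrite mulrA qangle_r; field.
by rewrite ltr_pM2l ?qangle_gt0// ltr_pdivlMr// -natrM ltr_nat mulnC.
Qed.

Lemma sg_qangle_sym (x : R) : sg h (r%:R - x) = - sg h x.
Proof.
by rewrite /sg mulrBr qangle_r sinB [2 * pi]mulr_natl sin2pi cos2pi; ring.
Qed.

Lemma sg_qangle_lt0 (j : nat) : (r < 2 * j)%N -> (j < r)%N -> sg h j%:R < 0.
Proof.
move=> jr rj; rewrite -[j%:R](subKr r%:R) sg_qangle_sym oppr_lt0 -natrB; last exact: ltnW.
by apply: sg_qangle_gt0; lia.
Qed.

Lemma sg_qangle_neq0 (j : nat) : (0 < j < r)%N -> sg h j%:R != 0.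
Proof.
move=> /andP[j0 jr]; have [jl|jl] := ltnP (2 * j) r.
  by rewrite gt_eqF// sg_qangle_gt0.
by rewrite lt_eqF// sg_qangle_lt0//; move: jl; rewrite /r; lia.
Qed.

Lemma sf_qangle_neq0 m : (m < r)%N -> sf h m != 0.
Proof.
elim: m => [|m IH] mr; first by rewrite sf0 oner_neq0.
by rewrite sfS mulf_neq0 ?IH ?sg_qangle_neq0//; lia.
Qed.

Lemma jones_real (a : 'I_3 -> nat) : (forall i, is_weight r (a i)) ->
  borromean_jones R r a =
  (\sum_(0 <= k < (borromean_kmax r a).+1)
     jones_term h k (a 0).+1%:R (a 1).+1%:R (a 2%:R).+1%:R)%:C.
Proof.
move=> wa; rewrite /borromean_jones rmorph_sum /=; apply: eq_big_nat => k /andP[_ kk].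
have kE i : (k <= a i)%N /\ (k <= r - (a i + 1) - 1)%N.
  have ki : (k <= minn (a i) (r - (a i + 1) - 1))%N.
    apply: leq_trans (_ : borromean_kmax r a <= _)%N; first by rewrite -ltnS.
    rewrite /borromean_kmax; case: i => -[|[|[|//]]] i.
    - rewrite (_ : Ordinal i = 0); last exact/val_inj. lia.
    - rewrite (_ : Ordinal i = 1); last exact/val_inj. lia.
    - rewrite (_ : Ordinal i = 2%:R); last exact/val_inj. lia.
  by move: ki; rewrite leq_min => /andP[].
pose u : R[i] := 'i ^+ k.
have i0 : 'i != 0 :> R[i] by rewrite eq_complex /= oner_eq0 andbF.
have u0 : u != 0 by rewrite expf_neq0.
have u4 : u ^+ 4 = 1.
  by rewrite /u -exprM mulnC exprM (_ : 'i ^+ 4 = 1) ?expr1n// (_ : 4 = 2 * 2)%N// exprM sqr_i sqrrN expr1n.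
have sFE i : qfact R r (a i + 1 + k)%N = u ^+ 2 * 'i * (sF h k (a i).+1%:R)%:C * qfact R r (a i - k)%N.
  have [k1 k2] := kE i.
  rewrite !qfactE addn1 -(@sF_nat _ h k (a i).+1)// subSS rmorphM /=.
  rewrite (_ : (a i).+1 + k = (2 * k).+1 + (a i - k))%N; last lia.
  by rewrite exprD exprS mulnC exprM -/u; ring.
have q0 i : qfact R r (a i - k)%N != 0.
  rewrite qfactE mulf_neq0 ?expf_neq0//.
  rewrite eq_complex /= eqxx andbT; apply: sf_qangle_neq0.
  by move: (wa i) (kE i); rewrite /is_weight /r; lia.
rewrite !big_ord_recl !big_ord0 !mulr1.
rewrite (_ : lift ord0 (lift ord0 ord0) = 2%:R :> 'I_3); last exact/val_inj.
rewrite (_ : lift ord0 ord0 = 1 :> 'I_3); last exact/val_inj.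
rewrite !sFE (qintE 1) (qfactE k) (qfactE (2 * k + 1)) addn1.
have -> : 'i ^+ (2 * k).+1 = u ^+ 2 * 'i :> R[i] by rewrite exprS mulnC exprM -/u mulrC.
have s1 : sg h 1 != 0 by rewrite (sg_qangle_neq0 (j := 1)) // /r; lia.
have kr : (2 * k < r - 1)%N by have := kE 0; have := wa 0; rewrite /is_weight; lia.
have s2 : sf h (2 * k).+1 != 0 by rewrite sf_qangle_neq0//; lia.
move: (q0 0) (q0 1) (q0 2%:R) s1 s2; rewrite /jones_term -/u.
rewrite -[(sg h 1%:~R)%:C]/((sg h 1)%:C) -[ord0]/(0 : 'I_3).
move: (qfact R r (a 0 - k)) (qfact R r (a 1 - k)) (qfact R r (a 2%:R - k)) => Q0 Q1 Q2.
move: (sg h 1) (sf h (2 * k).+1) (sf h k) => S1 S2 S.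
move: (sF h k (a 0).+1%:R) (sF h k (a 1).+1%:R) (sF h k (a 2%:R).+1%:R) => F0 F1 F2.
move=> Q0n Q1n Q2n S1n S2n.
rewrite !(rmorphM, rmorphXn, rmorphN1, fmorphV) /=.
have {}S1n : S1%:C != 0 :> R[i] by rewrite eq_complex /= eqxx andbT.
have {}S2n : S2%:C != 0 :> R[i] by rewrite eq_complex /= eqxx andbT.
(* With u = i^k, the three quotients of factorials give u^6 i^3, {1} gives 1 / i and the square
   gives (u / (u^2 i))^2, in all u^4 = 1. *)
transitivity (u ^+ 4 * ((-1) ^+ k * F0%:C * F1%:C * F2%:C * (S%:C / S2%:C) ^+ 2 / S1%:C)).
  by field; rewrite u0 i0 Q0n Q1n Q2n S1n S2n.
by rewrite u4 mul1r.
Qed.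
End Jones.

(** * Interpolation in the third colour *)

Section Interpolation.
Context {R : realType}.

Lemma lagrange_interpolation (K : nat) (s : 'I_K -> R) (p : {poly R}) (x : R) :
  injective s -> (size p <= K)%N ->
  p.[x] = \sum_(i < K) p.[s i] * \prod_(j < K | j != i) ((x - s j) / (s i - s j)).
Proof.
move=> sI pK.
pose l i := \prod_(j < K | j != i) ((s i - s j)^-1 *: ('X - (s j)%:P)).
pose q := \sum_(i < K) p.[s i] *: l i.
have lE i y : (l i).[y] = \prod_(j < K | j != i) ((y - s j) / (s i - s j)).
  by rewrite horner_prod; apply: eq_bigr => j _; rewrite hornerZ hornerXsubC mulrC.
suff {1}-> : p = q.
  by rewrite horner_sum; apply: eq_bigr => i _; rewrite hornerZ lE.
apply/eqP; rewrite -subr_eq0; apply/eqP.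
apply: (@roots_geq_poly_eq0 _ _ [seq s i | i : 'I_K]).
- apply/allP => _ /mapP[i _ ->]; rewrite /root hornerD hornerN horner_sum (bigD1 i)//=.
  rewrite hornerZ lE big1 => [|j ji]; last by rewrite divff// subr_eq0 (inj_eq sI) eq_sym.
  rewrite mulr1 big1 ?addr0 ?subrr// => j ji.
  by rewrite hornerZ lE (bigD1 i) 1?eq_sym//= subrr mul0r mul0r mulr0.
- by rewrite map_inj_uniq ?enum_uniq.
rewrite size_map size_enum_ord; apply: leq_trans (size_polyD _ _) _.
rewrite geq_max pK size_polyN; apply: leq_trans (size_sum _ _ _) _.
apply/bigmax_leqP => i _; apply: leq_trans (size_scale_leq _ _) _.
rewrite /l scaler_prod; apply: leq_trans (size_scale_leq _ _) _.
apply: leq_trans (size_prod_leq _ _) _.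
under eq_bigr do rewrite size_XsubC.
have := cardC1 i; rewrite sum_nat_const card_ord => ->.
by have := ltn_ord i; lia.
Qed.

Variable h : R.

(** The Lagrange basis polynomial in 2 cos (2 h z) at the node [m], times sg z / sg m: dividing
    [sF k z] by [sg z] is what leaves a polynomial. *)
Definition lagrange_coef (K : nat) (z : R) (m : nat) : R :=
  sg h z / sg h m%:R * \prod_(j < K | j.+1 != m)
    ((sg h (z + j.+1%:R) * sg h (z - j.+1%:R)) / (sg h (m%:R + j.+1%:R) * sg h (m%:R - j.+1%:R))).

Lemma sg_prod_cos x (j : nat) :
  sg h (x + j%:R) * sg h (x - j%:R) = 2 * cos (h * (2 * j%:R)) - 2 * cos (h * (2 * x)).
Proof. by rewrite sgM; congr (_ * cos _ - _ * cos _); ring. Qed.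

(** [sF k z / sg z] is a polynomial of degree k < K in 2 cos (2 h z), hence determined by the K
    nodes. *)
Lemma sF_interpolation (K k : nat) z : (k < K)%N ->
  (forall m : nat, (0 < m <= K)%N -> sg h m%:R != 0) ->
  (forall i j : nat, (0 < i <= K)%N -> (0 < j <= K)%N -> i != j -> sg h (i%:R + j%:R) * sg h (i%:R - j%:R) != 0) ->
  sF h k z = \sum_(i < K) lagrange_coef K z i.+1 * sF h k i.+1%:R.
Proof.
move=> kK s0 s1.
pose X x := 2 * cos (h * (2 * x)).
pose s (i : 'I_K) := X i.+1%:R.
have sI : injective s.
  move=> i j ij; apply/eqP; apply: contraT => ji.
  have := s1 i.+1 j.+1 (ltn_ord i) (ltn_ord j); rewrite eqSS => /(_ ji).
  by rewrite sg_prod_cos -/(X i.+1%:R) -/(X j.+1%:R) -/(s i) -/(s j) ij subrr eqxx.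
pose p := \prod_(1 <= j < k.+1) ((X j%:R)%:P - 'X : {poly R}).
have pE x : sF h k x = sg h x * p.[X x].
  rewrite /sF horner_prod; congr (_ * _); apply: eq_bigr => j _.
  by rewrite sg_prod_cos hornerD hornerN hornerX hornerC.
have pK : (size p <= K)%N.
  apply: leq_trans kK; rewrite /p big_add1 /= big_mkord.
  apply: leq_trans (size_prod_leq _ _) _.
  under eq_bigr do rewrite -opprB size_polyN size_XsubC.
  by rewrite sum_nat_const card_ord; lia.
rewrite pE (lagrange_interpolation _ sI pK) mulr_sumr; apply: eq_bigr => i _.
rewrite pE -/(s i) /lagrange_coef.
have -> : \prod_(j < K | j.+1 != i.+1)
    ((sg h (z + j.+1%:R) * sg h (z - j.+1%:R)) / (sg h (i.+1%:R + j.+1%:R) * sg h (i.+1%:R - j.+1%:R)))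
  = \prod_(j < K | j != i) ((X z - s j) / (s i - s j)).
  apply: eq_big => [j|j _]; first by rewrite eqSS.
  rewrite !sg_prod_cos -/(X j.+1%:R) -/(X z) -/(X i.+1%:R) -/(s i) -/(s j).
  by rewrite -opprB -[s j - s i]opprB invrN mulrNN.
have si : sg h i.+1%:R != 0 by apply: s0; exact: ltn_ord.
move: (sg h z) (sg h i.+1%:R) si p.[s i] (\prod_(_ < _ | _) _) => A B B0 C D.
by field.
Qed.

(** The interpolation coefficients do not depend on [k], so they come out of the sum. At the node i
    + 1 the terms with k > i contain the factor [sg 0], which shortens the inner sum to the length
    required by the orthogonality bound. *)
Lemma sum_jones_term_interpolation (K : nat) x y z :
  (forall m : nat, (0 < m <= K)%N -> sg h m%:R != 0) ->
  (forall i j : nat, (0 < i <= K)%N -> (0 < j <= K)%N -> i != j -> sg h (i%:R + j%:R) * sg h (i%:R - j%:R) != 0) ->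
  \sum_(k < K) jones_term h k x y z =
  \sum_(i < K) lagrange_coef K z i.+1 * \sum_(k < i.+1) jones_term h k x y i.+1%:R.
Proof.
move=> s0 s1.
transitivity (\sum_(i < K) lagrange_coef K z i.+1 * \sum_(k < K) jones_term h k x y i.+1%:R).
  under [RHS]eq_bigr do rewrite mulr_sumr.
  rewrite exchange_big /=; apply: eq_bigr => k _.
  rewrite /jones_term (@sF_interpolation K k z)//.
  rewrite mulr_sumr !mulr_suml; apply: eq_bigr => i _; ring.
apply: eq_bigr => i _; congr (_ * _).
rewrite (big_ord_widen _ (fun k => jones_term h k x y i.+1%:R) (ltn_ord i)).
rewrite [LHS](bigID (fun k : 'I_K => (k < i.+1)%N)) /= [X in _ + X]big1 ?addr0// => k.
rewrite -leqNgt => ik.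
have F0 : sF h k i.+1%:R = 0.
  rewrite /sF (big_cat_nat (n := i.+1))//=; last by rewrite ltnS ltnW.
  by rewrite (big_nat_recl k i.+1)//= subrr sg0 mulr0 !(mul0r, mulr0).
by rewrite /jones_term F0; ring.
Qed.
End Interpolation.

(** * The Lobachevsky function *)

Section Integrability.
Context {R : realType}.
Notation mu := (@lebesgue_measure R).

(** Monotone convergence along closed subintervals, on which the fundamental theorem of calculus
    bounds the integral by 2 B. *)
Lemma integrable_bounded_primitive (f F : R -> R) (a b B : R) : a < b ->
  (forall x, a < x < b -> 0 <= f x) ->
  (forall x, a < x < b -> {for x, continuous f}) ->
  (forall x, a < x < b -> is_derive x 1 F (f x)) ->
  (forall x, a < x < b -> `|F x| <= B) ->
  mu.-integrable `]a, b[ (EFin \o f).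
Proof.
move=> ab f0 cf dF FB.
(* The offset 3 makes 2 e(n) < b - a already at n = 0. *)
pose e (n : nat) := (b - a) / n.+3%:R.
have e0 n : 0 < e n by rewrite divr_gt0 ?subr_gt0.
have e_half n : a + e n < b - e n.
  rewrite ltrBrDl addrCA -ltrBrDl -mulr2n -mulr_natr /e -mulrA gtr_pMr ?subr_gt0//.
  by rewrite mulrC ltr_pdivrMr// mul1r ltr_nat.
pose A n : set R := `[a + e n, b - e n]%classic.
have sA n x : A n x -> a < x < b.
  rewrite /A /= in_itv /= => /andP[x1 x2].
  rewrite (lt_le_trans _ x1) ?ltrDl//= (le_lt_trans x2)//.
  by rewrite ltrBlDr ltrDl.
have mf : measurable_fun `]a, b[ f.
  apply: open_continuous_measurable_fun => // x.
  by rewrite inE /= in_itv /=; exact: cf.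
have UA : \bigcup_n A n = `]a, b[%classic.
  apply/seteqP; split=> x; first by move=> [n _ /sA]; rewrite /= in_itv.
  rewrite /= in_itv /= => /andP[ax xb].
  have d0 : 0 < Num.min (x - a) (b - x) / (b - a).
    by rewrite divr_gt0 ?subr_gt0// lt_min !subr_gt0 ax.
  have [N _ HN] := near_infty_natSinv_lt (PosNum d0).
  have := HN N.+2 ltac:(rewrite /=; lia).
  rewrite /= ltr_pdivlMr ?subr_gt0// mulrC -/(e N) lt_min => /andP[h1 h2].
  exists N => //; rewrite /A /= in_itv /=; apply/andP; split; lra.
apply/integrableP; split; first exact/measurable_EFinP.
have -> : (\int[mu]_(x in `]a, b[) `|(EFin \o f) x| = \int[mu]_(x in `]a, b[) (f x)%:E)%E.
  apply: eq_integral => x; rewrite inE /= in_itv /= => xab.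
  by rewrite ger0_norm// f0.
have ndA : nondecreasing_seq A.
  move=> m n mn; rewrite subsetEset => x; rewrite /A /= !in_itv /=.
  have : e n <= e m.
    by rewrite /e ler_pM2l ?subr_gt0// lef_pV2 ?posrE// ler_nat.
  move=> h /andP[h1 h2]; apply/andP; split; lra.
have Asub n : A n `<=` `]a, b[%classic.
  by move=> x /sA xab; rewrite /= in_itv.
have bound n : (\int[mu]_(x in A n) (f x)%:E <= (2 * B)%:E)%E.
  have inA x : e n <= x - a -> x <= b - e n -> a < x < b.
    by move=> h1 h2; apply: (sA n); rewrite /A /= in_itv /= h2 andbT; lra.
  rewrite (@continuous_FTC2 _ f F)//; first last.
  - move=> x; rewrite in_itv /= => /andP[x1 x2].
    rewrite derive1E; apply: (@derive_val _ _ _ _ _ F); apply: dF; apply: inA; lra.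
  - have dFA x : a + e n <= x <= b - e n -> derivable F x 1 /\ {for x, continuous F}.
      move=> /andP[x1 x2]; have dFx : is_derive x 1 F (f x) by apply: dF; apply: inA; lra.
      split; first exact: ex_derive.
      by apply/differentiable_continuous/derivable1_diffP/ex_derive.
    split.
    + by move=> x; rewrite in_itv /= => /andP[x1 x2]; apply: (dFA x _).1; rewrite !ltW.
    + apply: cvg_at_right_filter; apply: (dFA _ _).2; rewrite lexx/= ltW//.
    + apply: cvg_at_left_filter; apply: (dFA _ _).2; rewrite lexx/= ltW//.
  - apply: continuous_in_subspaceT => x; rewrite inE => /sA; exact: cf.
  have h1 : `|F (b - e n)| <= B.
    by apply: FB; apply: (sA n); rewrite /A /= in_itv /= lexx ltW.
  have h2 : `|F (a + e n)| <= B.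
    by apply: FB; apply: (sA n); rewrite /A /= in_itv /= lexx ltW.
  rewrite -EFinB lee_fin; move: h1 h2; rewrite !ler_norml => /andP[? ?] /andP[? ?]; lra.
have cvgA : (\int[mu]_(x in A i) (f x)%:E @[i --> \oo] --> \int[mu]_(x in \bigcup_i A i) (f x)%:E)%E.
  apply: ge0_nondecreasing_set_cvg_integral => //.
  - by move=> i; exact: measurable_itv.
  - move=> i; apply/measurable_EFinP; apply: measurable_funS mf => //; exact: Asub.
  - by move=> i x /sA /f0; rewrite lee_fin.
rewrite -UA; apply: (@le_lt_trans _ _ (2 * B)%:E); last exact: ltry.
by apply: (cvge_le _ cvgA) => //; apply: nearW.
Qed.

Lemma integrable_itv_closed (f : R -> R) (a b : R) : measurable_fun `[a, b] f ->
  mu.-integrable `]a, b[ (EFin \o f) -> mu.-integrable `[a, b] (EFin \o f).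
Proof.
move=> mf intf.
have mN : measurable ([set a; b] : set R) by apply: measurableU; exact: measurable_set1.
have N0 : mu [set a; b] = 0%E.
  by apply: countable_lebesgue_measure0; apply: finite_set_countable; exact: finite_set2.
apply: (iffRL (@negligible_integrable _ _ R mu `[a, b]%classic [set a; b] (EFin \o f)
  mN (measurable_itv _) ((measurable_EFinP _ _).2 mf) N0)).
apply: integrableS intf => //; first by apply: measurableD => //; exact: measurable_itv.
move=> x /=; rewrite !in_itv /= => -[/andP[ax xb] /not_orP[/eqP xa /eqP xb']].
by rewrite !lt_neqAle ax xb xb' eq_sym xa.
Qed.
Notation ell := (fun u : R => ln `|2 * sin u|).

Lemma measurable_ln_sin : measurable_fun setT ell.
Proof.
apply: measurableT_comp => //; apply: measurableT_comp => //.
apply: measurable_funM => //; apply: continuous_measurable_fun; exact: continuous_sin.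
Qed.

(** On [0, 1] the mean value theorem gives slope cos 1. On [1, pi / 2] the sine stays above cos 1,
    and v < 2 accounts for the factor 1 / 2. *)
Lemma sin_ge_linear (v : R) : 0 <= v <= pi / 2 -> cos 1 / 2 * v <= sin v.
Proof.
move=> /andP[v0 vpi]; have c1 : 0 < cos 1 :> R := cos1_gt0 R.
have pi4 : pi / 2 < 2 :> R by have /andP[] := pihalf_02 R.
have small (w : R) : 0 <= w <= 1 -> cos 1 * w <= sin w.
  move=> /andP[w0 w1].
  have [c cI] := @MVT_segment R sin cos 0 w w0 (fun x _ => is_derive_sin x)
    (continuous_subspaceT (@continuous_sin R)).
  rewrite sin0 !subr0 => ->; apply: ler_wpM2r => //.
  move: cI; rewrite in_itv /= => /andP[c0 cw].
  have [->//|c1'] := eqVneq c 1.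
  apply/ltW; rewrite ltr_cos ?in_itv /= ?c0 ?ler01 ?lt_neqAle ?c1' ?(le_trans cw)//.
  - by have := pi_ge2 R; lra.
  - by have := pi_ge2 R; lra.
have [v1|v1] := leP v 1.
  apply: le_trans (small v _); last by rewrite v0.
  by nra.
have s1 : cos 1 <= sin 1 :> R by have := small 1; rewrite mulr1 ler01 lexx; exact.
have : sin 1 < sin v.
  by rewrite ltr_sin ?in_itv//=; apply/andP; split; lra.
nra.
Qed.

Lemma ln_ge_sqrt (v : R) : 0 < v -> - ln v <= 2 / Num.sqrt v.
Proof.
move=> v0; have s0 : 0 < Num.sqrt v by rewrite sqrtr_gt0.
have E : ln v = ln (Num.sqrt v) + ln (Num.sqrt v).
  by rewrite -lnM ?posrE// -expr2 sqr_sqrtr// ltW.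
have := @ln_sublinear R (Num.sqrt v)^-1; rewrite invr_gt0 lnV ?posrE// => /(_ s0).
lra.
Qed.

(** The majorant is a constant plus 4 times the derivative of the square root, a form suited to
    [integrable_bounded_primitive]. *)
Lemma ln_sin_bound (v : R) : 0 < v < pi / 2 ->
  `|ln `|2 * sin v| | <= ln 2 + `|ln (cos 1 : R)| + 4 * (2 * Num.sqrt v)^-1.
Proof.
move=> /andP[v0 vpi]; have c1 : 0 < cos 1 :> R := cos1_gt0 R.
have s0 : 0 < Num.sqrt v by rewrite sqrtr_gt0.
have sv : cos 1 / 2 * v <= sin v by apply: sin_ge_linear; rewrite !ltW.
have sv0 : 0 < sin v by apply: lt_le_trans sv; rewrite !mulr_gt0 ?invr_gt0.
have -> : 4 * (2 * Num.sqrt v)^-1 = 2 / Num.sqrt v.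
  by field; exact: lt0r_neq0.
have h0 : 0 <= 2 / Num.sqrt v by rewrite divr_ge0 ?ltW.
rewrite [`|2 * sin v|]gtr0_norm ?mulr_gt0// ler_norml; apply/andP; split.
  have : ln (cos 1 * v) <= ln (2 * sin v) :> R by rewrite ler_ln ?posrE ?mulr_gt0//; lra.
  rewrite lnM ?posrE//; have := ln_ge_sqrt v0.
  have := ler_norm (- ln (cos 1 : R)); rewrite normrN.
  have : 0 <= ln 2 :> R by apply: ln_ge0; lra.
  lra.
have : ln (2 * sin v) <= ln 2 :> R.
  by rewrite ler_ln ?posrE ?mulr_gt0//; have := sin_le1 v; lra.
have := normr_ge0 (ln (cos 1 : R)); lra.
Qed.

Lemma integrable_of_bound (f : R -> R) (a b A : R) :
  (forall u, a < u < b -> 0 <= f u) ->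
  (forall u, a < u < b -> `|ell u| <= A + 4 * f u) ->
  mu.-integrable `]a, b[ (EFin \o f) -> mu.-integrable `[a, b] (EFin \o ell).
Proof.
move=> f0 fb intf; apply: integrable_itv_closed.
  by apply: measurable_funS measurable_ln_sin.
have intg : mu.-integrable `]a, b[ (fun u => ((EFin \o cst A) \+ (fun x => 4%:E * (EFin \o f) x)) u)%E.
  apply: integrableD => //; last exact: integrableZl.
  apply: (@integrableS _ _ _ mu `[a, b]) => //; first exact: subset_itv_oo_cc.
  by apply: continuous_compact_integrable; [exact: segment_compact|move=> x; exact: cvg_cst].
apply: le_integrable intg => //.
  by apply/measurable_EFinP; apply: measurable_funS measurable_ln_sin.
move=> u; rewrite /= in_itv /= => uab; rewrite lee_fin.
by rewrite (le_trans (fb u uab))// ler_norm.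
Qed.

(** The hypothesis makes [c] a zero of the sine, and the singularity there is compared with that at
    0. *)
Lemma ln_sin_integrable_right (c : R) : (forall u, `|sin (c + u)| = `|sin u|) ->
  mu.-integrable `[c, c + pi / 2] (EFin \o ell).
Proof.
move=> hc; have /andP[p0 p2] := pihalf_02 R.
have b2 u : c < u < c + pi / 2 -> 0 < u - c < pi / 2.
  by move=> /andP[? ?]; apply/andP; split; lra.
apply: (@integrable_of_bound (fun u => (2 * Num.sqrt (u - c))^-1) _ _ (ln 2 + `|ln (cos 1 : R)|)).
- by move=> u _; rewrite invr_ge0 mulr_ge0// sqrtr_ge0.
- move=> u /b2 uc; have := ln_sin_bound uc; rewrite !normrM -hc subrKC; exact.
apply: (@integrable_bounded_primitive _ (fun u => Num.sqrt (u - c)) _ _ (Num.sqrt (pi / 2))).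
- lra.
- by move=> u _; rewrite invr_ge0 mulr_ge0// sqrtr_ge0.
- move=> u /b2/andP[uc _]; apply: cvgV.
    by rewrite mulf_neq0// gt_eqF// sqrtr_gt0.
  apply: cvgMr; apply: (@cvg_comp _ _ _ (fun u => u - c) Num.sqrt).
    by apply: cvgB; [exact: cvg_id|exact: cvg_cst].
  exact: sqrt_continuous.
- move=> u /b2/andP[uc _].
  have d1 := is_derive1_sqrt uc.
  have d2 : is_derive u 1 (fun u => u - c) 1 by apply: is_derive_eq; rewrite subr0.
  have := @is_derive1_comp R Num.sqrt (fun u => u - c) u _ _ d1 d2.
  by rewrite mulr1.
- move=> u /b2/andP[uc u2]; rewrite ger0_norm ?sqrtr_ge0// ler_wsqrtr//; lra.
Qed.

Lemma ln_sin_integrable_left (c : R) : (forall u, `|sin (c + u)| = `|sin u|) ->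
  mu.-integrable `[c - pi / 2, c] (EFin \o ell).
Proof.
move=> hc; have /andP[p0 p2] := pihalf_02 R.
have b2 u : c - pi / 2 < u < c -> 0 < c - u < pi / 2.
  by move=> /andP[? ?]; apply/andP; split; lra.
apply: (@integrable_of_bound (fun u => (2 * Num.sqrt (c - u))^-1) _ _ (ln 2 + `|ln (cos 1 : R)|)).
- by move=> u _; rewrite invr_ge0 mulr_ge0// sqrtr_ge0.
- move=> u /b2 uc; have := ln_sin_bound uc; rewrite !normrM.
  by rewrite -[`|sin (c - u)|]normrN -sinN opprB -hc subrKC; exact.
apply: (@integrable_bounded_primitive _ (fun u => - Num.sqrt (c - u)) _ _ (Num.sqrt (pi / 2))).
- lra.
- by move=> u _; rewrite invr_ge0 mulr_ge0// sqrtr_ge0.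
- move=> u /b2/andP[uc _]; apply: cvgV.
    by rewrite mulf_neq0// gt_eqF// sqrtr_gt0.
  apply: cvgMr; apply: (@cvg_comp _ _ _ (fun u => c - u) Num.sqrt).
    by apply: cvgB; [exact: cvg_cst|exact: cvg_id].
  exact: sqrt_continuous.
- move=> u /b2/andP[uc _].
  have d1 := is_derive1_sqrt uc.
  have d2 : is_derive u 1 (fun u => c - u) (- 1 : R).
    by rewrite -[- 1]sub0r; exact: is_deriveB (is_derive_cst c u 1) (is_derive_id u 1).
  have d3 := @is_derive1_comp R Num.sqrt (fun u => c - u) u _ _ d1 d2.
  by apply: is_derive_eq; rewrite mulrN1 opprK.
- move=> u /b2/andP[uc u2]; rewrite normrN ger0_norm ?sqrtr_ge0// ler_wsqrtr//; lra.
Qed.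

Lemma integrable_itv_cat (f : R -> R) (a b c : R) : a <= b -> b <= c ->
  mu.-integrable `[a, b] (EFin \o f) -> mu.-integrable `[b, c] (EFin \o f) ->
  mu.-integrable `[a, c] (EFin \o f).
Proof.
move=> ab bc i1 i2.
have i2' : mu.-integrable `]b, c] (EFin \o f).
  by apply: integrableS i2 => //; exact: subset_itv_oc_cc.
have E : `[a, c]%classic = `[a, b] `|` `]b, c] :> set R.
  by rewrite -itv_bndbnd_setU// bnd_simp.
move/integrableP : i1 => [m1 f1]; move/integrableP : i2' => [m2 f2].
have mf : measurable_fun `[a, c] (EFin \o f).
  by rewrite E; apply/measurable_funU.
apply/integrableP; split => //.
rewrite E ge0_integral_setU//=.
- exact: lte_add_pinfty.
- by rewrite -E; apply/measurable_EFinP; apply: measurableT_comp => //; exact/measurable_EFinP.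
- apply/disj_set2P/seteqP; split => // x [] /=; rewrite !in_itv /= => /andP[_ xb] /andP[bx _].
  by move: bx; rewrite ltNge xb.
Qed.

Lemma norm_sinDpi (x : R) (k : nat) : `|sin (x + k%:R * pi)| = `|sin x|.
Proof.
elim: k => [|k IH]; first by rewrite mul0r addr0.
by rewrite -natr1 mulrDl mul1r addrA sinDpi normrN.
Qed.

(** A long interval between multiples of pi is covered by half-periods, each having its singularity
    at one end. *)
Lemma ln_sin_integrable (a b : R) : mu.-integrable `[a, b] (EFin \o ell).
Proof.
have /andP[p0 p2] := pihalf_02 R.
have main c N : (forall u, `|sin (c + u)| = `|sin u|) ->
    mu.-integrable `[c, c + N%:R * pi] (EFin \o ell).
  elim: N c => [|N IH] c hc.
    rewrite mul0r addr0 set_itv1; apply: integrableS (ln_sin_integrable_right hc) => //.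
    by move=> x /= ->; rewrite in_itv /= lexx; lra.
  have hN u : `|sin (c + N%:R * pi + u)| = `|sin u|.
    by rewrite addrAC norm_sinDpi hc.
  have hN1 u : `|sin (c + N.+1%:R * pi + u)| = `|sin u|.
    by rewrite addrAC norm_sinDpi hc.
  have NP : 0 <= N%:R * pi :> R by rewrite mulr_ge0// pi_ge0.
  have E : c + N.+1%:R * pi - pi / 2 = c + N%:R * pi + pi / 2 by rewrite -natr1; field.
  have E' : c + N.+1%:R * pi = c + N%:R * pi + pi by rewrite -natr1; ring.
  apply: (@integrable_itv_cat _ _ (c + N%:R * pi)); [lra|rewrite E'; lra|exact: IH|].
  apply: (integrable_itv_cat _ _ (ln_sin_integrable_right hN)); [lra|rewrite E'; lra|].
  by rewrite -E; exact: ln_sin_integrable_left.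
have [N HN] : exists N : nat, Num.max `|a| `|b| <= N%:R * pi.
  exists (Num.bound (Num.max `|a| `|b|)).
  have h := ltW (archi_boundP (_ : 0 <= Num.max `|a| `|b|)).
  apply: le_trans (h _) _; first by rewrite le_max normr_ge0.
  by rewrite ler_peMr//; have := pi_ge2 R; lra.
have hc (u : R) : `|sin (- (N%:R * pi) + u)| = `|sin u|.
  by rewrite -(norm_sinDpi (- (N%:R * pi) + u) N) addrAC addNr add0r.
apply: integrableS (main _ (N + N)%N hc) => //.
move: HN; rewrite ge_max => /andP[aN bN].
move: aN bN; rewrite !ler_norml => /andP[a1 a2] /andP[b1 b2].
apply: subset_itv; rewrite bnd_simp// natrD; lra.
Qed.
End Integrability.

(** * Functional equations of the Lobachevsky function *)

Section LobachevskyFunction.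
Context {R : realType}.
Notation mu := (@lebesgue_measure R).
Notation ell := (fun u : R => ln `|2 * sin u|).
Notation Lam := (@lobachevsky R).

(** A single formula for both signs of [t], with a fixed lower limit to the left of 0 and [t], as
    differentiation of the integral requires. *)
Lemma lobachevsky_primitive (T t : R) : 0 <= T -> - T <= t ->
  Lam t = \int[mu]_(u in `[(- T), 0]) ell u - \int[mu]_(u in `[(- T), t]) ell u.
Proof.
move=> T0 Tt; rewrite /lobachevsky; case: ifPn => t0.
  rewrite -opprB; congr (- _).
  rewrite (@Rintegral_itvB _ ell (BLeft (- T)) (BRight t) 0) ?bnd_simp ?oppr_le0//; last first.
    exact: ln_sin_integrable.
  rewrite Rintegral_itv_obnd_cbnd//; apply: integrableS (ln_sin_integrable 0 t) => //.
  exact: subset_itv_oc_cc.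
rewrite -ltNge in t0.
rewrite (@Rintegral_itvB _ ell (BLeft (- T)) (BRight 0) t) ?bnd_simp ?(ltW t0)//; last first.
  exact: ln_sin_integrable.
rewrite Rintegral_itv_obnd_cbnd//; apply: integrableS (ln_sin_integrable t 0) => //.
exact: subset_itv_oc_cc.
Qed.

Lemma lobachevsky0 : Lam 0 = 0.
Proof. by rewrite /lobachevsky lexx set_itv1 Rintegral_set1 oppr0. Qed.

Lemma continuous_ln_sin (t : R) : sin t != 0 -> {for t, continuous ell}.
Proof.
move=> s0; apply: (@continuous_comp _ _ _ (fun u => `|2 * sin u|) (@ln R)); last first.
  by apply: continuous_ln; rewrite normr_gt0 mulf_neq0.
apply: (@continuous_comp _ _ _ (fun u => 2 * sin u) Num.norm); last exact: norm_continuous.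
by apply: cvgMr; exact: continuous_sin.
Qed.

Lemma is_derive_lobachevsky (t : R) : sin t != 0 -> is_derive t 1 Lam (- ell t).
Proof.
move=> s0; pose T := `|t| + 1.
have tT : - T < t by rewrite /T; have := ler_norm (- t); rewrite normrN; lra.
have T0 : 0 <= T by rewrite addr_ge0.
have [dF Fell] := @continuous_FTC1 R ell (BLeft (- T)) t (t + 1) ltac:(lra)
  (ln_sin_integrable _ _) tT (continuous_ln_sin s0).
pose F x := \int[mu]_(u in `[(- T), x]) ell u.
have dF' : is_derive t 1 F (ell t).
  by split => //; rewrite -derive1E.
apply: (@near_eq_is_derive _ _ _ (fun x => \int[mu]_(u in `[(- T), 0]) ell u - F x)).
  near=> x; rewrite -(@lobachevsky_primitive T)// ltW//.
  by near: x; exact: lt_nbhsr.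
by rewrite -[- ell t]sub0r; exact: is_deriveB.
Unshelve. all: by end_near. Qed.

Lemma continuous_lobachevsky : continuous Lam.
Proof.
move=> t; pose T := `|t| + 1.
have tT : - T < t < T.
  by rewrite /T -ltr_norml; lra.
have /andP[tT1 tT2] := tT.
have T0 : 0 <= T by rewrite addr_ge0.
have TT : - T <= T by lra.
have := parameterized_integral_continuous TT (ln_sin_integrable (- T) T).
have TT' : - T < T by lra.
move=> /(continuous_within_itvP _ TT')[cF _ _]; have {}cF := cF t; rewrite in_itv /= tT in cF.
have {cF} cF := cF isT.
pose F x := \int[mu]_(u in `[(- T), x]) ell u.
have E : \forall x \near t, \int[mu]_(u in `[(- T), 0]) ell u - F x = Lam x.
  near=> x; rewrite -(@lobachevsky_primitive T)// ltW//.
  by near: x; exact: lt_nbhsr.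
have E' := nbhs_singleton E.
rewrite /continuous_at -E'.
have cG : (\int[mu]_(u in `[(- T), 0]) ell u - F x) @[x --> t] --> \int[mu]_(u in `[(- T), 0]) ell u - F t.
  by apply: cvgB; [exact: cvg_cst|exact: cF].
apply: cvg_trans cG; exact: near_eq_cvg.
Unshelve. all: by end_near. Qed.

(** The functional equations can be differentiated only off the multiples of pi / 2. These are
    isolated, and the mean value theorem on an interval ending at such a point needs only continuity
    there, so [f] is locally constant everywhere. *)
Lemma constant_of_derive0 (f : R -> R) : continuous f ->
  (forall x, sin (2 * x) != 0 -> is_derive x 1 f 0) -> forall x y, f x = f y.
Proof.
move=> cf df x y; apply: is_derive_0_is_cst => {y}x.
have [s0|/df//] := eqVneq (sin (2 * x)) 0.
(* Radius 1 suffices because 2 < pi. *)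
have sd d : 0 < `|d| < 1 -> sin (2 * (x + d)) != 0.
  move=> /andP[d0 d1]; have c0 : cos (2 * x) != 0.
    by have := sin0cos1 s0; case: eqP => // ->; rewrite normr0 => /eqP; rewrite eq_sym oner_eq0.
  rewrite mulrDr sinD s0 mul0r add0r mulf_neq0// -normr_eq0.
  have h (e : R) : 0 < e < 1 -> 0 < sin (2 * e).
    move=> /andP[e0 e1]; apply: sin_gt0_pi; have := pi_ge2 R.
    by move=> ?; apply/andP; split; lra.
  case: (ltrgtP d 0) d0 d1 => [dN|dP|->]; last by rewrite normr0 ltxx.
    rewrite ltr0_norm// => d0 d1; rewrite -[d]opprK mulrN sinN normrN.
    by rewrite gt_eqF// normr_gt0 gt_eqF// h// d0.
  by rewrite gtr0_norm// => d0 d1; rewrite gt_eqF// normr_gt0 gt_eqF// h// d0.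
have loc y : `|y - x| < 1 -> f y = f x.
  have mvt a b : a < b -> (forall z, a < z < b -> 0 < `|z - x| < 1) -> f b = f a.
    move=> ab zx.
    have dz z : z \in `]a, b[%R -> is_derive z 1 f ((fun=> 0) z).
      by rewrite in_itv /= => /zx /sd; rewrite subrKC; exact: df.
    have [c _] := MVT ab dz (continuous_subspaceT cf).
    by rewrite mul0r => /eqP; rewrite subr_eq0 => /eqP.
  rewrite ltr_norml => /andP[y1 y2]; case: (ltgtP y x) => [xy|xy|->//].
    apply/esym/mvt => // z /andP[z1 z2].
    by rewrite normr_gt0 subr_eq0 lt_eqF//= ltr_norml; apply/andP; split; lra.
  apply/mvt => // z /andP[z1 z2].
  by rewrite normr_gt0 subr_eq0 gt_eqF//= ltr_norml; apply/andP; split; lra.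
apply: (@near_eq_is_derive _ _ _ (cst (f x))).
near=> y; apply/esym/loc; rewrite distrC; near: y.
by apply: nbhsx_ballx.
Unshelve. all: by end_near. Qed.

Lemma is_derive_affine (a b x : R) : is_derive x 1 (fun t => a * t + b) a.
Proof.
have d1 := is_deriveD (is_deriveM (is_derive_cst a x 1) (is_derive_id x 1)) (is_derive_cst b x 1).
by apply: (is_derive_eq d1); rewrite /GRing.scale /= mulr0 mulr1 !addr0.
Qed.

Lemma is_derive_lobachevsky_affine (a b x : R) : sin (a * x + b) != 0 ->
  is_derive x 1 (fun t => Lam (a * t + b)) (- ell (a * x + b) * a).
Proof.
move=> s0; have d1 := is_derive_lobachevsky s0.
exact: (@is_derive1_comp R Lam (fun t => a * t + b) x _ _ d1 (is_derive_affine a b x)).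
Qed.

Lemma continuous_lobachevsky_affine (a b : R) : continuous (fun t => Lam (a * t + b)).
Proof.
move=> x; apply: (@continuous_comp _ _ _ (fun t => a * t + b) Lam); last exact: continuous_lobachevsky.
by apply: cvgD; [apply: cvgMr; exact: cvg_id|exact: cvg_cst].
Qed.

Lemma sin_double (x : R) : sin (2 * x) = 2 * (sin x * cos x).
Proof. by rewrite mulr_natl sin_mulr2n -mulr_natl mulrC; ring. Qed.

Lemma sin2_neq0 (x : R) : sin (2 * x) != 0 -> sin x != 0 /\ cos x != 0.
Proof. by rewrite sin_double !mulf_eq0 !negb_or => /andP[_ /andP[]]. Qed.

Lemma lobachevskyN (t : R) : Lam (- t) = - Lam t.
Proof.
apply/eqP; rewrite -addr_eq0; apply/eqP.
pose f x := Lam ((-1) * x + 0) + Lam (1 * x + 0).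
have fE x : f x = Lam (- x) + Lam x by rewrite /f mulN1r mul1r !addr0.
rewrite -fE (_ : 0 = f 0); last by rewrite fE oppr0 lobachevsky0 addr0.
apply: constant_of_derive0 => [x|x /sin2_neq0[s0 _]].
  by apply: cvgD; exact: continuous_lobachevsky_affine.
have s1 : sin ((-1) * x + 0) != 0 by rewrite mulN1r addr0 sinN oppr_eq0.
have s2 : sin (1 * x + 0) != 0 by rewrite mul1r addr0.
apply: (is_derive_eq (is_deriveD (is_derive_lobachevsky_affine s1) (is_derive_lobachevsky_affine s2))).
by rewrite mulN1r mul1r !addr0 sinN [2 * - sin x]mulrN normrN; ring.
Qed.

(** The constant at pi / 2 is carried along, since its vanishing is itself a consequence: it cancels
    for x = pi / 2, which gives the value at pi, hence the period pi, hence by oddness the value at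
    pi / 2. *)
Lemma lobachevsky_double (x : R) :
  Lam (2 * x) = 2 * Lam x + 2 * Lam (x + pi / 2) - 2 * Lam (pi / 2).
Proof.
pose f x := Lam (2 * x + 0) + (-2) * (Lam (1 * x + 0) + Lam (1 * x + pi / 2)).
have fE y : f y = Lam (2 * y) - 2 * Lam y - 2 * Lam (y + pi / 2).
  by rewrite /f !mul1r !addr0; ring.
suff : f x = f 0 by rewrite !fE mulr0 add0r lobachevsky0; lra.
apply: constant_of_derive0 => {}x.
  apply: cvgD; first exact: continuous_lobachevsky_affine.
  by apply: cvgMr; apply: cvgD; exact: continuous_lobachevsky_affine.
move=> s2; have [s0 c0] := sin2_neq0 s2.
have s1 : sin (2 * x + 0) != 0 by rewrite addr0.
have s3 : sin (1 * x + 0) != 0 by rewrite mul1r addr0.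
have s4 : sin (1 * x + pi / 2) != 0 by rewrite mul1r sinDpihalf.
apply: (is_derive_eq (is_deriveD (is_derive_lobachevsky_affine s1) (is_deriveZ (-2)
  (is_deriveD (is_derive_lobachevsky_affine s3) (is_derive_lobachevsky_affine s4))))).
rewrite /GRing.scale /= !mul1r !addr0 sinDpihalf !mulr1 sin_double.
have -> : ln `|2 * (2 * (sin x * cos x))| = ln `|2 * sin x| + ln `|2 * cos x|.
  rewrite -lnM ?posrE ?normr_gt0 ?mulf_neq0// -normrM; congr (ln `|_|); ring.
by ring.
Qed.

Lemma lobachevsky_pi : Lam pi = 0.
Proof.
have := lobachevsky_double (pi / 2).
rewrite (_ : 2 * (pi / 2) = pi); last by field.
rewrite (_ : pi / 2 + pi / 2 = pi); last by field.
lra.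
Qed.

Lemma lobachevskyDpi (x : R) : Lam (x + pi) = Lam x.
Proof.
apply/eqP; rewrite -subr_eq0; apply/eqP.
pose f x := Lam (1 * x + pi) + (-1) * Lam (1 * x + 0).
have fE y : f y = Lam (y + pi) - Lam y by rewrite /f !mul1r addr0 mulN1r.
rewrite -fE (_ : 0 = f 0); last by rewrite fE add0r lobachevsky0 lobachevsky_pi subrr.
apply: constant_of_derive0 => {}x.
  apply: cvgD; first exact: continuous_lobachevsky_affine.
  by apply: cvgMr; exact: continuous_lobachevsky_affine.
move=> s2; have [s0 c0] := sin2_neq0 s2.
have s1 : sin (1 * x + 0) != 0 by rewrite mul1r addr0.
have s3 : sin (1 * x + pi) != 0 by rewrite mul1r sinDpi oppr_eq0.
apply: (is_derive_eq (is_deriveD (is_derive_lobachevsky_affine s3) (is_deriveZ (-1)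
  (is_derive_lobachevsky_affine s1)))).
rewrite /GRing.scale /= !mul1r !addr0 sinDpi [2 * - sin x]mulrN normrN.
by ring.
Qed.

Lemma lobachevsky_pihalf : Lam (pi / 2) = 0.
Proof.
have := lobachevskyDpi (- (pi / 2)); rewrite lobachevskyN.
by rewrite (_ : - (pi / 2) + pi = pi / 2); [lra|field].
Qed.
End LobachevskyFunction.

(** * Logarithms of quantum factorials *)

Section LogSums.
Context {R : realType}.
Notation ell := (fun u : R => ln `|2 * sin u|).
Notation Lam := (@lobachevsky R).

(* by concavity of [ln (2 sin u)] on ]0, pi[ *)
Lemma lobachevsky_midpoint (x t : R) : 0 < t -> 0 <= x - t -> x + t <= pi ->
  Lam (x - t) - Lam (x + t) <= 2 * t * ell x.
Proof.
move=> t0 xt0 xtpi.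
pose g s := Lam ((-1) * s + x) - Lam (1 * s + x).
have cg : {within `[0, t], continuous g}.
  apply: continuous_subspaceT => s.
  by apply: cvgB; exact: continuous_lobachevsky_affine.
have dg s : s \in `]0, t[%R -> is_derive s 1 g ((fun s => ell (x - s) + ell (x + s)) s).
  rewrite in_itv /= => /andP[s0 st].
  have h1 : sin ((-1) * s + x) != 0 by rewrite gt_eqF// sin_gt0_pi//; apply/andP; split; lra.
  have h2 : sin (1 * s + x) != 0 by rewrite gt_eqF// sin_gt0_pi//; apply/andP; split; lra.
  apply: (is_derive_eq (is_deriveB (is_derive_lobachevsky_affine h1) (is_derive_lobachevsky_affine h2))).
  by rewrite mulN1r mul1r [- s + x]addrC [s + x]addrC; ring.
have [c] := MVT t0 dg cg; rewrite in_itv /= => /andP[c0 ct].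
rewrite /g !mulr0 !add0r subrr !subr0 mulN1r mul1r [- t + x]addrC [t + x]addrC => ->.
rewrite (_ : 2 * t * ell x = (ell x + ell x) * t); last by ring.
rewrite ler_pM2r//=.
have s1 : 0 < sin (x - c) by apply: sin_gt0_pi; apply/andP; split; lra.
have s2 : 0 < sin (x + c) by apply: sin_gt0_pi; apply/andP; split; lra.
have s3 : 0 < sin x by apply: sin_gt0_pi; apply/andP; split; lra.
rewrite !gtr0_norm ?mulr_gt0// -!lnM ?posrE ?mulr_gt0//.
rewrite ler_ln ?posrE ?mulr_gt0//.
have -> : 2 * sin (x - c) * (2 * sin (x + c)) = 4 * (sin x ^+ 2 - sin c ^+ 2).
  by rewrite sinB sinD; ring: (cos2sin2 x) (cos2sin2 c).
by have := sqr_ge0 (sin c); lra.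
Qed.

Variable n : nat.
Hypothesis n_gt0 : (0 < n)%N.
Let r := (2 * n + 1)%N.
Let h : R := qangle r.

Let h_gt0 : 0 < h. Proof. exact: qangle_gt0. Qed.
Let h_r : h * r%:R = 2 * pi. Proof. exact: qangle_r. Qed.

(** The midpoint inequality on the cell of width h centred at h j. Since r is odd, pi = h (n + 1/2)
    is an end of a cell, so no cell contains it in its interior; the cells beyond it are moved back
    by the period. *)
Lemma ln_sg_ge (j : nat) : (0 < j < r)%N ->
  Lam (h * (j%:R - 1 / 2)) - Lam (h * (j%:R + 1 / 2)) <= h * ln `|sg h j%:R|.
Proof.
move=> /andP[j0 jr].
have hn : h * (n%:R + 1 / 2) = pi.
  have : h * (2 * n%:R + 1) = 2 * pi by rewrite -h_r /r natrD natrM.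
  lra.
have j1 : 1 <= j%:R :> R by rewrite ler1n.
have [jn|jn] := leqP j n.
  have jn' : j%:R <= n%:R :> R by rewrite ler_nat.
  have := @lobachevsky_midpoint (h * j%:R) (h / 2) ltac:(by rewrite divr_gt0).
  have -> : h * j%:R - h / 2 = h * (j%:R - 1 / 2) by ring.
  have -> : h * j%:R + h / 2 = h * (j%:R + 1 / 2) by ring.
  rewrite mulrCA mulfV// mulr1 -hn => -> //.
    by rewrite mulr_ge0 ?(ltW h_gt0)//; lra.
  by rewrite ler_pM2l//; lra.
have jn' : n%:R + 1 <= j%:R :> R by rewrite natr1 ler_nat.
have jr' : j%:R + 1 <= 2 * n%:R + 1 :> R.
  by rewrite natr1 -natrM natr1 ler_nat; move: jr; rewrite /r; lia.
have := @lobachevsky_midpoint (h * j%:R - pi) (h / 2) ltac:(by rewrite divr_gt0).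
have -> : h * j%:R - pi - h / 2 = h * (j%:R - 1 / 2) - pi by ring.
have -> : h * j%:R - pi + h / 2 = h * (j%:R + 1 / 2) - pi by ring.
rewrite -[Lam (_ - pi)]lobachevskyDpi subrK -[Lam (_ - pi)]lobachevskyDpi subrK.
have -> : ell (h * j%:R - pi) = ln `|sg h j%:R|.
  have -> : sin (h * j%:R - pi) = - sin (h * j%:R).
    by rewrite -[in RHS](subrK pi (h * j%:R)) sinDpi opprK.
  by rewrite mulrN normrN.
rewrite mulrCA mulfV// mulr1; apply; rewrite -hn.
  by rewrite -mulrBr mulr_ge0 ?(ltW h_gt0)//; lra.
rewrite -mulrBr ler_pM2l//; lra.
Qed.

Lemma normc_one_sub_cis (x : R) : Normc.normc (1 - cis (2 * x)) = `|2 * sin x|.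
Proof.
rewrite /cis.
have -> : 1 - (cos (2 * x) +i* sin (2 * x))%C = ((1 - cos (2 * x)) +i* - sin (2 * x))%C.
  by simpc.
rewrite /Normc.normc -sqrtr_sqr; congr Num.sqrt.
have -> : 2 * x = x + x by ring.
rewrite cosD sinD; ring: (cos2sin2 x).
Qed.

(** The cyclotomic identity: (X^r - 1) / (X - 1) at X = 1 is the product of the numbers 1 - z^j, of
    modulus |2 sin (h j)|, for the primitive root z = e^{2 i h}. *)
Lemma prod_sg : \prod_(1 <= j < r) `|sg h j%:R| = r%:R.
Proof.
pose z : R[i] := cis (2 * h).
have zX j : z ^+ j = cis (2 * (h * j%:R)) by rewrite cisX mulrA.
have r1 : (0 < r)%N by rewrite /r addn1.
have prz : r.-primitive_root z.
  apply/andP; split => //; apply/forallP => i; apply/eqP.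
  rewrite unity_rootE zX; have [->|ir] := eqVneq i.+1 r.
    rewrite h_r; apply/eqP.
    have -> : 2 * (2 * pi) = pi *+ 2 + pi *+ 2 :> R by rewrite -[pi *+ 2]mulr_natl; ring.
    rewrite /cis.
    by rewrite cosD2pi sinD2pi cos2pi sin2pi.
  apply/negbTE/eqP => E; have := normc_one_sub_cis (h * i.+1%:R).
  rewrite E subrr Normc.normc0 => /esym/eqP; rewrite normr_eq0 -/(sg h i.+1%:R).
  by apply/negP; apply: sg_qangle_neq0 => //=; have := ltn_ord i; rewrite leq_eqVlt (negbTE ir).
have := factor_Xn_sub_1 prz; rewrite big_ltn// expr0 subrX1.
have X1 : ('X - 1%:P : {poly R[i]}) != 0 by rewrite polyXsubC_eq0.
move=> /(mulfI X1).
move=> /(congr1 (fun p : {poly R[i]} => Normc.normc p.[1])).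
rewrite horner_prod horner_sum (big_morph _ (@Normc.normcM R) (@Normc.normc1 R)).
have -> : \sum_(i < r) ('X^i : {poly R[i]}).[1] = r%:R.
  by under eq_bigr do rewrite hornerXn expr1n; rewrite sumr_const card_ord.
have -> : Normc.normc (r%:R : R[i]) = r%:R.
  have -> : (r%:R : R[i]) = (r%:R +i* 0)%C by rewrite -(rmorph_nat (real_complex R)).
  by rewrite /Normc.normc expr0n addr0 sqrtr_sqr ger0_norm.
move=> <-; apply: eq_bigr => j _.
by rewrite hornerXsubC zX normc_one_sub_cis.
Qed.

Lemma sum_ln_sg_ge (m d : nat) : (m + d < r)%N ->
  Lam (h * (m%:R + 1 / 2)) - Lam (h * ((m + d)%:R + 1 / 2))
  <= h * ln `|sf h (m + d)| - h * ln `|sf h m|.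
Proof.
elim: d => [|d IH] md; first by rewrite addn0 !subrr.
rewrite addnS sfS normrM lnM ?posrE ?normr_gt0; last 2 first.
- by apply: sf_qangle_neq0 => //; move: md; rewrite /r; lia.
- by apply: sg_qangle_neq0 => //; move: md; rewrite /r; lia.
have := IH ltac:(lia); have := @ln_sg_ge (m + d).+1 ltac:(lia).
have -> : (m + d).+1%:R - 1 / 2 = (m + d)%:R + 1 / 2 :> R by rewrite -natr1; field.
lra.
Qed.

(** The lower bound is the sum of the midpoint inequalities up to [m]. The upper bound applies the
    same sum to the complementary factors m + 1, .., r - 1 and subtracts it from the logarithm of
    the full product, which equals r. *)
Lemma ln_sf_bound (m : nat) : (m < r)%N ->
  `|h * ln `|sf h m| + Lam (h * (m%:R + 1 / 2))| <= h * ln r%:R + `|Lam (h / 2)|.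
Proof.
move=> mr; have := @sum_ln_sg_ge 0 m; rewrite add0n sf0 normr1 ln1 mulr0 subr0 => /(_ mr).
have := @sum_ln_sg_ge m (r.-1 - m); rewrite subnKC; last by rewrite -ltnS prednK//; lia.
move=> /(_ ltac:(lia)).
have -> : `|sf h r.-1| = r%:R.
  by rewrite -prod_sg /sf (big_morph _ (@normrM R) (@normr1 R)) prednK//; lia.
have -> : h * (r.-1%:R + 1 / 2) = - (h / 2) + pi + pi.
  have -> : r.-1%:R = r%:R - 1 :> R by rewrite -subn1 natrB//; lia.
  by rewrite mulrDr mulrBr h_r; field.
rewrite !lobachevskyDpi lobachevskyN add0r.
have -> : h * (1 / 2) = h / 2 by ring.
have := ler_norm (Lam (h / 2)); have := ler_norm (- Lam (h / 2)); rewrite normrN.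
have : 0 <= h * ln r%:R by rewrite mulr_ge0 ?(ltW h_gt0)// ln_ge0// ler1n; lia.
by move=> ? ? ? ? ?; rewrite ler_norml; apply/andP; split; lra.
Qed.
End LogSums.

(** * The potential function *)

Section Potential.
Context {R : realType}.
Notation ell := (fun u : R => ln `|2 * sin u|).
Notation Lam := (@lobachevsky R).

Lemma Delta_pihalf (x : R) : Delta (pi / 2) x = Lam (2 * x) - 2 * Lam x.
Proof.
rewrite lobachevsky_double lobachevsky_pihalf /Delta.
rewrite -[Lam (pi / 2 - x)]opprK -lobachevskyN opprB.
rewrite -[Lam (x - pi / 2)]lobachevskyDpi (_ : x - pi / 2 + pi = x + pi / 2); last by field.
by rewrite [pi / 2 + x]addrC; ring.
Qed.

(** The function P of the overview, in terms of the half-angles. *)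
Definition potential (a b c x : R) : R :=
  - (Delta a x + Delta b x + Delta c x) + 2 * Delta (pi / 2) x + Delta 0 x.

Lemma potentialE a b c x : potential a b c x =
  Lam (a - x) - Lam (a + x) + (Lam (b - x) - Lam (b + x)) + (Lam (c - x) - Lam (c + x))
  + 2 * Lam (2 * x) - 2 * Lam x.
Proof.
rewrite /potential Delta_pihalf /Delta sub0r lobachevskyN add0r; ring.
Qed.

Lemma DeltaBpi (a x : R) : Delta a (pi - x) = - Delta a x.
Proof.
rewrite /Delta (_ : a + (pi - x) = a - x + pi); last by ring.
rewrite lobachevskyDpi -[Lam (a - (pi - x))]lobachevskyDpi (_ : a - (pi - x) + pi = a + x); last by ring.
by rewrite opprB.
Qed.

Lemma potentialBpi (a b c x : R) : potential a b c (pi - x) = - potential a b c x.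
Proof. by rewrite /potential !DeltaBpi; ring. Qed.

Lemma potential_pihalf (a b c : R) : potential a b c (pi / 2) = 0.
Proof.
have := potentialBpi a b c (pi / 2).
rewrite (_ : pi - pi / 2 = pi / 2 :> R); last by field.
lra.
Qed.

Lemma mednykh_potential (al : 'I_3 -> R) th :
  mednykh_value al th = - 2 * potential (al 0 / 2) (al 1 / 2) (al 2%:R / 2) th.
Proof.
rewrite /mednykh_value /potential !big_ord_recl big_ord0.
rewrite (_ : lift ord0 (lift ord0 ord0) = 2%:R :> 'I_3); last exact/val_inj.
rewrite (_ : lift ord0 ord0 = 1 :> 'I_3); last exact/val_inj.
by rewrite -[ord0]/(0 : 'I_3); ring.
Qed.

Lemma continuous_potential (a b c : R) : continuous (potential a b c).
Proof.
have -> : potential a b c = (fun x =>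
  Lam ((-1) * x + a) - Lam (1 * x + a) + (Lam ((-1) * x + b) - Lam (1 * x + b))
  + (Lam ((-1) * x + c) - Lam (1 * x + c)) + (2 * Lam (2 * x + 0) - 2 * Lam (1 * x + 0))).
  apply/funext => x; rewrite potentialE !mulN1r !mul1r !addr0 ![- x + _]addrC ![x + _]addrC.
  ring.
have cL (u v : R) : continuous (fun x => Lam (u * x + v)) by exact: continuous_lobachevsky_affine.
have cB (u v : R) : continuous (fun x : R => Lam ((-1) * x + u) - Lam (1 * x + v)).
  by move=> x; apply: cvgB; exact: cL.
move=> x; apply: cvgD; first by apply: cvgD; [apply: cvgD|]; exact: cB.
by apply: cvgB; (apply: cvgM; [exact: cvg_cst|exact: cL]).
Qed.

(** With p, q, s, v the squared sines of the half-angles and of x, its sign is that of the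
    derivative of the potential. The cubic terms cancel, as [quadE] shows, and a quadratic is
    left. *)
Definition quad (p q s v : R) := (2 - (p + q + s)) * v ^+ 2 + (p * q + q * s + p * s - 1) * v - p * q * s.

Lemma quadE p q s v : quad p q s v = (v - p) * (v - q) * (v - s) - v * (1 - v) ^+ 2.
Proof. by rewrite /quad; ring. Qed.

(** A squared tangent is w / (1 - w) in terms of the squared sine w; clearing denominators turns the
    equation for theta into [quad]. *)
Lemma quad_root (p q s w : R) : p < 1 -> q < 1 -> s < 1 -> w < 1 ->
  (w / (1 - w)) ^+ 2 - (p / (1 - p) + q / (1 - q) + s / (1 - s) + 1) * (w / (1 - w))
    - p / (1 - p) * (q / (1 - q)) * (s / (1 - s)) = 0 -> quad p q s w = 0.
Proof.
move=> p1 q1 s1 w1 E.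
have -> : quad p q s w = (1 - w) ^+ 2 * (1 - p) * (1 - q) * (1 - s) *
  ((w / (1 - w)) ^+ 2 - (p / (1 - p) + q / (1 - q) + s / (1 - s) + 1) * (w / (1 - w))
    - p / (1 - p) * (q / (1 - q)) * (s / (1 - s))).
  rewrite /quad; field; rewrite !subr_eq0.
  by do ?(apply/andP; split); rewrite gt_eqF.
by rewrite E mulr0.
Qed.

(** The cofactor of v - w is affine, nonnegative at 0, and positive at 1 because the quadratic there
    is (1 - p) (1 - q) (1 - s). So it is positive on ]0, 1[. *)
Lemma quad_sign (p q s w v : R) : 0 <= p < 1 -> 0 <= q < 1 -> 0 <= s < 1 -> 0 < w < 1 ->
  quad p q s w = 0 -> 0 < v < 1 -> (0 < quad p q s v) = (w < v) /\ (quad p q s v < 0) = (v < w).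
Proof.
move=> /andP[p0 p1] /andP[q0 q1] /andP[s0 s1] /andP[w0 w1] G0 /andP[v0 v1].
pose e := p * q * s.
have e0 : 0 <= e by rewrite !mulr_ge0.
pose B v := (2 - (p + q + s)) * v + e / w.
have GE u : quad p q s u = (u - w) * B u.
  have E : p * q + q * s + p * s - 1 = e / w - (2 - (p + q + s)) * w.
    have E' : (p * q + q * s + p * s - 1) * w = e - (2 - (p + q + s)) * w ^+ 2.
      by apply/eqP; rewrite -subr_eq0 -G0 /quad /e; apply/eqP; ring.
    by rewrite -[LHS](mulfK (lt0r_neq0 w0)) E'; field; exact: lt0r_neq0.
  by rewrite /quad E /B -/e; field; exact: lt0r_neq0.
have B1 : 0 < B 1.
  have : 0 < (1 - w) * B 1.
    rewrite -GE quadE subrr expr0n /= mulr0 subr0 !mulr_gt0// subr_gt0//.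
  by rewrite pmulr_rgt0// subr_gt0.
have Bv : 0 < B v.
  have -> : B v = v * B 1 + (1 - v) * (e / w) by rewrite /B; ring.
  by rewrite ltr_pwDl ?mulr_gt0// mulr_ge0 ?divr_ge0// ?subr_ge0 ltW.
by rewrite GE pmulr_lgt0// pmulr_llt0// subr_gt0 subr_lt0.
Qed.

(** * Monotonicity of the potential on both sides of theta *)

Section Minimum.
Variables a b c m theta : R.
Hypotheses (a0 : 0 <= a) (b0 : 0 <= b) (c0 : 0 <= c).
Hypotheses (am : a <= m) (bm : b <= m) (cm : c <= m) (m2 : m < pi / 2).
Hypothesis m_max : m = a \/ m = b \/ m = c.
Hypothesis theta_itv : 0 < theta < pi / 2.
Hypothesis theta_eq : tan theta ^+ 4 - (tan a ^+ 2 + tan b ^+ 2 + tan c ^+ 2 + 1) * tan theta ^+ 2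
  - tan a ^+ 2 * tan b ^+ 2 * tan c ^+ 2 = 0.

Let G (v : R) := quad (sin a ^+ 2) (sin b ^+ 2) (sin c ^+ 2) v.

Let sin2_itv (x : R) : 0 <= x < pi / 2 -> 0 <= sin x ^+ 2 < 1.
Proof.
move=> /andP[x0 x1]; rewrite sqr_ge0 sin2cos2 ltrBlDr ltrDl exprn_gt0//.
by rewrite cos_gt0_pihalf//; apply/andP; split=> //; lra.
Qed.

Let tan2 (x : R) : tan x ^+ 2 = sin x ^+ 2 / (1 - sin x ^+ 2).
Proof. by rewrite -cos2sin2 /tan expr_div_n. Qed.

Let sin2_theta : 0 < sin theta ^+ 2 < 1.
Proof.
have /andP[t0 t1] := theta_itv.
have /andP[_ ->] : 0 <= sin theta ^+ 2 < 1 by apply: sin2_itv; rewrite ltW.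
by rewrite andbT exprn_gt0// sin_gt0_pihalf.
Qed.

Let p1 (x : R) : 0 <= x <= m -> 0 <= sin x ^+ 2 < 1.
Proof. by move=> /andP[x0 xm]; apply: sin2_itv; rewrite x0 (le_lt_trans xm). Qed.

Let G_theta : G (sin theta ^+ 2) = 0.
Proof.
have /andP[_ pa] : 0 <= sin a ^+ 2 < 1 by apply: p1; rewrite a0.
have /andP[_ pb] : 0 <= sin b ^+ 2 < 1 by apply: p1; rewrite b0.
have /andP[_ pc] : 0 <= sin c ^+ 2 < 1 by apply: p1; rewrite c0.
have /andP[_ pt] := sin2_theta.
apply: quad_root => //; rewrite -!tan2 -[RHS]theta_eq; ring.
Qed.

Let G_sign (v : R) : 0 < v < 1 -> (0 < G v) = (sin theta ^+ 2 < v) /\ (G v < 0) = (v < sin theta ^+ 2).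
Proof. by apply: quad_sign G_theta; rewrite ?sin2_theta// p1 ?a0 ?b0 ?c0. Qed.

Let sin2_lt (x y : R) : 0 <= x -> x < y -> y <= pi / 2 -> sin x ^+ 2 < sin y ^+ 2.
Proof.
move=> x0 xy y2; have := pi_gt0 R => ?.
have s0 : 0 <= sin x by apply: sin_ge0_pi; apply/andP; split; lra.
have s1 : sin x < sin y.
  by rewrite ltr_sin// in_itv /=; apply/andP; split; lra.
by rewrite ltr_pXn2r ?nnegrE//; lra.
Qed.

Lemma lt_theta : m < theta.
Proof.
have /andP[t0 t2] := theta_itv.
rewrite ltNge; apply/negP => tm.
have s1 : sin theta ^+ 2 <= sin m ^+ 2.
  move: tm; rewrite le_eqVlt => /predU1P[->//|tm].
  by apply/ltW/sin2_lt; rewrite ?(ltW t0)// ltW.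
have m1 : 0 < sin m ^+ 2 < 1.
  have /andP[s0 _] := sin2_theta; rewrite (lt_le_trans s0 s1)/=.
  by have /andP[] : 0 <= sin m ^+ 2 < 1 by apply: sin2_itv; rewrite m2 andbT; lra.
have [_] := G_sign m1; rewrite [RHS]ltNge s1 /= => /negbT; rewrite -leNgt.
have /andP[v0 v1] := m1.
have h : 0 < sin m ^+ 2 * (1 - sin m ^+ 2) ^+ 2 by rewrite mulr_gt0// exprn_gt0// subr_gt0.
(* At the largest half-angle one factor of the cubic vanishes, so [G] is negative there and its root
   lies further to the right. *)
have E0 : (sin m ^+ 2 - sin a ^+ 2) * (sin m ^+ 2 - sin b ^+ 2) * (sin m ^+ 2 - sin c ^+ 2) = 0.
  by have [->|[->|->]] := m_max; rewrite subrr; ring.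
by rewrite /G quadE E0 sub0r oppr_ge0 leNgt h.
Qed.

Lemma le_theta : m <= theta. Proof. exact: ltW lt_theta. Qed.

Let df (x : R) := ell (a - x) + ell (a + x) + (ell (b - x) + ell (b + x)) + (ell (c - x) + ell (c + x))
  - 4 * ell (2 * x) + 2 * ell x.

Let is_derive_potential x : m < x < pi / 2 -> is_derive x 1 (potential a b c) (df x).
Proof.
move=> /andP[mx x2].
have sn u : 0 <= u <= m -> sin ((-1) * x + u) != 0 /\ sin (1 * x + u) != 0.
  move=> /andP[u0 um]; rewrite mulN1r mul1r; split.
    rewrite (_ : - x + u = - (x - u)); last by ring.
    by rewrite sinN oppr_eq0 gt_eqF// sin_gt0_pi//; apply/andP; split; lra.
  by rewrite gt_eqF// sin_gt0_pi//; apply/andP; split; lra.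
have [a1 a2] := sn a ltac:(by rewrite a0).
have [b1 b2] := sn b ltac:(by rewrite b0).
have [c1 c2] := sn c ltac:(by rewrite c0).
have m0 : 0 <= m by exact: le_trans am.
have [_ x1] := sn 0 ltac:(by rewrite lexx).
have x3 : sin (2 * x + 0) != 0.
  by rewrite addr0 gt_eqF// sin_gt0_pi//; apply/andP; split; lra.
have -> : potential a b c = (fun x =>
  Lam ((-1) * x + a) - Lam (1 * x + a) + (Lam ((-1) * x + b) - Lam (1 * x + b))
  + (Lam ((-1) * x + c) - Lam (1 * x + c)) + (2 * Lam (2 * x + 0) - 2 * Lam (1 * x + 0))).
  apply/funext => y; rewrite potentialE !mulN1r !mul1r !addr0 ![- y + _]addrC ![y + _]addrC.
  ring.
have dL := is_derive_lobachevsky_affine.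
apply: (is_derive_eq (is_deriveD (is_deriveD (is_deriveD
  (is_deriveB (dL _ _ _ _ a1) (dL _ _ _ _ a2)) (is_deriveB (dL _ _ _ _ b1) (dL _ _ _ _ b2)))
  (is_deriveB (dL _ _ _ _ c1) (dL _ _ _ _ c2)))
  (is_deriveB (is_deriveZ 2 (dL _ _ _ _ x3)) (is_deriveZ 2 (dL _ _ _ _ x1))))).
rewrite /df /GRing.scale /= !mulN1r !mul1r !addr0 ![- x + _]addrC ![x + _]addrC.
ring.
Qed.

(** Since sin (u - x) sin (u + x) = sin^2 u - sin^2 x, the derivative is a logarithm of a quotient.
    The common factor 256 sin^2 x is 4^3 times 4 sin^2 x in the numerator and comes from (4 sin x
    cos x)^4 in the denominator. *)
Let dfE x : m < x < pi / 2 ->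
  df x = ln (256 * sin x ^+ 2 * ((sin x ^+ 2 - sin a ^+ 2) * (sin x ^+ 2 - sin b ^+ 2) * (sin x ^+ 2 - sin c ^+ 2)))
    - ln (256 * sin x ^+ 2 * (sin x ^+ 2 * (1 - sin x ^+ 2) ^+ 2)) /\
  0 < (sin x ^+ 2 - sin a ^+ 2) * (sin x ^+ 2 - sin b ^+ 2) * (sin x ^+ 2 - sin c ^+ 2) /\
  0 < sin x ^+ 2 < 1.
Proof.
move=> /andP[mx x2]; have x0 : 0 < x by apply: le_lt_trans mx; exact: le_trans am.
have s0 : 0 < sin x by apply: sin_gt0_pihalf; rewrite x0.
have co : 0 < cos x by apply: cos_gt0_pihalf; apply/andP; split; lra.
have pos u : 0 <= u <= m -> 0 < sin x ^+ 2 - sin u ^+ 2.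
  by move=> /andP[u0 um]; rewrite subr_gt0; apply: sin2_lt => //; lra.
have pa := pos a ltac:(by rewrite a0).
have pb := pos b ltac:(by rewrite b0).
have pc := pos c ltac:(by rewrite c0).
have pE u : 0 <= u <= m -> ell (u - x) + ell (u + x) = ln (4 * (sin x ^+ 2 - sin u ^+ 2)).
  move=> um; have pu := pos u um; have /andP[u0 um'] := um.
  have h1 : sin (u + x) != 0 by rewrite gt_eqF// sin_gt0_pi//; apply/andP; split; lra.
  have h2 : sin (u - x) != 0.
    by rewrite -opprB sinN oppr_eq0 gt_eqF// sin_gt0_pi//; apply/andP; split; lra.
  rewrite -lnM ?posrE ?normr_gt0 ?mulf_neq0// -normrM.
  have -> : 2 * sin (u - x) * (2 * sin (u + x)) = - (4 * (sin x ^+ 2 - sin u ^+ 2)).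
    by rewrite sinB sinD; ring: (cos2sin2 x) (cos2sin2 u).
  by rewrite normrN gtr0_norm// mulr_gt0.
have v0 : 0 < sin x ^+ 2 by rewrite exprn_gt0.
have v1 : 0 < 1 - sin x ^+ 2 by rewrite -cos2sin2 exprn_gt0.
split; last by split; [rewrite !mulr_gt0|rewrite v0 -subr_gt0].
rewrite /df !pE ?a0 ?b0 ?c0//.
have E1 : 2 * ell x = ln (4 * sin x ^+ 2).
  rewrite gtr0_norm ?mulr_gt0// mulr_natl mulr2n -lnM ?posrE ?mulr_gt0//.
  by congr ln; ring.
have E2 : 4 * ell (2 * x) = ln (256 * sin x ^+ 2 * (sin x ^+ 2 * (1 - sin x ^+ 2) ^+ 2)).
  rewrite sin_double gtr0_norm ?mulr_gt0// mulr_natl -lnXn ?mulr_gt0//.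
  by congr ln; rewrite -cos2sin2; ring.
rewrite E1 E2 addrAC -!lnM ?posrE ?mulr_gt0//; congr (ln _ - _); ring.
Qed.

Let df_sign x : m < x < pi / 2 -> (theta < x -> 0 < df x) /\ (x < theta -> df x < 0).
Proof.
move=> mx; have [-> [P v01]] := dfE mx; have /andP[v0 v1] := v01.
have [G1 G2] := G_sign v01; rewrite /G quadE in G1 G2.
have /andP[mx' x2] := mx; have /andP[t0 t2] := theta_itv.
have x0 : 0 < x by apply: le_lt_trans mx'; exact: le_trans am.
have hA : 0 < 256 * sin x ^+ 2 by exact: mulr_gt0.
have hB : 0 < sin x ^+ 2 * (1 - sin x ^+ 2) ^+ 2.
  by apply: mulr_gt0 => //; rewrite exprn_gt0// subr_gt0.
split=> h.
  rewrite subr_gt0 ltr_ln ?posrE ?(mulr_gt0 hA)//.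
  by rewrite ltr_pM2l// -subr_gt0 G1; apply: sin2_lt; lra.
rewrite subr_lt0 ltr_ln ?posrE ?(mulr_gt0 hA)//.
by rewrite ltr_pM2l// -subr_lt0 G2; apply: sin2_lt; lra.
Qed.

Let potential_mvt x y : m <= x -> x < y -> y <= pi / 2 ->
  exists2 z, x < z < y & potential a b c y - potential a b c x = df z * (y - x).
Proof.
move=> mx xy y2.
have dz z : z \in `]x, y[%R -> is_derive z 1 (potential a b c) (df z).
  by rewrite in_itv /= => /andP[z1 z2]; apply: is_derive_potential; apply/andP; split; lra.
have [z] := MVT xy dz (continuous_subspaceT (@continuous_potential a b c)).
by rewrite in_itv /= => zI E; exists z.
Qed.

(** The potential increases from theta to pi / 2, where it vanishes. *)
Lemma potential_theta_lt0 : potential a b c theta < 0.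
Proof.
have /andP[t0 t2] := theta_itv.
have [z /andP[z1 z2]] := potential_mvt le_theta t2 (lexx _).
rewrite potential_pihalf sub0r => E; rewrite -oppr_gt0 E mulr_gt0 ?subr_gt0//.
by apply: (df_sign _).1 => //; apply/andP; split=> //; have := le_theta; lra.
Qed.

Lemma potential_theta_le x : m <= x -> x <= pi / 2 -> potential a b c theta <= potential a b c x.
Proof.
move=> mx x2; have /andP[t0 t2] := theta_itv; have mt := le_theta.
case: (ltgtP x theta) => [xt|tx|->//]; rewrite -subr_ge0.
  have [z /andP[z1 z2]] := potential_mvt mx xt (ltW t2).
  move=> E; rewrite -opprB E oppr_ge0 mulr_le0_ge0 ?subr_ge0 ?(ltW xt)// ltW//.
  by apply: (df_sign _).2 => //; apply/andP; split; lra.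
have [z /andP[z1 z2]] := potential_mvt mt tx x2.
move=> ->; rewrite mulr_ge0 ?subr_ge0 ?(ltW tx)// ltW//.
by apply: (df_sign _).1 => //; apply/andP; split; lra.
Qed.
End Minimum.

Lemma theta_exists (a b c : R) : exists2 th, 0 < th < pi / 2 &
  tan th ^+ 4 - (a ^+ 2 + b ^+ 2 + c ^+ 2 + 1) * tan th ^+ 2 - a ^+ 2 * b ^+ 2 * c ^+ 2 = 0.
Proof.
pose e1 := a ^+ 2 + b ^+ 2 + c ^+ 2 + 1; pose e3 := a ^+ 2 * b ^+ 2 * c ^+ 2.
have e1p : 0 < e1 by rewrite /e1; have := sqr_ge0 a; have := sqr_ge0 b; have := sqr_ge0 c; lra.
have e3p : 0 <= e3 by apply: mulr_ge0; [apply: mulr_ge0|]; exact: sqr_ge0.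
pose D := Num.sqrt (e1 ^+ 2 + 4 * e3).
have D0 : 0 <= D by exact: sqrtr_ge0.
have DE : D ^+ 2 = e1 ^+ 2 + 4 * e3 by rewrite sqr_sqrtr// addr_ge0 ?(sqr_ge0 e1)// mulr_ge0.
pose u := (e1 + D) / 2.
have u0 : 0 < u by rewrite divr_gt0// ltr_wpDr.
have uE : u ^+ 2 - e1 * u - e3 = 0.
  have -> : u ^+ 2 - e1 * u - e3 = (D ^+ 2 - e1 ^+ 2 - 4 * e3) / 4 by rewrite /u; field.
  by rewrite DE; ring.
exists (atan (Num.sqrt u)).
  rewrite atan_ltpi2 andbT -atan0; apply: lt_atan; by rewrite sqrtr_gt0.
rewrite atanK -/e1 -/e3 (_ : 4 = 2 * 2)%N// exprM sqr_sqrtr ?(ltW u0)//.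
Qed.
End Potential.

(** * Estimates at a fixed level *)

Section Asymptotics.
Context {R : realType}.
Notation Lam := (@lobachevsky R).

(** Heine's theorem by a compactness argument, with [y] free to leave the interval. *)
Lemma lobachevsky_unif (A e : R) : 0 < e -> exists2 d, 0 < d &
  forall x y, `|x| <= A -> `|x - y| < d -> `|Lam x - Lam y| < e.
Proof.
move=> e0.
have cK : compact (`[(- A), A]%classic : set R) by exact: segment_compact.
have /compact_near_coveringP nc := cK.
pose P (d x : R) := forall y, `|x - y| < d -> `|Lam x - Lam y| < e.
have : \forall d \near 0^'+, `[(- A), A]%classic `<=` P d.
  apply: nc => x _.
  have e2 : 0 < e / 2 by rewrite divr_gt0.
  have /cvgrPdist_lt/(_ _ e2)/nbhs_ballP[d /= d0 hd] := @continuous_lobachevsky R x.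
  have d2 : 0 < d / 2 by rewrite divr_gt0.
  near=> z t => y zy.
  have xz : `|x - z| < d / 2 by near: z; exact: nbhsx_ballx.
  have td : t < d / 2 by near: t; exact: nbhs_right_lt.
  have xz' : `|x - z| < d by apply: (lt_trans xz); rewrite ltr_pdivrMr// ltr_pMr// ltr1n.
  have h1 := hd z xz'.
  have xy : `|x - y| < d.
    have -> : x - y = (x - z) + (z - y) by ring.
    by apply: (le_lt_trans (ler_normD _ _)); rewrite (splitr d) ltrD//; exact: lt_trans td.
  have h2 := hd y xy.
  have -> : Lam z - Lam y = (Lam x - Lam y) - (Lam x - Lam z) by ring.
  by apply: (le_lt_trans (ler_normB _ _)); rewrite (splitr e) ltrD.
move=> near_d; near (0 : R)^'+ => d.
exists d; first by near: d; exact: nbhs_right_gt.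
move=> x y xA xy; have : `[(- A), A]%classic `<=` P d by near: d; exact: near_d.
by move=> /(_ x); apply=> //=; rewrite in_itv /= -ler_norml.
Unshelve. all: by end_near. Qed.

Notation hn n := (qangle (2 * n + 1)%N : R).

Lemma near_hn_lt (e : R) : 0 < e ->
  \forall n \near \oo, [/\ (0 < n)%N, hn n < e & hn n * ln (2 * n + 1)%N%:R < e].
Proof.
(* For r > C one has 4 pi / sqrt r < e. This number equals 2 h sqrt r and dominates both h and h ln
   r = 2 h ln (sqrt r). *)
move=> e0; pose C := (4 * pi / e) ^+ 2.
have p0 := pi_gt0 R.
have C0 : 0 < C by rewrite exprn_gt0// divr_gt0// mulr_gt0.
exists (Num.bound C).+1 => // n /= Cn.
have n0 : (0 < n)%N by lia.
set r := (2 * n + 1)%N.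
have rC : C < r%:R.
  have h := archi_boundP (ltW C0).
  by apply: lt_trans h _; rewrite ltr_nat /r; lia.
have r1 : 1 <= r%:R :> R by rewrite ler1n /r; lia.
have r0 : 0 < r%:R :> R by rewrite (lt_le_trans ltr01).
have s0 : 0 < Num.sqrt r%:R :> R by rewrite sqrtr_gt0.
have sr : Num.sqrt r%:R ^+ 2 = r%:R :> R by rewrite sqr_sqrtr// ltW.
have sC : 4 * pi / e < Num.sqrt r%:R :> R.
  have u0 : 0 <= 4 * pi / e by rewrite ltW// divr_gt0// mulr_gt0.
  by rewrite -(ltr_pXn2r (n := 2)) ?nnegrE ?sr ?(ltW s0).
have hs : hn n = 2 * pi / Num.sqrt r%:R ^+ 2 by rewrite sr.
have s1 : 1 <= Num.sqrt r%:R :> R by rewrite -[leLHS](@sqrtr1 R) ler_wsqrtr.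
have hlt : 4 * pi / Num.sqrt r%:R < e.
  rewrite ltr_pdivrMr// [ltRHS]mulrC; move: sC; rewrite ltr_pdivrMr//.
have hE : hn n * (2 * Num.sqrt r%:R) = 4 * pi / Num.sqrt r%:R.
  by rewrite hs; field; rewrite gt_eqF.
have h0 : 0 < hn n by exact: qangle_gt0.
split=> //.
  apply: le_lt_trans hlt; rewrite -hE ler_peMr ?(ltW h0)//; lra.
apply: le_lt_trans hlt; rewrite -hE; apply: ler_wpM2l; first exact: ltW.
rewrite -[X in ln X]sr lnXn// -[X in X <= _]mulr_natl ler_pM2l//.
exact/ltW/ln_sublinear.
Qed.

(** One third of [e] each goes to h ln r, to the value of the Lobachevsky function at h / 2, and to
    the shift from m + 1/2 to m. The range 10 exceeds all angles h m < 2 pi. *)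
Lemma near_sf_lobachevsky (e : R) : 0 < e -> \forall n \near \oo,
  forall m, (m < 2 * n + 1)%N -> `|hn n * ln `|sf (hn n) m| + Lam (hn n * m%:R)| <= e.
Proof.
move=> e0; have e3 : 0 < e / 3 by rewrite divr_gt0.
have [d d0 Hd] := lobachevsky_unif 10 e3.
have md : 0 < Num.min (e / 3) d by rewrite lt_min e3.
have := near_hn_lt md; apply: filterS => n [n0 + hl] m mr.
rewrite !lt_min => /andP[he hd]; rewrite lt_min in hl; case/andP: hl => hl _.
have hs := @ln_sf_bound R n n0 m mr.
have h0 : 0 < hn n by exact: qangle_gt0.
have hR := @qangle_r R n.
have p4 : pi < 4 :> R by have := pihalf_lt2 R; lra.
have mr' : m%:R <= (2 * n + 1)%N%:R :> R by rewrite ler_nat ltnW.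
have hm : 0 <= hn n * m%:R by rewrite mulr_ge0// ltW.
have hm8 : hn n * m%:R <= 8.
  by apply: (@le_trans _ _ (hn n * (2 * n + 1)%N%:R)); rewrite ?ler_wpM2l ?(ltW h0)// hR; lra.
have := Hd (hn n * m%:R) (hn n * (m%:R + 1 / 2)).
rewrite ger0_norm// (_ : _ - _ = - (hn n / 2)); last by field.
rewrite normrN ger0_norm; last by rewrite divr_ge0// ltW.
move=> /(_ ltac:(lra) ltac:(lra)) H1.
have := Hd 0 (hn n / 2).
rewrite normr0 sub0r normrN ger0_norm; last by rewrite divr_ge0// ltW.
move=> /(_ ltac:(lra) ltac:(lra)); rewrite lobachevsky0 sub0r normrN => H2.
rewrite -[X in `|X|](subrK (hn n * ln `|sf (hn n) m| + Lam (hn n * (m%:R + 1 / 2)))).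
apply: (le_trans (ler_normD _ _)); rewrite opprD addrACA subrr add0r; lra.
Qed.
End Asymptotics.

(** * Numerators and denominators of the interpolation coefficients *)

Section LagrangeDenominator.
Context {R : realType}.
Variable h : R.

Definition lagrange_den (K m : nat) : R :=
  sg h m%:R * \prod_(j < K | j.+1 != m) (sg h (m%:R + j.+1%:R) * sg h (m%:R - j.+1%:R)).

(** Here [K] counts the nodes beyond [m]. Restoring the missing factor sg (2 m) completes the
    products to factorials, up to sign. *)
Lemma lagrange_den_norm (K m : nat) : (0 < m)%N ->
  `|lagrange_den (m + K) m| * `|sg h (2 * m)%:R| = `|sf h (m + K + m)| * `|sf h K|.
Proof.
move=> m0; elim: K => [|K IH].
  rewrite addn0 sf0 normr1 mulr1 -normrM; congr `|_|.
  case: m m0 => // m _.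
  have -> : lagrange_den m.+1 m.+1 = sF h m m.+1%:R.
    rewrite /lagrange_den big_mkcond big_ord_recr /= eqxx mulr1 /sF big_add1 /= big_mkord.
    congr (_ * _); apply: eq_bigr => j _.
    by rewrite eqSS ltn_eqF//.
  have := @sF_nat _ h m m.+1 (ltnSn m); rewrite subnn sf0 mulr1 => ->.
  by rewrite (_ : m.+1 + m.+1 = (m.+1 + m).+1)%N ?sfS; [congr (_ * sg h _%:R)|]; lia.
rewrite /lagrange_den addnS big_mkcond big_ord_recr /= -big_mkcond /=.
rewrite ifT; last by apply/eqP; lia.
have -> : m%:R + (m + K).+1%:R = (m + K + m).+1%:R :> R by rewrite -natrD; congr _%:R; lia.
have -> : m%:R - (m + K).+1%:R = - K.+1%:R :> R by rewrite -addnS natrD; ring.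
rewrite mulrA -/(lagrange_den _ _) sgN addSn !sfS.
move: (sg h (m + K + m).+1%:R) (sg h K.+1%:R) (lagrange_den _ _) IH => u v d IH.
move: (sg h _) IH => s; rewrite !normrM normrN => IH; rewrite -[RHS]mulrACA -IH; ring.
Qed.

(** The numerator of the coefficient is [sF K z] deprived of its factor j = m. *)
Lemma sF_lagrange_coef (K m : nat) z : (0 < m <= K)%N -> lagrange_den K m != 0 ->
  lagrange_coef h K z m * (sg h (z + m%:R) * sg h (z - m%:R)) * lagrange_den K m = sF h K z.
Proof.
move=> /andP[m0 mK]; rewrite /lagrange_den mulf_eq0 negb_or => /andP[s0 p0].
have mK' : (m.-1 < K)%N by lia.
rewrite /lagrange_coef prodf_div /sF big_add1 /= big_mkord [in RHS](bigD1 (Ordinal mK'))//= prednK//.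
have eP (j : 'I_K) : (j.+1 != m) = (j != Ordinal mK').
  by rewrite -val_eqE /=; congr (~~ _); apply/eqP/eqP; lia.
rewrite -[in RHS](eq_bigl _ _ eP).
move: (sg h m%:R) (\prod_(j < K | j.+1 != m) _) (\prod_(j < K | j.+1 != m) _) s0 p0 => s p q s0 p0.
by field; apply/andP.
Qed.
End LagrangeDenominator.

Lemma normrD_same_sign (R : realDomainType) (x y : R) : 0 <= x * y -> `|x + y| = `|x| + `|y|.
Proof.
move=> xy; case: (ltgtP x 0) => [x0|x0|->]; last by rewrite normr0 !add0r.
  have y0 : y <= 0 by rewrite -(nmulr_rge0 _ x0).
  by rewrite !ler0_norm ?opprD ?(ltW x0)//; have := ltW x0; lra.
have y0 : 0 <= y by rewrite -(pmulr_rge0 _ x0).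
by rewrite !ger0_norm ?(ltW x0)// addr_ge0// ltW.
Qed.

(** A zero term would let the sign change unnoticed, hence the second condition. The induction keeps
    the partial sum and its last term of equal sign. *)
Lemma normr_sum_same_sign (R : realDomainType) (t : nat -> R) (m p : nat) :
  (forall k, (m <= k)%N -> (k.+1 < p)%N -> 0 <= t k * t k.+1 /\ t k != 0) ->
  `|\sum_(m <= k < p) t k| = \sum_(m <= k < p) `|t k|.
Proof.
have [mp|mp] := ltnP m p; last by rewrite !big_geq// normr0.
rewrite -(subnKC mp); move: (p - _)%N => d tP {mp}; rewrite addSn.
suff : `|\sum_(m <= k < (m + d).+1) t k| = \sum_(m <= k < (m + d).+1) `|t k|
    /\ 0 <= (\sum_(m <= k < (m + d).+1) t k) * t (m + d)%N by case.
elim: d tP => [|d IH] tP; first by rewrite addn0 !big_nat1 -expr2 sqr_ge0.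
have [|IH1 IH2] := IH; first by move=> k mk kd; apply: tP => //; lia.
have [tt t0] := tP (m + d)%N ltac:(lia) ltac:(lia).
have mS : (m <= (m + d).+1)%N by lia.
rewrite addnS (big_nat_recr _ _ t mS) (big_nat_recr _ _ (fun k => `|t k|) mS) /=.
set S := \sum_(m <= k < _) _ in IH1 IH2 *.
have St : 0 <= S * t (m + d).+1.
  have t2 : 0 < t (m + d)%N ^+ 2 by rewrite exprn_even_gt0.
  rewrite -(pmulr_lge0 _ t2).
  have -> : S * t (m + d).+1 * t (m + d)%N ^+ 2 = (S * t (m + d)%N) * (t (m + d)%N * t (m + d).+1) by ring.
  exact: mulr_ge0.
rewrite normrD_same_sign// IH1; split=> //.
by rewrite mulrDl addr_ge0// -expr2 sqr_ge0.
Qed.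

Ltac nat_lia := repeat match goal with
  | H : context [@Order.le] |- _ => clear H
  | H : context [@Order.lt] |- _ => clear H
  | H : context [@GRing.zero] |- _ => clear H
  | H : context [@ln] |- _ => clear H
  end; lia.

Ltac gen_lra := repeat match goal with
  | |- context [@lobachevsky ?T ?x] => move: (@lobachevsky T x)
  | |- context [@ln ?T ?x] => move: (@ln T x)
  end; intros; repeat match goal with H : is_true (_ && _) |- _ => case/andP: H => ? ? end;
  lra.

(** * Errors counted in multiples of eps *)

Section Estimates.
Context {R : realType}.
Notation Lam := (@lobachevsky R).
Variables (n : nat) (eps del : R).
Let r := (2 * n + 1)%N.
Let h : R := qangle r.
Hypotheses (n_gt0 : (0 < n)%N) (eps_gt0 : 0 < eps) (h_del : 4 * h < del).
Hypothesis sf_lobachevsky : forall m, (m < r)%N -> `|h * ln `|sf h m| + Lam (h * m%:R)| <= eps.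
Hypothesis lobachevsky_eps : forall x y, `|x| <= 10 -> `|x - y| < del -> `|Lam x - Lam y| < eps.
Hypothesis r_eps : h * ln (16 * r%:R ^+ 4) <= eps.

Let h_gt0 : 0 < h. Proof. exact: qangle_gt0. Qed.
Let h_r : h * r%:R = 2 * pi. Proof. exact: qangle_r. Qed.
Let pi_lt4 : pi < 4 :> R. Proof. by have := pihalf_lt2 R; lra. Qed.

Let E : R := expR (eps / h).

Let E_ge1 : 1 <= E.
Proof. by rewrite -expR0 ler_expR divr_ge0// ltW. Qed.

Let norm_h (x : R) : 0 <= x -> x <= r%:R -> `|h * x| <= 10.
Proof.
have h0 := ltW h_gt0.
move=> x0 xr; rewrite ger0_norm; last exact: mulr_ge0.
apply: (@le_trans _ _ (h * r%:R)); first exact: ler_wpM2l.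
by have := pi_lt4; rewrite h_r; lra.
Qed.

Lemma le_expr_of_ln (x : R) k : 0 < x -> h * ln x <= k%:R * eps -> x <= E ^+ k.
Proof.
move=> x0 xk; rewrite -expRM_natl -[leLHS]lnK ?posrE// ler_expR.
rewrite mulrA ler_pdivlMr//; rewrite mulrC; exact: xk.
Qed.

Lemma ge_expr_of_ln (x : R) k : 0 < x -> - (k%:R * eps) <= h * ln x -> 1 <= x * E ^+ k.
Proof.
move=> x0 xk; rewrite -expRM_natl -[X in _ <= X * _]lnK ?posrE// -expRD -[leLHS]expR0 ler_expR.
have -> : ln x + k%:R * (eps / h) = (h * ln x + k%:R * eps) / h.
  by field; rewrite gt_eqF.
rewrite divr_ge0 ?(ltW h_gt0)//; lra.
Qed.

(** A quotient of consecutive factorials: one eps for each, and one for the shift of the Lobachevsky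
    function by h. *)
Lemma ln_sg_ge_eps (j : nat) : (0 < j < r)%N -> - (3 * eps) <= h * ln `|sg h j%:R|.
Proof.
case: j => // j /= jr.
have s0 : 0 < `|sg h j.+1%:R| by rewrite normr_gt0 sg_qangle_neq0.
have sf0 : 0 < `|sf h j| by rewrite normr_gt0 sf_qangle_neq0//; nat_lia.
have := sf_lobachevsky jr; have := sf_lobachevsky (ltnW jr).
rewrite sfS normrM lnM ?posrE// !ler_norml mulrDr.
have := @lobachevsky_eps (h * j.+1%:R) (h * j%:R).
rewrite norm_h ?ler_nat ?(ltnW jr)// (_ : h * _ - _ = h); last by rewrite -natr1; ring.
rewrite [`|h|]gtr0_norm//.
have h1 : h < del by have := h_del; have := h_gt0; lra.
move=> /(_ isT h1); rewrite ltr_norml.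
gen_lra.
Qed.

(** One eps for each factorial of [sF_nat], and one for replacing N - k - 1 by N - k. *)
Lemma ln_sF_bound (k N : nat) : (k < N)%N -> (N + k < r)%N ->
  `|h * ln `|sF h k N%:R| - (Lam (h * N%:R - h * k%:R) - Lam (h * N%:R + h * k%:R))| <= 3 * eps.
Proof.
move=> kN Nk.
have f1 : 0 < `|sf h (N + k)| by rewrite normr_gt0 sf_qangle_neq0.
have f2 : 0 < `|sf h (N - k.+1)| by rewrite normr_gt0 sf_qangle_neq0//; nat_lia.
have := congr1 Num.norm (sF_nat h kN); rewrite normrM => E1.
have F0 : 0 < `|sF h k N%:R| by rewrite -(pmulr_lgt0 _ f2) E1.
have := congr1 (@ln R) E1; rewrite lnM ?posrE// => E2.
have E3 : h * ln `|sF h k N%:R| = h * ln `|sf h (N + k)| - h * ln `|sf h (N - k.+1)|.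
  by rewrite -E2; ring.
have := sf_lobachevsky Nk; have := @sf_lobachevsky (N - k.+1)%N ltac:(nat_lia).
rewrite !ler_norml -mulrBr -mulrDr -natrD -natrB ?(ltnW kN)//.
have := @lobachevsky_eps (h * (N - k)%:R) (h * (N - k.+1)%:R).
have -> : (N - k = (N - k.+1).+1)%N by nat_lia.
rewrite norm_h ?ler_nat//; last by nat_lia.
move: (N - k.+1)%N E3 => j E3.
rewrite (_ : h * j.+1%:R - h * j%:R = h); last by rewrite -natr1; ring.
rewrite [`|h|]gtr0_norm//.
have h1 : h < del by have := h_del; have := h_gt0; lra.
move=> /(_ isT h1); rewrite ltr_norml.
rewrite E3.
gen_lra.
Qed.

Lemma ln_normM (x y : R) : x != 0 -> y != 0 -> ln `|x * y| = ln `|x| + ln `|y|.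
Proof. by move=> x0 y0; rewrite normrM lnM ?posrE ?normr_gt0. Qed.

Lemma ln_normV (x : R) : x != 0 -> ln `|x^-1| = - ln `|x|.
Proof. by move=> x0; rewrite normfV lnV ?posrE ?normr_gt0. Qed.

Lemma sF_neq0 (k N : nat) : (k < N)%N -> (N + k < r)%N -> sF h k N%:R != 0.
Proof.
move=> kN Nk; apply/eqP => F0; have := sF_nat h kN.
by rewrite F0 mul0r => /esym/eqP; apply/negP; exact: sf_qangle_neq0.
Qed.

Section Term.
Variables (k N1 N2 N3 : nat).
Hypotheses (k1 : (k < N1)%N) (k2 : (k < N2)%N) (k3 : (k < N3)%N).
Hypotheses (r1 : (N1 + k < r)%N) (r2 : (N2 + k < r)%N) (r3 : (N3 + k < r)%N).

Lemma jones_term_neq0 : jones_term h k N1%:R N2%:R N3%:R != 0.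
Proof.
have s1 : sg h 1 != 0 by apply: (@sg_qangle_neq0 _ n n_gt0 1); rewrite -/r /r; nat_lia.
have f1 : sf h k != 0 by apply: sf_qangle_neq0 => //; rewrite -/r; nat_lia.
have f2 : sf h (2 * k).+1 != 0 by apply: sf_qangle_neq0 => //; rewrite -/r; nat_lia.
have := sF_neq0 k1 r1; have := sF_neq0 k2 r2; have := sF_neq0 k3 r3.
rewrite /jones_term; move: (sF h k N1%:R) (sF h k N2%:R) (sF h k N3%:R) => x y z z0 y0 x0.
move: (sf h k) (sf h (2 * k).+1) (sg h 1) f1 f2 s1 => f g s f0 g0 s0.
by rewrite !mulf_eq0 !expf_eq0 ?mulf_eq0 !invr_eq0 oppr_eq0 oner_eq0 andbF !negb_or /= x0 y0 z0 f0 g0 s0.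
Qed.

Lemma ln_jones_term : ln `|jones_term h k N1%:R N2%:R N3%:R| =
  ln `|sF h k N1%:R| + ln `|sF h k N2%:R| + ln `|sF h k N3%:R|
  + 2 * ln `|sf h k| - 2 * ln `|sf h (2 * k).+1| - ln `|sg h 1|.
Proof.
have s1 : sg h 1 != 0 by apply: (@sg_qangle_neq0 _ n n_gt0 1); rewrite -/r /r; nat_lia.
have f1 : sf h k != 0 by apply: sf_qangle_neq0 => //; rewrite -/r; nat_lia.
have f2 : sf h (2 * k).+1 != 0 by apply: sf_qangle_neq0 => //; rewrite -/r; nat_lia.
have := sF_neq0 k1 r1; have := sF_neq0 k2 r2; have := sF_neq0 k3 r3.
rewrite /jones_term; move: (sF h k N1%:R) (sF h k N2%:R) (sF h k N3%:R) => x y z z0 y0 x0.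
move: (sf h k) (sf h (2 * k).+1) (sg h 1) f1 f2 s1 => f g s f0 g0 s0.
have xyz : (-1) ^+ k * x * y * z * (f / g) ^+ 2 / s
    = (-1) ^+ k * (x * (y * (z * (f / g * (f / g) * s^-1)))) by ring.
rewrite xyz normrM normrX normrN1 expr1n mul1r.
have s1 : s^-1 != 0 by rewrite invr_eq0.
have g1 : g^-1 != 0 by rewrite invr_eq0.
have e0 := mulf_neq0 f0 g1; have e1 := mulf_neq0 (mulf_neq0 e0 e0) s1.
have e2 := mulf_neq0 z0 e1; have e3 := mulf_neq0 y0 e2.
rewrite (ln_normM x0 e3) (ln_normM y0 e2) (ln_normM z0 e1) (ln_normM (mulf_neq0 e0 e0) s1).
by rewrite (ln_normM e0 e0) (ln_normM f0 g1) !ln_normV//; ring.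
Qed.

(** 17 = 3 * 3 for the colours, 2 for [sf k], 2 for [sf (2 * k).+1], 2 for replacing 2 k + 1 by 2 k,
    and 2 for [sg 1]. *)
Lemma ln_jones_term_bound :
  `|h * ln `|jones_term h k N1%:R N2%:R N3%:R| -
   (Lam (h * N1%:R - h * k%:R) - Lam (h * N1%:R + h * k%:R)
   + (Lam (h * N2%:R - h * k%:R) - Lam (h * N2%:R + h * k%:R))
   + (Lam (h * N3%:R - h * k%:R) - Lam (h * N3%:R + h * k%:R))
   + 2 * Lam (2 * (h * k%:R)) - 2 * Lam (h * k%:R))| <= 17 * eps.
Proof.
have hd : h < del by have := h_del; have := h_gt0; lra.
have B1 := ln_sF_bound k1 r1; have B2 := ln_sF_bound k2 r2; have B3 := ln_sF_bound k3 r3.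
have B4 := @sf_lobachevsky k ltac:(nat_lia).
have B5 := @sf_lobachevsky (2 * k).+1 ltac:(nat_lia).
have B6 := @sf_lobachevsky 1 ltac:(nat_lia).
have := @lobachevsky_eps 0 h; rewrite normr0 sub0r normrN (gtr0_norm h_gt0).
rewrite lobachevsky0 sub0r normrN => /(_ (ler0n _ 10) hd) B7.
have := @lobachevsky_eps (h * (2 * k).+1%:R) (2 * (h * k%:R)).
have -> : h * (2 * k).+1%:R - 2 * (h * k%:R) = h by rewrite -natr1 natrM; ring.
rewrite norm_h ?ler_nat//; last nat_lia.
rewrite (gtr0_norm h_gt0) => /(_ isT hd) B8.
have s1 : sf h 1 = sg h 1 by rewrite /sf big_nat1.
move: B6; rewrite s1 mulr1 => B6.
rewrite ln_jones_term.
move: B1 B2 B3 B4 B5 B6; rewrite !ler_norml; move: B7 B8; rewrite !ltr_norml.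
gen_lra.
Qed.

(** Moving each h N_i to its limit x_i costs 2 eps, and 23 = 17 + 3 * 2. Passing from x_i to |x_i -
    pi| is exact, by oddness and the period pi. *)
Lemma ln_jones_term_potential (x1 x2 x3 a b c : R) :
  `|x1 - pi| = a -> `|x2 - pi| = b -> `|x3 - pi| = c ->
  `|h * N1%:R - x1| < del -> `|h * N2%:R - x2| < del -> `|h * N3%:R - x3| < del ->
  `|h * ln `|jones_term h k N1%:R N2%:R N3%:R| - potential a b c (h * k%:R)| <= 23 * eps.
Proof.
move=> Xa Xb Xc d1 d2 d3.
have step (N : nat) (x u : R) : `|x - pi| = u -> `|h * N%:R - x| < del -> (k < N)%N -> (N + k < r)%N ->
    `|Lam (h * N%:R - h * k%:R) - Lam (h * N%:R + h * k%:R)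
      - (Lam (u - h * k%:R) - Lam (u + h * k%:R))| <= 2 * eps.
  move=> xu dN kN Nk.
  have -> : Lam (u - h * k%:R) - Lam (u + h * k%:R) = Lam (x - h * k%:R) - Lam (x + h * k%:R).
    move: xu; case: (ger0P (x - pi)) => _ <-.
      rewrite -[Lam (x - pi - _)]lobachevskyDpi -[Lam (x - pi + _)]lobachevskyDpi.
      by congr (Lam _ - Lam _); ring.
    rewrite (_ : - (x - pi) - h * k%:R = - (x + h * k%:R) + pi); last ring.
    rewrite (_ : - (x - pi) + h * k%:R = - (x - h * k%:R) + pi); last ring.
    by rewrite !lobachevskyDpi !lobachevskyN opprK addrC.
  have := @lobachevsky_eps (h * N%:R - h * k%:R) (x - h * k%:R).
  rewrite -mulrBr -(natrB _ (ltnW kN)) norm_h ?ler_nat//; last nat_lia.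
  rewrite natrB ?(ltnW kN)// mulrBr.
  rewrite (_ : h * N%:R - h * k%:R - (x - h * k%:R) = h * N%:R - x); last ring.
  move=> /(_ isT dN).
  have := @lobachevsky_eps (h * N%:R + h * k%:R) (x + h * k%:R).
  rewrite -mulrDr -natrD norm_h ?ler_nat//; last nat_lia.
  rewrite natrD mulrDr.
  rewrite (_ : h * N%:R + h * k%:R - (x + h * k%:R) = h * N%:R - x); last ring.
  move=> /(_ isT dN).
  rewrite !ltr_norml ler_norml; gen_lra.
have := step _ _ _ Xa d1 k1 r1; have := step _ _ _ Xb d2 k2 r2; have := step _ _ _ Xc d3 k3 r3.
have := ln_jones_term_bound; rewrite potentialE !ler_norml.
gen_lra.
Qed.
End Term.

Variable K : nat.
Hypothesis K2 : (2 * K <= n <= (2 * K).+1)%N.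

Let hK_pihalf : `|2 * (h * K%:R) - pi| < del.
Proof.
have h1 : h * (2 * n%:R + 1) = 2 * pi by rewrite -h_r /r natrD natrM.
have /andP[k1 k2] := K2.
have k1' : 2 * K%:R <= n%:R :> R by rewrite -natrM ler_nat.
have k2' : n%:R <= 2 * K%:R + 1 :> R by rewrite -natrM natr1 ler_nat.
have := ler_wpM2l (ltW h_gt0) k1'; have := ler_wpM2l (ltW h_gt0) k2'.
rewrite mulrDr mulr1 [h * (2 * n%:R)]mulrCA in h1.
rewrite mulrDr mulr1 [h * (2 * K%:R)]mulrCA.
move: (h * n%:R) (h * K%:R) h1 h_del h_gt0 => x y h1 h2 h3 h4 h5.
by rewrite ltr_norml; apply/andP; split; lra.
Qed.

(** As 2 h K is close to pi, the angles h (N + K) and h (N - K) agree up to the period, and so do h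
    (K + m) and - h (K - m). Hence the growth rates cancel separately in [sF] and in the product of
    factorials. *)
Lemma ln_sF_ratio_le (m N : nat) : (0 < m <= K)%N -> (K < N)%N -> (N + K < r)%N ->
  h * (ln `|sF h K N%:R| - ln `|sf h (K + m)| - ln `|sf h (K - m)|) <= 7 * eps.
Proof.
move=> /andP[m0 mK] KN NK; have /andP[k1 k2] := K2.
have B1 := ln_sF_bound KN NK.
have B2 := @sf_lobachevsky (K + m) ltac:(nat_lia).
have B3 := @sf_lobachevsky (K - m) ltac:(nat_lia).
have := @lobachevsky_eps (h * N%:R + h * K%:R) (h * N%:R - h * K%:R + pi).
rewrite lobachevskyDpi -mulrDr -natrD norm_h ?ler_nat//; last exact: ltnW.
rewrite natrD (_ : h * (N%:R + K%:R) - (h * N%:R - h * K%:R + pi) = 2 * (h * K%:R) - pi); last ring.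
move=> /(_ isT hK_pihalf) B4.
have := @lobachevsky_eps (h * (K + m)%:R) (h * (m%:R - K%:R) + pi).
rewrite lobachevskyDpi norm_h ?ler_nat//; last nat_lia.
have -> : h * (K + m)%:R - (h * (m%:R - K%:R) + pi) = 2 * (h * K%:R) - pi by rewrite natrD; ring.
move=> /(_ isT hK_pihalf).
have -> : h * (m%:R - K%:R) = - (h * (K - m)%:R) by rewrite natrB//; ring.
rewrite lobachevskyN => B5.
rewrite -mulrDr in B1.
have arith (F f1 f2 A B C D e : R) : `|F - (A - B)| <= 3 * e -> `|f1 + C| <= e -> `|f2 + D| <= e ->
    `|B - A| < e -> `|C - - D| < e -> F - f1 - f2 <= 7 * e.
  rewrite !ler_norml !ltr_norml => /andP[? ?] /andP[? ?] /andP[? ?] /andP[? ?] /andP[? ?]; lra.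
by rewrite !mulrBr; exact: arith B1 B2 B3 B4 B5.
Qed.

(** 13 = 7 + 3 + 3: the previous ratio and the two divisors sg (N + m) and sg (N - m), each at least
    E^-3 in modulus. The factor 2 bounds the restored sg (2 m). *)
Lemma lagrange_coef_bound (m N : nat) : (0 < m <= K)%N -> (K < N)%N -> (N + K < r)%N ->
  `|lagrange_coef h K N%:R m| <= 2 * E ^+ 13.
Proof.
move=> mK KN NK; have /andP[k1 k2] := K2; have /andP[m0 mK'] := mK.
have F0 : 0 < `|sF h K N%:R| by rewrite normr_gt0 sF_neq0.
have f1 : 0 < `|sf h (K + m)| by rewrite normr_gt0; apply: sf_qangle_neq0 => //; rewrite -/r; nat_lia.
have f2 : 0 < `|sf h (K - m)| by rewrite normr_gt0; apply: sf_qangle_neq0 => //; rewrite -/r; nat_lia.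
have s0 : 0 < `|sg h (2 * m)%:R| by rewrite normr_gt0; apply: sg_qangle_neq0 => //; rewrite -/r; nat_lia.
have s2 := sg_max h (2 * m)%:R.
have D1 := @lagrange_den_norm _ h (K - m) m m0.
rewrite subnKC// in D1.
have D0 : lagrange_den h K m != 0.
  by rewrite -normr_gt0 -(pmulr_lgt0 _ s0) D1 mulr_gt0.
have cE : `|lagrange_coef h K N%:R m| * (`|sg h (N + m)%:R| * `|sg h (N - m)%:R|)
    * `|lagrange_den h K m| = `|sF h K N%:R|.
  have mN : (m <= N)%N by nat_lia.
  have := @sF_lagrange_coef _ h K m N%:R mK D0; rewrite -natrD -natrB// => <-.
  move: (lagrange_coef _ _ _ _) (lagrange_den _ _ _) (sg h (N + m)%:R) (sg h (N - m)%:R) => *.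
  by rewrite !normrM.
have u1 : 1 <= `|sg h (N + m)%:R| * E ^+ 3.
  apply: ge_expr_of_ln; last by apply: ln_sg_ge_eps; nat_lia.
  by rewrite normr_gt0; apply: sg_qangle_neq0 => //; rewrite -/r; nat_lia.
have v1 : 1 <= `|sg h (N - m)%:R| * E ^+ 3.
  apply: ge_expr_of_ln; last by apply: ln_sg_ge_eps; nat_lia.
  by rewrite normr_gt0; apply: sg_qangle_neq0 => //; rewrite -/r; nat_lia.
have g12 : 0 < `|sf h (K + m)| * `|sf h (K - m)| by rewrite mulr_gt0.
have FE : `|sF h K N%:R| <= E ^+ 7 * (`|sf h (K + m)| * `|sf h (K - m)|).
  rewrite -ler_pdivrMr//; apply: le_expr_of_ln; first by rewrite divr_gt0.
  rewrite lnM ?posrE ?invr_gt0// lnV ?posrE// lnM ?posrE// opprD addrA.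
  exact: ln_sF_ratio_le mK KN NK.
have := normr_ge0 (lagrange_coef h K N%:R m).
move: `|lagrange_coef h K N%:R m| `|lagrange_den h K m| `|sF h K N%:R| `|sf h (K + m)| `|sf h (K - m)|
  `|sg h (2 * m)%:R| `|sg h (N + m)%:R| `|sg h (N - m)%:R| F0 f1 f2 s0 s2 D1 cE u1 v1 g12 FE
  => c D F g1 g2 s u v F0 f1 f2 s0 s2 D1 cE u1 v1 g12 FE c_ge0.
have E0 : 0 <= E by apply: le_trans E_ge1.
rewrite -(ler_pM2r g12).
have c0 : 0 <= c * (g1 * g2) by rewrite mulr_ge0 ?(ltW g12).
apply: (@le_trans _ _ (c * (g1 * g2) * ((u * E ^+ 3) * (v * E ^+ 3)))).
  rewrite -[leLHS]mulr1; apply: ler_wpM2l => //.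
  by rewrite -[leLHS]mulr1 ler_pM.
have -> : c * (g1 * g2) * ((u * E ^+ 3) * (v * E ^+ 3)) = F * s * E ^+ 6.
  by rewrite -cE -D1; ring.
have -> : 2 * E ^+ 13 * (g1 * g2) = E ^+ 7 * (g1 * g2) * 2 * E ^+ 6 by ring.
apply: ler_wpM2r; first exact: exprn_ge0.
by rewrite ler_pM// ltW.
Qed.
Lemma r4_le : 16 * r%:R ^+ 4 <= E.
Proof.
have r0 : 0 < r%:R :> R by rewrite ltr0n; nat_lia.
rewrite -[leRHS]expr1; apply: le_expr_of_ln; last by rewrite mul1r.
by rewrite mulr_gt0// exprn_gt0.
Qed.

(** Here 4 M <= 4 K < r gives the positivity of sines up to 2 M and of cosines up to M, and w = E^-3
    bounds the sines from below. *)
Lemma sum_jones_term_integer_bound (M : nat) x y : (0 < M <= K)%N ->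
  `|\sum_(k < M) jones_term h k x y M%:R| <= 8 * r%:R ^+ 3 * E ^+ 9.
Proof.
move=> /andP[M0 MK]; have /andP[k1 k2] := K2.
have E0 : 0 < E by apply: lt_le_trans E_ge1.
have s0 (j : nat) : (0 < j <= 2 * M)%N -> 0 < sg h j%:R.
  by move=> /andP[j0 jM]; apply: sg_qangle_gt0 => //; nat_lia.
have c0 (c : nat) : (c <= M)%N -> 0 < cos (h * c%:R).
  move=> cM; apply: cos_gt0_pihalf.
  have hc : 0 <= h * c%:R by apply: mulr_ge0 => //; exact: ltW.
  have : h * (4 * c%:R) < h * r%:R.
    by rewrite ltr_pM2l// -natrM ltr_nat; nat_lia.
  rewrite h_r mulrCA; move: (h * c%:R) (pi_gt0 R) hc => z p0 z0 z1.
  by apply/andP; split; lra.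
have w0 : 0 < (E ^+ 3)^-1 by rewrite invr_gt0 exprn_gt0.
have ws (j : nat) : (0 < j < 2 * M)%N -> (E ^+ 3)^-1 <= sg h j%:R.
  move=> /andP[j0 jM]; have sj := s0 j ltac:(nat_lia).
  have : 1 <= `|sg h j%:R| * E ^+ 3.
    by apply: ge_expr_of_ln; [rewrite gtr0_norm|apply: ln_sg_ge_eps; nat_lia].
  by rewrite (gtr0_norm sj) => H; rewrite -[leLHS]mul1r ler_pdivrMr// exprn_gt0.
apply: le_trans (@sum_jones_term_bound _ h M M0 s0 c0 _ x y w0 ws) _.
rewrite exprVn invrK -exprM ler_wpM2r ?exprn_ge0 ?(ltW E0)//.
by rewrite ler_wpM2l// lerXn2r ?nnegrE// ler_nat; nat_lia.
Qed.

(** 23 = 13 + 9 + 1, where the last power of E absorbs the K nodes and the polynomial factor. *)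
Lemma sum_jones_term_head_bound (N : nat) x y : (K < N)%N -> (N + K < r)%N ->
  `|\sum_(k < K) jones_term h k x y N%:R| <= E ^+ 23.
Proof.
move=> KN NK; have /andP[k1 k2] := K2.
have E0 : 0 < E by apply: lt_le_trans E_ge1.
rewrite sum_jones_term_interpolation; last 2 first.
- by move=> m mK; apply: sg_qangle_neq0 => //; nat_lia.
- move=> i j; wlog ij : i j / (j < i)%N => [hw|].
    move=> iK jK; rewrite neq_ltn => /orP[] ij; last first.
      by apply: hw => //; rewrite gtn_eqF.
    by rewrite -opprB sgN mulrN oppr_eq0 addrC; apply: hw => //; rewrite gtn_eqF.
  move=> iK jK _; rewrite -natrD -natrB ?(ltnW ij)//.
  by apply: mulf_neq0; apply: sg_qangle_neq0 => //; rewrite -/r; nat_lia.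
apply: le_trans (ler_norm_sum _ _ _) _.
apply: (@le_trans _ _ (\sum_(i < K) (2 * E ^+ 13) * (8 * r%:R ^+ 3 * E ^+ 9))).
  apply: ler_sum => i _; have iK : (0 < i.+1 <= K)%N by rewrite ltn_ord.
  rewrite normrM; apply: ler_pM => //; first exact: lagrange_coef_bound.
  exact: sum_jones_term_integer_bound.
rewrite sumr_const card_ord -[leLHS]mulr_natl.
have -> : K%:R * (2 * E ^+ 13 * (8 * r%:R ^+ 3 * E ^+ 9)) = 16 * (r%:R ^+ 3 * K%:R) * E ^+ 22 by ring.
rewrite [leRHS]exprS ler_wpM2r ?exprn_ge0 ?(ltW E0)//.
apply: le_trans r4_le; rewrite ler_wpM2l// [leRHS]exprSr ler_wpM2l ?exprn_ge0// ler_nat; nat_lia.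
Qed.

Lemma jones_term_same_sign (k N1 N2 N3 : nat) : (K <= k)%N ->
  (k.+1 < N1)%N -> (k.+1 < N2)%N -> (k.+1 < N3)%N ->
  (N1 + k.+1 < r)%N -> (N2 + k.+1 < r)%N -> (N3 + k.+1 < r)%N ->
  0 <= jones_term h k N1%:R N2%:R N3%:R * jones_term h k.+1 N1%:R N2%:R N3%:R.
Proof.
move=> Kk k1 k2 k3 r1 r2 r3; have /andP[n1 n2] := K2.
(* Both N and k + 1 exceed K, so N + k + 1 passes r / 2, whereas N - k - 1 < r - 2 K - 2 stays below
   it. *)
have neg (N : nat) : (k.+1 < N)%N -> (N + k.+1 < r)%N ->
    sg h (N%:R + k.+1%:R) * sg h (N%:R - k.+1%:R) < 0.
  move=> kN Nk; rewrite -natrD -natrB ?(ltnW kN)//.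
  rewrite nmulr_rlt0; first by apply: sg_qangle_gt0 => //; nat_lia.
  by apply: sg_qangle_lt0 => //; nat_lia.
have := neg _ k1 r1; have := neg _ k2 r2; have := neg _ k3 r3.
rewrite /jones_term !sFS.
move: (sg h (N1%:R + _) * _) (sg h (N2%:R + _) * _) (sg h (N3%:R + _) * _) => p1 p2 p3 p3_lt0 p2_lt0 p1_lt0.
move: (sF h k _) (sF h k _) (sF h k _) (sf h k / _) (sf h k.+1 / _) (sg h 1) => F3 F2 F1 f g s.
have -> : (-1) ^+ k * F1 * F2 * F3 * f ^+ 2 / s * ((-1) ^+ k.+1 * (F1 * p1) * (F2 * p2) * (F3 * p3) * g ^+ 2 / s)
    = (- p1) * (- p2) * (- p3) * ((-1) ^+ k * F1 * F2 * F3 * f * g / s) ^+ 2.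
  by rewrite [(-1) ^+ k.+1]exprS; ring.
by rewrite mulr_ge0 ?sqr_ge0// !mulr_ge0 ?oppr_ge0 ?ltW.
Qed.

(** * Comparison of head and tail *)

Section Sum.
Variables (a b c x1 x2 x3 P : R) (N1 N2 N3 kmax kstar : nat).
Hypotheses (X1 : `|x1 - pi| = a) (X2 : `|x2 - pi| = b) (X3 : `|x3 - pi| = c).
Hypotheses (d1 : `|h * N1%:R - x1| < del) (d2 : `|h * N2%:R - x2| < del)
  (d3 : `|h * N3%:R - x3| < del).
Hypotheses (k1 : (kmax < N1)%N) (k2 : (kmax < N2)%N) (k3 : (kmax < N3)%N).
Hypotheses (r1 : (N1 + kmax < r)%N) (r2 : (N2 + kmax < r)%N) (r3 : (N3 + kmax < r)%N).
Hypothesis kstar_itv : (K <= kstar <= kmax)%N.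
Hypothesis P_ge : 57 * eps <= P.
Hypothesis potential_le : forall k, (K <= k <= kmax)%N -> potential a b c (h * k%:R) <= P + 10 * eps.
Hypothesis potential_ge : P - 10 * eps <= potential a b c (h * kstar%:R).

Let t k := jones_term h k N1%:R N2%:R N3%:R.
Let T : R := expR (P / h).

Let T_gt0 : 0 < T. Proof. exact: expR_gt0. Qed.

Let ln_t k : (k <= kmax)%N -> `|h * ln `|t k| - potential a b c (h * k%:R)| <= 23 * eps.
Proof. by move=> kk; apply: ln_jones_term_potential X1 X2 X3 d1 d2 d3; nat_lia. Qed.

Let t_neq0 k : (k <= kmax)%N -> t k != 0.
Proof. by move=> kk; apply: jones_term_neq0; nat_lia. Qed.

Let T_expE (m : nat) : T * E ^+ m = expR ((P + m%:R * eps) / h).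
Proof. by rewrite -expRM_natl -expRD mulrDl mulrA. Qed.

Let ln_TE (x y : R) : 0 < x -> h * ln x <= y -> x <= expR (y / h).
Proof.
move=> x0 xy; rewrite -[leLHS]lnK ?posrE// ler_expR ler_pdivlMr// mulrC; exact: xy.
Qed.

Let t_le k : (K <= k <= kmax)%N -> `|t k| <= T * E ^+ 33.
Proof.
move=> /andP[Kk kk]; rewrite T_expE; apply: ln_TE; first by rewrite normr_gt0 t_neq0.
have := ln_t kk; have := @potential_le k; rewrite Kk kk => /(_ isT).
move: (potential _ _ _ _) (h * ln _) => u v; rewrite ler_norml => ? /andP[? ?]; lra.
Qed.

Let mul_h (x y : R) : (x + y * (eps / h)) * h = h * x + y * eps.
Proof. by field; rewrite gt_eqF. Qed.

Let t_ge : T <= `|t kstar| * E ^+ 33.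
Proof.
have /andP[Kk kk] := kstar_itv.
have := ln_t kk; have := potential_ge.
have tp : 0 < `|t kstar| by rewrite normr_gt0 t_neq0.
rewrite -[`|t kstar| in X in _ -> _ -> X]lnK ?posrE// -expRM_natl -expRD ler_expR ler_pdivrMr//.
rewrite mul_h.
move: (potential _ _ _ _) (h * ln _) => u v; rewrite ler_norml => ? /andP[? ?]; lra.
Qed.

Let tail_normE : `|\sum_(K <= k < kmax.+1) t k| = \sum_(K <= k < kmax.+1) `|t k|.
Proof.
apply: normr_sum_same_sign => k Kk kk; split; last by apply: t_neq0; nat_lia.
by apply: jones_term_same_sign => //; nat_lia.
Qed.

(** Each tail term is at most T E^33 with 33 = 23 + 10, and one more E absorbs the number of terms.
    From below, the tail times E^34 is at least T E >= 2 T, while the head times E^34 is at most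
    E^(23 + 34) = E^57 <= T, so at least T is left. *)
Lemma ln_sum_jones_term_bound : `|h * ln `|\sum_(0 <= k < kmax.+1) t k| - P| <= 34 * eps.
Proof.
have /andP[Kk kk] := kstar_itv.
have KK : (K <= kmax.+1)%N by nat_lia.
rewrite (big_cat_nat _ KK)//= big_mkord.
have head : `|\sum_(k < K) t k| <= E ^+ 23 by apply: sum_jones_term_head_bound; nat_lia.
have E0 : 0 < E by apply: lt_le_trans E_ge1.
have kr : 1 + kmax.+1%:R <= E.
  have : (1 + kmax.+1 <= 16 * r ^ 4)%N.
    have : (0 < r)%N by rewrite /r addn1.
    have : (kmax < r)%N by nat_lia.
    move=> rk r0; have := leq_pexp2l r0 (isT : 1 <= 4)%N; rewrite expn1.
    by move: (r ^ 4)%N => q; nat_lia.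
  rewrite -(ler_nat R) natrD natrM natrX => /le_trans; apply; exact: r4_le.
have E2 : 2 <= E.
  by apply: le_trans kr; rewrite (_ : 2 = 1 + 1)// lerD2l ler1n.
have TE : E ^+ 57 <= T.
  rewrite -expRM_natl ler_expR mulrA ler_pM2r ?invr_gt0//.
have T1 : 1 <= T by apply: le_trans TE; apply: exprn_ege1; exact: E_ge1.
have tail_le : `|\sum_(K <= k < kmax.+1) t k| <= kmax.+1%:R * (T * E ^+ 33).
  rewrite tail_normE.
  apply: (@le_trans _ _ (\sum_(K <= k < kmax.+1) T * E ^+ 33)).
    by rewrite big_nat_cond [leRHS]big_nat_cond; apply: ler_sum => k /andP[/andP[? ?] _]; apply: t_le; nat_lia.
  rewrite big_const_nat iter_addr_0 -[leLHS]mulr_natl.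
  by rewrite ler_wpM2r ?mulr_ge0 ?exprn_ge0 ?(ltW E0) ?(ltW T_gt0)// ler_nat leq_subr.
have tail_ge : T <= `|\sum_(K <= k < kmax.+1) t k| * E ^+ 33.
  apply: le_trans t_ge _; rewrite ler_wpM2r ?exprn_ge0 ?(ltW E0)// tail_normE.
  by rewrite (bigD1_seq kstar) ?iota_uniq ?mem_index_iota ?ltnS//= ?Kk// lerDl sumr_ge0.
set S1 := \sum_(k < K) _ in head *; set S2 := \sum_(K <= k < _) _ in tail_le tail_ge *.
have up : `|S1 + S2| <= T * E ^+ 34.
  apply: le_trans (ler_normD _ _) _; apply: le_trans (lerD head tail_le) _.
  apply: (@le_trans _ _ ((1 + kmax.+1%:R) * (T * E ^+ 33))).
    rewrite mulrDl mul1r lerD2r; apply: (@le_trans _ _ (E ^+ 33)).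
      by apply: ler_weXn2l => //; exact: E_ge1.
    by rewrite ler_peMl// exprn_ge0// ltW.
  rewrite [leRHS](_ : _ = E * (T * E ^+ 33)); last by rewrite [E ^+ 34]exprS; ring.
  by rewrite ler_wpM2r// mulr_ge0 ?exprn_ge0 ?(ltW E0) ?(ltW T_gt0).
have low : T <= `|S1 + S2| * E ^+ 34.
  have S12 : `|S2| <= `|S1 + S2| + `|S1|.
    by rewrite -[in leLHS](addKr S1 S2) addrC ler_normB.
  have F1 : `|S2| * E ^+ 34 <= (`|S1 + S2| + E ^+ 23) * E ^+ 34.
    by rewrite ler_wpM2r ?exprn_ge0 ?(ltW E0)//; apply: le_trans S12 _; rewrite lerD2l.
  have F2 : T * E <= `|S2| * E ^+ 34.
    by rewrite [E ^+ 34]exprSr mulrA ler_wpM2r ?(ltW E0).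
  have F3 : E ^+ 23 * E ^+ 34 <= T by rewrite -exprD.
  have F4 : T * 2 <= T * E by rewrite ler_pM2l.
  rewrite mulrDl in F1; move: F1 F2 F3 F4.
  move: (`|S2| * E ^+ 34) (`|S1 + S2| * E ^+ 34) (E ^+ 23 * E ^+ 34) (T * E) => *; lra.
have V0 : 0 < `|S1 + S2| by rewrite -(pmulr_lgt0 _ (exprn_gt0 34 E0)); exact: lt_le_trans low.
have : ln `|S1 + S2| <= (P + 34 * eps) / h.
  by rewrite -ler_expR lnK ?posrE// -T_expE.
have : P / h <= ln `|S1 + S2| + 34 * (eps / h).
  rewrite -ler_expR expRD lnK ?posrE// expRM_natl; exact: low.
rewrite ler_pdivlMr// ler_pdivrMr// mul_h [ln _ * h]mulrC.
move: (h * ln _) => v ? ?; rewrite ler_norml; apply/andP; split; lra.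
Qed.
End Sum.

End Estimates.

(** * The growth rate *)

Section Limit.
Context {R : realType}.
Notation Lam := (@lobachevsky R).
Notation hn n := (qangle (2 * n + 1)%N : R).

(** Three differences cost 2 eps each, and the two terms with coefficient 2 add 4 eps. The term in 2
    x is why the distance is doubled. *)
Lemma potential_eps (eps del a b c x y : R) :
  (forall u v, `|u| <= 10 -> `|u - v| < del -> `|Lam u - Lam v| < eps) ->
  0 <= a <= 2 -> 0 <= b <= 2 -> 0 <= c <= 2 -> 0 <= x <= 4 -> 2 * `|x - y| < del ->
  `|potential a b c x - potential a b c y| <= 10 * eps.
Proof.
move=> HU a2 b2 c2 /andP[x0 x4] xy.
have nxy := normr_ge0 (x - y).
have S u : 0 <= u <= 2 -> `|Lam (u - x) - Lam (u + x) - (Lam (u - y) - Lam (u + y))| <= 2 * eps.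
  move=> /andP[u0 u2].
  have H1 := HU (u - x) (u - y); have H2 := HU (u + x) (u + y).
  have {}H1 : `|Lam (u - x) - Lam (u - y)| < eps.
    apply: H1; first by rewrite ler_norml; apply/andP; split; lra.
    rewrite (_ : u - x - (u - y) = - (x - y)); last by ring.
    by rewrite normrN; lra.
  have {}H2 : `|Lam (u + x) - Lam (u + y)| < eps.
    apply: H2; first by rewrite ler_norml; apply/andP; split; lra.
    by rewrite (_ : u + x - (u + y) = x - y); [lra|ring].
  move: H1 H2; move: (Lam _) (Lam _) (Lam _) (Lam _) => p q s t.
  by rewrite !ltr_norml ler_norml => /andP[? ?] /andP[? ?]; apply/andP; split; lra.
have Hx : `|Lam x - Lam y| < eps by apply: HU; [rewrite ger0_norm//|]; lra.
have H2x : `|Lam (2 * x) - Lam (2 * y)| < eps.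
  apply: HU; first by rewrite ger0_norm; lra.
  by rewrite -mulrBr normrM ger0_norm.
have arith (A A' B B' C C' D D' F F' : R) : `|A - A'| <= 2 * eps -> `|B - B'| <= 2 * eps ->
    `|C - C'| <= 2 * eps -> `|D - D'| < eps -> `|F - F'| < eps ->
    `|A + B + C + 2 * D - 2 * F - (A' + B' + C' + 2 * D' - 2 * F')| <= 10 * eps.
  by rewrite !ler_norml !ltr_norml => /andP[? ?] /andP[? ?] /andP[? ?] /andP[? ?] /andP[? ?];
    apply/andP; split; lra.
by rewrite !potentialE; exact: arith (S _ a2) (S _ b2) (S _ c2) H2x Hx.
Qed.
Section FixedLevel.
Variables (n : nat) (eps del gam a b c x1 x2 x3 m theta : R) (w : 'I_3 -> nat).
Let r := (2 * n + 1)%N.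
Let h : R := qangle r.
Hypotheses (n_gt0 : (0 < n)%N) (eps_gt0 : 0 < eps) (h_del : 4 * h < del).
Hypothesis sf_lobachevsky : forall m, (m < r)%N -> `|h * ln `|sf h m| + Lam (h * m%:R)| <= eps.
Hypothesis lobachevsky_eps : forall x y, `|x| <= 10 -> `|x - y| < del -> `|Lam x - Lam y| < eps.
Hypothesis r_eps : h * ln (16 * r%:R ^+ 4) <= eps.
Hypotheses (a0 : 0 <= a) (b0 : 0 <= b) (c0 : 0 <= c).
Hypotheses (am : a <= m) (bm : b <= m) (cm : c <= m) (m2 : m < pi / 2).
Hypothesis m_max : m = a \/ m = b \/ m = c.
Hypothesis theta_itv : 0 < theta < pi / 2.
Hypothesis m_theta : m < theta.
Hypothesis potential_theta_min :
  forall x, m <= x -> x <= pi / 2 -> potential a b c theta <= potential a b c x.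
Hypothesis eps_le : 57 * eps <= - potential a b c theta.
Hypotheses (X1 : `|x1 - pi| = a) (X2 : `|x2 - pi| = b) (X3 : `|x3 - pi| = c).
Hypotheses (gam_del : 2 * gam <= del) (gam_theta : gam <= theta - m).
Hypotheses (d1 : `|h * (w 0).+1%:R - x1| < gam) (d2 : `|h * (w 1).+1%:R - x2| < gam)
  (d3 : `|h * (w 2%:R).+1%:R - x3| < gam).
Hypothesis w_weight : forall i, is_weight r (w i).

Let h_gt0 : 0 < h. Proof. exact: qangle_gt0. Qed.
Let h_r : h * r%:R = 2 * pi. Proof. exact: qangle_r. Qed.
Let pi_lt4 : pi < 4 :> R. Proof. by have := pihalf_lt2 R; lra. Qed.

Let kmax := borromean_kmax r w.

(** The range in terms of N_i = w_i + 1, the form in which the bounds on single terms are stated. *)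
Let le_kmax k : (k <= kmax)%N = [&& (k < (w 0%R).+1) && ((w 0%R).+1 + k < r),
  (k < (w 1%R).+1) && ((w 1%R).+1 + k < r) & (k < (w 2%:R%R).+1) && ((w 2%:R%R).+1 + k < r)]%N.
Proof.
have W := w_weight; rewrite /is_weight -/r in W.
rewrite /kmax /borromean_kmax !leq_min; have := W 0; have := W 1; have := W 2%:R.
move: (w 0) (w 1) (w 2%:R) => u v t ? ? ?.
have : (2 < r)%N by rewrite /r addn1 ltnS (leq_mul2l 2 1).
have E0 s : (s <= r - 2)%N -> (2 < r)%N -> ((k <= s) && (k <= r - (s + 1) - 1))%N = ((k < s.+1) && (s.+1 + k < r))%N.
  clear; move: r => q ? ?; lia.
by move=> ?; rewrite !E0.
Qed.

Let K := n./2.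
Let K2 : (2 * K <= n <= (2 * K).+1)%N.
Proof. by have := odd_double_half n; rewrite /K; case: (odd n); clear; lia. Qed.

Let h_n_lt : h * n%:R < pi.
Proof.
have : 2 * (h * n%:R) + h = 2 * pi by rewrite -h_r /r natrD natrM; ring.
by move: (h * n%:R) h_gt0 => z ? ?; lra.
Qed.

Let hK_ge : pi - del < 2 * (h * K%:R).
Proof.
have : 2 * (h * n%:R) + h = 2 * pi by rewrite -h_r /r natrD natrM; ring.
have /andP[_ k2] := K2.
have : n%:R <= 2 * K%:R + 1 :> R by rewrite -natrM natr1 ler_nat.
rewrite -(ler_pM2l h_gt0) [h * (_ + 1)]mulrDr mulr1 [h * (2 * K%:R)]mulrCA.
move: (h * n%:R) (h * K%:R) h_gt0 h_del => z y ? ? ? ?; lra.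
Qed.

(* up to [gam], the number [h (kmax + 1)] is [pi] minus the largest half-angle *)
Let h_lt k : (k <= kmax)%N -> h * k%:R < pi - m + gam.
Proof.
rewrite le_kmax => /and3P[/andP[k1 l1] /andP[k2 l2] /andP[k3 l3]].
have S (N : nat) (x u : R) : `|x - pi| = u -> `|h * N%:R - x| < gam -> (k < N)%N -> (N + k < r)%N ->
    h * k%:R < pi - u + gam.
  move=> xu dN kN Nk.
  have H1 : h * k%:R < h * N%:R by rewrite ltr_pM2l// ltr_nat.
  have : h * (N + k)%:R < h * r%:R by rewrite ltr_pM2l// ltr_nat.
  rewrite h_r natrD mulrDr; move: (h * k%:R) (h * N%:R) H1 dN xu => y z.
  rewrite ltr_norml; case: (ger0P (x - pi)) => ? ? /andP[? ?] <- ?; lra.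
by have [->|[->|->]] := m_max; [apply: S X1 d1 _ _|apply: S X2 d2 _ _|apply: S X3 d3 _ _].
Qed.

(** The maximiser pi - theta lies within the range of h k: its distance theta - m from the end pi -
    m is at least [gam]. *)
Let kmax_ge k : h * k%:R <= pi - theta -> (k <= kmax)%N.
Proof.
move=> kt; rewrite le_kmax.
have S (N : nat) (x u : R) : `|x - pi| = u -> `|h * N%:R - x| < gam -> u <= m ->
    ((k < N) && (N + k < r))%N.
  move=> xu dN um; have [H1 H2] : h * k%:R < h * N%:R /\ h * N%:R + h * k%:R < 2 * pi.
    move: (h * k%:R) (h * N%:R) kt dN xu um m_theta gam_theta => y z ?.
    by rewrite ltr_norml; case: (ger0P (x - pi)) => ? /andP[? ?] <- ? ? ?; split; lra.
  rewrite -(ltr_nat R) -(ltr_pM2l h_gt0) H1 /=.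
  by rewrite -(ltr_nat R) -(ltr_pM2l h_gt0) h_r natrD mulrDr.
by rewrite (S _ _ _ X1 d1 am) (S _ _ _ X2 d2 bm) (S _ _ _ X3 d3 cm).
Qed.

Let potential_eps_le x y : 0 <= x <= 4 -> 2 * `|x - y| < del ->
  `|potential a b c x - potential a b c y| <= 10 * eps.
Proof.
have := pihalf_lt2 R => p2.
by apply: potential_eps lobachevsky_eps _ _ _; rewrite ?a0 ?b0 ?c0 /=; move: am bm cm m2; lra.
Qed.

Let P := - potential a b c theta.

Let potential_le k : (K <= k <= kmax)%N -> potential a b c (h * k%:R) <= P + 10 * eps.
Proof.
move=> /andP[Kk kk]; have := h_lt kk; have := hK_ge.
have : h * K%:R <= h * k%:R by rewrite ler_pM2l// ler_nat.
move: (h * K%:R) => y.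
have x4 : 0 <= h * k%:R <= 4.
  rewrite mulr_ge0 ?(ltW h_gt0)//=.
  have : (2 * k < r)%N by move: kk; rewrite le_kmax => /andP[/andP[A B] _]; clear -A B; lia.
  rewrite -(ltr_nat R) -(ltr_pM2l h_gt0) h_r natrM mulrCA.
  move: (h * k%:R) pi_lt4 => z; lra.
move: (h * k%:R) x4 => x x4 yx yK xk; have /andP[x0 _] := x4.
have p2 := pihalf_lt2 R; have p0 := pi_gt0 R.
have [t0 t2] := andP theta_itv.
have P_le z : pi / 2 <= z -> z <= pi - m -> potential a b c z <= P.
  move=> z1 z2; rewrite -[z](subKr pi) potentialBpi lerN2.
  by apply: potential_theta_min; lra.
(* [z] is the point of [pi / 2, pi - m] nearest to x. On that interval the reflection x -> pi - x
   turns the minimum at theta into the bound [P]. *)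
have [z zx zP] : exists2 z, 2 * `|x - z| < del & potential a b c z <= P.
  case: (ltP x (pi / 2)) => xp.
    exists (pi / 2); last by apply: P_le => //; move: m2; lra.
    by rewrite ltr0_norm; lra.
  case: (ltP (pi - m) x) => xm; last by exists x; rewrite ?subrr ?normr0 ?mulr0 ?P_le//; move: h_gt0 h_del; lra.
  exists (pi - m); last by apply: P_le => //; move: m2; lra.
  by rewrite gtr0_norm; move: gam_del; lra.
have := potential_eps_le x4 zx; rewrite ler_norml => /andP[_]; move: zP.
move: (potential _ _ _ x) (potential _ _ _ z) P => u v q; lra.
Qed.

Lemma ln_jones_bound :
  `|h * ln (Normc.normc (borromean_jones R r w)) - P| <= 34 * eps.
Proof.
rewrite (jones_real n_gt0 w_weight) /Normc.normc /= expr0n addr0 sqrtr_sqr.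
have [t0 t2] := andP theta_itv; have p0 := pi_gt0 R.
have pt : 0 <= (pi - theta) / h by rewrite divr_ge0 ?(ltW h_gt0)//; lra.
(* The last index with h k <= pi - theta, hence within h of the maximiser. *)
pose ks := Num.truncn ((pi - theta) / h).
have /andP[ks1 ks2] := truncn_itv pt; rewrite -/ks in ks1 ks2.
rewrite ler_pdivlMr// mulrC in ks1; rewrite ltr_pdivrMr// mulrC in ks2.
have ksk := kmax_ge ks1.
have Kks : (K <= ks)%N.
  rewrite leqNgt; apply/negP => ksK; have /andP[k1 _] := K2.
  have : h * (2 * ks.+1)%:R <= h * n%:R.
    by rewrite ler_pM2l// ler_nat (leq_trans _ k1)// leq_mul2l.
  rewrite natrM mulrCA; move: (h * ks.+1%:R) (h * n%:R) ks2 h_n_lt => y z ? ? ?; lra.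
have gd : gam < del by have := normr_ge0 (h * (w 0).+1%:R - x1); move: d1 gam_del; lra.
have := le_kmax kmax; rewrite leqnn => /esym /and3P[/andP[k1 l1] /andP[k2 l2] /andP[k3 l3]].
have ks_itv : (K <= ks <= kmax)%N by rewrite Kks ksk.
apply: (ln_sum_jones_term_bound n_gt0 eps_gt0 h_del sf_lobachevsky lobachevsky_eps r_eps K2 X1 X2 X3
  (lt_trans d1 gd) (lt_trans d2 gd) (lt_trans d3 gd) k1 k2 k3 l1 l2 l3 ks_itv eps_le potential_le).
have hk0 : 0 <= h * ks%:R by rewrite mulr_ge0// ltW.
have hk4 : 0 <= h * ks%:R <= 4.
  by rewrite hk0 /=; move: (h * ks%:R) ks1 pi_lt4 => y; lra.
have hkt : 2 * `|h * ks%:R - (pi - theta)| < del.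
  rewrite ler0_norm; last by rewrite subr_le0.
  move: ks2; rewrite -natr1 mulrDr mulr1; move: (h * ks%:R) h_gt0 h_del => y; lra.
have := potential_eps_le hk4 hkt; rewrite potentialBpi ler_norml -/P => /andP[+ _].
move: (potential _ _ _ (h * _)) P => u q; lra.
Qed.
End FixedLevel.

Lemma is_theta_B_of_tan (al : 'I_3 -> R) th : 0 < th < pi / 2 ->
  tan th ^+ 4 - (tan (al 0 / 2) ^+ 2 + tan (al 1 / 2) ^+ 2 + tan (al 2%:R / 2) ^+ 2 + 1) * tan th ^+ 2
    - tan (al 0 / 2) ^+ 2 * tan (al 1 / 2) ^+ 2 * tan (al 2%:R / 2) ^+ 2 = 0 ->
  is_theta_B al th.
Proof.
move=> th_itv E; split=> //; rewrite -[RHS]E !big_ord_recl !big_ord0.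
rewrite (_ : lift ord0 (lift ord0 ord0) = 2%:R :> 'I_3); last exact/val_inj.
rewrite (_ : lift ord0 ord0 = 1 :> 'I_3); last exact/val_inj.
by rewrite (_ : ord0 = 0 :> 'I_3) //; ring.
Qed.

(** With N = w + 1 and j = w / 2, the angle h N equals 4 pi j / r + h. *)
Lemma near_colour (w : nat -> nat) (l e : R) :
  (fun n : nat => weight_val R (w n) / (2 * n + 1)%:R) @ \oo --> l -> 0 < e ->
  \forall n \near \oo, `|hn n * (w n).+1%:R - 4 * pi * l| < e.
Proof.
move=> wl e0; have p0 := pi_gt0 R.
have e1 : 0 < e / (8 * pi) by rewrite divr_gt0// mulr_gt0.
have e2 : 0 < e / 2 by rewrite divr_gt0.
have /cvgrPdist_lt/(_ _ e1) := wl; have := near_hn_lt e2.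
apply: filterS2 => n [_ + _] /=.
have -> : hn n * (w n).+1%:R - 4 * pi * l
    = hn n - 4 * pi * (l - weight_val R (w n) / (2 * n + 1)%:R).
  have : (2 * n + 1)%:R != 0 :> R by rewrite pnatr_eq0 addn1.
  rewrite /qangle /weight_val -[(w n).+1%:R]natr1; move: (2 * n + 1)%:R (w n)%:R => r v r0.
  by field.
move: (l - _) => d h1 h2; apply: le_lt_trans (ler_normB _ _) _.
have h0 : 0 < hn n by exact: qangle_gt0.
rewrite (gtr0_norm h0) normrM gtr0_norm; last by rewrite mulr_gt0.
rewrite ltr_pdivlMr ?mulr_gt0// in h2.
by move: `|d| h2 => z h2; lra.
Qed.
End Limit.

Theorem theorem1p4 (R : realType) (Hmednykh : mednykh_formula R)
    (al : 'I_3 -> R) (Hal : Omega0 al)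
    (a : nat -> 'I_3 -> nat) (L : 'I_3 -> R)
    (Ha : forall n : nat, (1 <= n)%N ->
       forall i, is_weight (2 * n + 1)%N (a n i))
    (HL : forall i,
       (fun n : nat => weight_val R (a n i) / (2 * n + 1)%:R) @ \oo --> L i)
    (HLal : forall i, `|8 * pi * L i - 2 * pi| = al i) :
  (fun n : nat => 4 * pi / (2 * n + 1)%:R
     * ln (Normc.normc (borromean_jones R (2 * n + 1)%N (a n)))) @ \oo
    --> borromean_volume al.
Proof.
have cone := Hal.1.
pose b i := al i / 2.
have b_itv i : 0 <= b i /\ b i < pi / 2.
  by have /andP[? ?] := cone i; rewrite /b; split; lra.
pose m := Num.max (b 0) (Num.max (b 1) (b 2%:R)).
have b0m : b 0 <= m by rewrite /m le_max lexx.
have b1m : b 1 <= m by rewrite /m !le_max lexx orbT.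
have b2m : b 2%:R <= m by rewrite /m !le_max lexx !orbT.
have m_max : m = b 0 \/ m = b 1 \/ m = b 2%:R.
  by rewrite /m /Num.max; case: ifP => _; [case: ifP => _|]; auto.
have m2 : m < pi / 2 by have [->|[->|->]] := m_max; exact: (b_itv _).2.
have [b0 b1] := b_itv 0; have [c0 c1] := b_itv 1; have [d0 d1] := b_itv 2%:R.
have [th th_itv th_eq] := theta_exists (tan (b 0)) (tan (b 1)) (tan (b 2%:R)).
have m_th := lt_theta b0 c0 d0 b0m b1m b2m m2 m_max th_itv th_eq.
have P_lt0 := potential_theta_lt0 b0 c0 d0 b0m b1m b2m m2 m_max th_itv th_eq.
have P_min := potential_theta_le b0 c0 d0 b0m b1m b2m m2 m_max th_itv th_eq.
rewrite (Hmednykh al th cone (is_theta_B_of_tan th_itv th_eq)) mednykh_potential -!/(b _).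
set P := potential _ _ _ th in P_lt0 P_min *.
apply/cvgrPdist_lt => e e0.
(* Only 57 eps <= - P and 2 * 34 eps < e are needed; the 2 arises from 4 pi / r = 2 h. *)
pose eps := Num.min (e / 100) (- P / 100).
have eps0 : 0 < eps by rewrite lt_min !divr_gt0// oppr_gt0.
have epse : eps <= e / 100 by rewrite ge_min lexx.
have epsP : eps <= - P / 100 by rewrite ge_min lexx orbT.
have [del del0 Hdel] := lobachevsky_unif 10 eps0.
pose gam := Num.min (del / 2) (th - m).
have gam0 : 0 < gam by rewrite lt_min divr_gt0// subr_gt0.
have gamd : gam <= del / 2 by rewrite ge_min lexx.
have gamt : gam <= th - m by rewrite ge_min lexx orbT.
(* 20 = 16 + 4, since h ln (16 r^4) is at most 16 h + 4 h ln r; the second bound gives 4 h < del. *)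
pose eta := Num.min (eps / 20) (del / 4).
have eta0 : 0 < eta by rewrite lt_min !divr_gt0.
have etae : eta <= eps / 20 by rewrite ge_min lexx.
have etad : eta <= del / 4 by rewrite ge_min lexx orbT.
have X i : `|4 * pi * L i - pi| = b i.
  rewrite /b -HLal (_ : 4 * pi * L i - pi = (8 * pi * L i - 2 * pi) / 2); last by field.
  by rewrite normf_div [`|2|]gtr0_norm.
near=> n.
have [n0 hn1 hn2] : [/\ (0 < n)%N, qangle (2 * n + 1) < eta & qangle (2 * n + 1) * ln (2 * n + 1)%:R < eta].
  by near: n; exact: near_hn_lt.
have Hsf : forall m, (m < 2 * n + 1)%N ->
    `|qangle (2 * n + 1) * ln `|sf (qangle (2 * n + 1)) m| + lobachevsky (qangle (2 * n + 1) * m%:R)| <= eps.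
  by near: n; exact: near_sf_lobachevsky.
have D0 : `|qangle (2 * n + 1) * (a n 0).+1%:R - 4 * pi * L 0| < gam by near: n; exact: near_colour.
have D1 : `|qangle (2 * n + 1) * (a n 1).+1%:R - 4 * pi * L 1| < gam by near: n; exact: near_colour.
have D2 : `|qangle (2 * n + 1) * (a n 2%:R).+1%:R - 4 * pi * L 2%:R| < gam by near: n; exact: near_colour.
have r_eps : qangle (2 * n + 1) * ln (16 * (2 * n + 1)%N%:R ^+ 4) <= eps.
  have r0 : 0 < (2 * n + 1)%N%:R :> R by rewrite ltr0n addn1.
  have l16 := ln_sublinear (ltr0n R 16).
  have h0 : 0 < qangle (2 * n + 1) :> R by exact: qangle_gt0.
  rewrite lnM ?posrE ?exprn_gt0// lnXn// mulrDr -[X in _ + _ * X]mulr_natl [_ * (4%:R * _)]mulrCA.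
  have : qangle (2 * n + 1) * ln 16 <= qangle (2 * n + 1) * 16 :> R.
    by rewrite ler_pM2l// ltW.
  move: (qangle _) (qangle _ * ln _) (qangle _ * ln _) hn1 hn2 => z u v; lra.
have := ln_jones_bound n0 eps0 _ Hsf Hdel r_eps b0 c0 d0 b0m b1m b2m m2 m_max th_itv m_th P_min
  _ (X 0) (X 1) (X 2%:R) _ gamt D0 D1 D2 (Ha n n0).
have -> : 4 * pi / (2 * n + 1)%:R = 2 * qangle (2 * n + 1) :> R.
  by rewrite /qangle; ring.
rewrite -/P; move: (qangle _) (ln _) hn1 => z v hn1 H.
have {}H := H ltac:(lra) ltac:(lra) ltac:(lra).
rewrite -mulrA; move: (z * v) H => y; rewrite ler_norml ltr_norml => /andP[? ?].
by apply/andP; split; lra.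
Unshelve. all: by end_near. Qed.
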